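(* Let $\pi$ be an exterior order-$q$-subplane of $\mathrm{PG}(2,q^3)$ with conic cover $\mathbb C$, and let $\mathcal C$ be an irreducible conic of $\pi$. Then $\mathcal C$ is a $(\pi,\ell_\infty)$-special conic of $\pi$ if and only if in $\mathrm{PG}(6,q)$, $[\mathcal C]$ is a $\mathbb C$-special twisted cubic. Otherwise, $[\mathcal C]$ is a $6$-dimensional normal rational curve of $\mathrm{PG}(6,q)$.
   Context: Bruck-Bose representation. $q$ is a prime power. $\Sigma_\infty\cong\mathrm{PG}(5,q)$ is a hyperplane of $\mathrm{PG}(6,q)$ and $\mathcal S$ is a regular $2$-spread of $\Sigma_\infty$: a set of $q^3+1$ planes partitioning the points of $\Sigma_\infty$ and containing the $2$-regulus through any three of its planes. (A $2$-regulus is a set of $q+1$ mutually disjoint planes such that any line meeting three of them meets all.) The points of $\mathrm{PG}(6,q)\setminus\Sigma_\infty$, together with the $3$-spaces not in $\Sigma_\infty$ that contain a plane of $\mathcal S$ as lines, form an affine plane whose projective completion $\mathcal P(\mathcal S)$ is $\mathrm{PG}(2,q^3)$; points of the line at infinity $\ell_\infty$ correspond to planes of $\mathcal S$. For a set $X$ of points of $\mathrm{PG}(2,q^3)$, $[X]$ is the corresponding set in $\mathrm{PG}(6,q)$. Curves. A $d$-dimensional normal rational curve (here $d=6$, or $d=3$ for a twisted cubic) is a set of points $\{(f_0(\theta),\ldots,f_6(\theta)):\theta\in\mathbb F_q\cup\{\infty\}\}$ of $\mathrm{PG}(6,q)$, where $f_0,\ldots,f_6$ are polynomials over $\mathbb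 F_q$ of degree at most $d$ (read as binary forms of degree $d$) spanning the $(d+1)$-dimensional space of all such polynomials. Its extension to $\mathrm{PG}(6,q^3)$ uses the same parametrisation with $\theta\in\mathbb F_{q^3}\cup\{\infty\}$. An irreducible conic of $\pi$ is parametrised by $\theta\in\mathbb F_q\cup\{\infty\}$ by quadratic forms, and the curve $[\mathcal C]$ is taken with the induced parametrisation. Subplanes and splashes. An order-$q$-subplane of $\mathrm{PG}(2,q^3)$ is an image of $\mathrm{PG}(2,q)$ under $\mathrm{PGL}(3,q^3)$; it is exterior if it has no point on $\ell_\infty$. The exterior splash $\mathbb S$ of an exterior order-$q$-subplane $\pi$ is the set of $q^2+q+1$ points of $\ell_\infty$ lying on extended lines of $\pi$; it is identified with the corresponding set of $q^2+q+1$ planes of $\mathcal S$. Special conics. Let $m,n$ be the two conjugates of $\ell_\infty$ with respect to $\pi$ (if $\pi=\phi(\mathrm{PG}(2,q))$, conjugation is $\phi\circ\mathrm{Frob}_q\circ\phi^{-1}$) and $E_1=\ell_\infty\cap m$, $E_2=\ell_\infty\cap n$, $E_3=m\cap n$. A $(\pi,\ell_\infty)$-special conic is a conic of $\pi$ (given by a quadratic equation over $\mathbb F_q$ in coordinates in which $\pi=\mathrm{PG}(2,q)$) whose extension to $\mathrm{PG}(2,q^3)$ (same equation) contains $E_1,E_2,E_3$. Covers. $\mathbb S$ has exactly two covers: sets of $q^2+q+1$ mutually disjoint planes of $\Sigma_\infty$ covering the same points as the planes of $\mathbb S$ and each meeting every plane of $\mathbb S$ in exactly one point. Planes from different covers meet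 in exactly one point. Each cover $\mathbb X$ has exactly three transversal lines: lines $g,g^q,g^{q^2}$ of the cubic extension $\mathrm{PG}(5,q^3)$ of $\Sigma_\infty$, conjugate under the $q$-Frobenius map and disjoint from $\Sigma_\infty$, that meet the extension of every plane of $\mathbb X$. Tangent and conic cover. For a line $\ell$ of $\pi$, $[\ell]$ (the $q+1$ points of $\pi$ on $\ell$) is a twisted cubic. For $P\in\pi$, the $q+1$ tangent lines at $P$ to the twisted cubics $[\ell]$, $\ell$ a line of $\pi$ through $P$, lie in a plane $\mathcal T_P$, and the line $\mathcal T_P\cap\Sigma_\infty$ lies in a plane of one of the two covers, the same cover for every $P\in\pi$. This cover is the tangent cover $\mathbb T$ of $\pi$; the other one is the conic cover $\mathbb C$ of $\pi$. Special twisted cubics. For a cover $\mathbb X$ of an exterior splash, an $\mathbb X$-special twisted cubic is a twisted cubic $\mathcal N$ in a $3$-space of $\mathrm{PG}(6,q)$, not contained in $\Sigma_\infty$, through a plane of $\mathbb X$, such that the extension of $\mathcal N$ to $\mathrm{PG}(6,q^3)$ meets the three transversal lines of $\mathbb X$. *)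

(* Defs.v *)
From HB Require Import structures.
From mathcomp Require Import all_boot all_order all_algebra all_field.
From mathcomp Require Import boolp classical_sets functions cardinality.

Set Implicit Arguments.
Unset Strict Implicit.
Unset Printing Implicit Defensive.

Import GRing.Theory.
Local Open Scope card_scope.
Local Open Scope classical_set_scope.
Local Open Scope ring_scope.

(* PG(n, K) is the lattice of vector subspaces of K^(n+1); a subspace of
   projective dimension k has vector dimension k + 1, incidence is inclusion
   of subspaces, and two subspaces are disjoint in PG(n, K) when their
   vector-space intersection is 0. *)
Definition flat (K : fieldType) (n k : nat) : set {vspace 'rV[K]_n.+1} :=
  [set U | \dim U = k.+1].
Arguments flat {K n} k U.

Definition pairwise_disjoint (K : fieldType) (n : nat)
    (R : set {vspace 'rV[K]_n}) : Prop :=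
  forall A B, R A -> R B -> A <> B -> (A :&: B = 0)%VS.

Definition intersects (K : fieldType) (n : nat) (U V : {vspace 'rV[K]_n}) : bool :=
  (U :&: V)%VS != 0%VS.

(* The subspace spanned by the coordinatewise image of U under a field
   morphism f (independent of the chosen basis). *)
Definition mapv (K1 K2 : fieldType) (n : nat) (f : K1 -> K2)
    (U : {vspace 'rV[K1]_n}) : {vspace 'rV[K2]_n} :=
  <<[seq map_mx f v | v <- vbasis U]>>%VS.

Definition ext (F : finFieldType) (L : fieldExtType F) (n : nat)
    (U : {vspace 'rV[F]_n}) : {vspace 'rV[L]_n} :=
  mapv (in_alg L) U.
Arguments ext {F} L {n} U.

Definition regulus (F : finFieldType) (Sigma : {vspace 'rV[F]_7})
    (R : set {vspace 'rV[F]_7}) : Prop :=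
  [/\ forall A, R A -> flat 2 A /\ (A <= Sigma)%VS,
      R #= `I_(#|F|.+1),
      pairwise_disjoint R
    & forall l, flat 1 l -> forall A B C, R A -> R B -> R C ->
        A <> B -> A <> C -> B <> C ->
        intersects l A -> intersects l B -> intersects l C ->
        forall D, R D -> intersects l D].

Definition regular_spread (F : finFieldType) (Sigma : {vspace 'rV[F]_7})
    (S : set {vspace 'rV[F]_7}) : Prop :=
  [/\ forall A, S A -> flat 2 A /\ (A <= Sigma)%VS,
      S #= `I_((#|F| ^ 3).+1),
      forall P, flat 0 P -> (P <= Sigma)%VS ->
        exists! A, S A /\ (P <= A)%VS
    & forall A B C, S A -> S B -> S C -> A <> B -> A <> C -> B <> C ->
        exists R, [/\ regulus Sigma R, R A, R B, R C & R `<=` S]].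

(* The projective plane P(S).  The points at infinity are the elements of S,
   the line at infinity is represented by Sigma, and incidence is inclusion:
   a 3-space through an element of S and not in Sigma contains no other
   element of S. *)
Definition bb_points (F : finFieldType) (Sigma : {vspace 'rV[F]_7})
    (S : set {vspace 'rV[F]_7}) : set {vspace 'rV[F]_7} :=
  [set P | flat 0 P /\ ~~ (P <= Sigma)%VS] `|` S.

Definition bb_lines (F : finFieldType) (Sigma : {vspace 'rV[F]_7})
    (S : set {vspace 'rV[F]_7}) : set {vspace 'rV[F]_7} :=
  [set U | [/\ flat 3 U, ~~ (U <= Sigma)%VS & exists2 A, S A & (A <= U)%VS]]
    `|` [set Sigma].

(* The identification of PG(2, q^3) with P(S) is given by linear coordinates:
   G is the matrix of an F-linear map x |-> x G from F^7 to L^3, and the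
   element of P(S) corresponding to a point or line U of PG(2, q^3) is the
   F-subspace of all x with x G in U.  With l a linear form of kernel linf
   scaled so that the image of G is {v | l v in F}, this is the usual
   (x, y, 1) <-> (x_0, x_1, x_2, y_0, y_1, y_2, 1). *)
Definition bb (F : finFieldType) (L : fieldExtType F) (G : 'M[L]_(7, 3))
    (U : {vspace 'rV[L]_3}) : {vspace 'rV[F]_7} :=
  <<enum [pred x : 'rV[F]_7 | map_mx (in_alg L) x *m G \in U]>>%VS.

Definition bruck_bose (F : finFieldType) (L : fieldExtType F)
    (Sigma : {vspace 'rV[F]_7}) (S : set {vspace 'rV[F]_7})
    (linf : {vspace 'rV[L]_3}) (G : 'M[L]_(7, 3)) : Prop :=
  [/\ set_bij (flat 0) (bb_points Sigma S) (bb G),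
      set_bij (flat 1) (bb_lines Sigma S) (bb G),
      forall P l, flat 0 P -> flat 1 l ->
        (bb G P <= bb G l)%VS = (P <= l)%VS
    & bb G linf = Sigma].

(* The projectivity v |-> v M of PG(2, q^3).  Below, M always represents the
   order-q-subplane that is the image of PG(2, q) under it. *)
Definition pgl (K : fieldType) (n : nat) (M : 'M[K]_n)
    (U : {vspace 'rV[K]_n}) : {vspace 'rV[K]_n} :=
  (linfun (mulmxr M : 'rV[K]_n -> 'rV[K]_n) @: U)%VS.

Definition subplane (F : finFieldType) (L : fieldExtType F) (M : 'M[L]_3) :
    set {vspace 'rV[L]_3} :=
  [set pgl M (ext L p) | p in flat 0].

Definition subplane_lines (F : finFieldType) (L : fieldExtType F)
    (M : 'M[L]_3) : set {vspace 'rV[L]_3} :=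
  [set pgl M (ext L l) | l in flat 1].

Definition exterior (F : finFieldType) (L : fieldExtType F)
    (linf : {vspace 'rV[L]_3}) (M : 'M[L]_3) : Prop :=
  forall P, subplane M P -> ~~ (P <= linf)%VS.

Definition splash (F : finFieldType) (L : fieldExtType F)
    (linf : {vspace 'rV[L]_3}) (M : 'M[L]_3) : set {vspace 'rV[L]_3} :=
  [set P | [/\ flat 0 P, (P <= linf)%VS
             & exists2 l, subplane_lines M l & (P <= l)%VS]].

Definition conjugate (F : finFieldType) (L : fieldExtType F) (M : 'M[L]_3)
    (U : {vspace 'rV[L]_3}) : {vspace 'rV[L]_3} :=
  pgl M (mapv (fun x => x ^+ #|F|) (pgl (invmx M) U)).

(* Every quadratic form in three variables is v |-> v A v^T for some matrix A,
   in any characteristic; A need not be symmetric. *)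
Definition qform (R : comNzRingType) (A : 'M[R]_3) (v : 'rV[R]_3) : R :=
  (v *m A *m v^T) 0 0.

Definition qpoints (K : fieldType) (A : 'M[K]_3) : set {vspace 'rV[K]_3} :=
  [set p | flat 0 p /\ forall v, v \in p -> qform A v = 0].

(* Irreducibility is over every extension of F.  A quadratic form is
   determined by its values, so this pointwise factorisation is one of
   polynomials, even over small fields. *)
Definition irreducible_conic (F : finFieldType) (A : 'M[F]_3) : Prop :=
  forall (K : fieldExtType F) (a b : 'cV[K]_3),
    ~ (forall v : 'rV[K]_3,
         qform (map_mx (in_alg K) A) v = (v *m a) 0 0 * (v *m b) 0 0).

Definition conic (F : finFieldType) (L : fieldExtType F) (M : 'M[L]_3)
    (A : 'M[F]_3) : set {vspace 'rV[L]_3} :=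
  [set pgl M (ext L p) | p in qpoints A].

Definition conic_ext (F : finFieldType) (L : fieldExtType F) (M : 'M[L]_3)
    (A : 'M[F]_3) : set {vspace 'rV[L]_3} :=
  [set pgl M P | P in qpoints (map_mx (in_alg L) A)].

Definition special_conic (F : finFieldType) (L : fieldExtType F)
    (linf : {vspace 'rV[L]_3}) (M : 'M[L]_3) (A : 'M[F]_3) : Prop :=
  let m := conjugate M linf in
  let n := conjugate M m in
  [/\ conic_ext M A (linf :&: m)%VS,
      conic_ext M A (linf :&: n)%VS
    & conic_ext M A (m :&: n)%VS].

(* A curve of degree at most d in PG(n, F) is given by n + 1 polynomials of
   degree at most d, i.e. of size at most d + 1.  The parameter None is
   infinity, where the associated binary form of degree d takes the value of
   the coefficient of degree d.  The curve is considered over a field K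
   containing F by iota. *)
Definition crow (F K : fieldType) (iota : {rmorphism F -> K}) (n d : nat)
    (f : n.-tuple {poly_d.+1 F}) : 'rV[{poly K}]_n :=
  \row_j map_poly iota (tnth f j : {poly F}).

Definition cval (F K : fieldType) (iota : {rmorphism F -> K}) (n d : nat)
    (f : n.-tuple {poly_d.+1 F}) (t : option K) : 'rV[K]_n :=
  map_mx (fun p : {poly K} => if t is Some x then p.[x] else p`_d)
    (crow iota f).

Definition cpoint (F K : fieldType) (iota : {rmorphism F -> K}) (n d : nat)
    (f : n.-tuple {poly_d.+1 F}) (t : option K) : {vspace 'rV[K]_n} :=
  <[cval iota f t]>%VS.

Definition curve (F : fieldType) (n d : nat) (f : n.-tuple {poly_d.+1 F}) :
    set {vspace 'rV[F]_n} :=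
  range (cpoint idfun f).

Definition curve_ext (F : finFieldType) (L : fieldExtType F) (n d : nat)
    (f : n.-tuple {poly_d.+1 F}) : set {vspace 'rV[L]_n} :=
  range (cpoint (in_alg L) f).
Arguments curve_ext {F} L {n d} f.

Definition normal_rational_curve (F : finFieldType) (n d : nat)
    (f : n.-tuple {poly_d.+1 F}) : Prop :=
  <<f>>%VS = fullv.

(* The tangent line at parameter t, spanned by f(t) and f'(t); at infinity,
   the derivative in the local parameter 1/theta is the coefficient of degree
   d - 1. *)
Definition tangent_line (F : finFieldType) (n d : nat)
    (f : n.-tuple {poly_d.+1 F}) (t : option F) : {vspace 'rV[F]_n} :=
  (<[cval idfun f t]> +
   <[map_mx (fun p : {poly F} => if t is Some x then p^`().[x] else p`_d.-1)
       (crow idfun f)]>)%VS.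

(* c parametrises the point set X of the subplane M by forms of degree e,
   and f is the parametrisation of [X] induced by c: f(theta) G and
   c(theta) M are proportional over L(theta).  For small q the latter does
   not follow from the values at the q + 1 parameters in PG(1, q). *)
Definition induced_param (F : finFieldType) (L : fieldExtType F)
    (G : 'M[L]_(7, 3)) (M : 'M[L]_3) (X : set {vspace 'rV[L]_3}) (e d : nat)
    (c : 3.-tuple {poly_e.+1 F}) (f : 7.-tuple {poly_d.+1 F}) : Prop :=
  let u := crow (in_alg L) f *m map_mx polyC G in
  let w := crow (in_alg L) c *m map_mx polyC M in
  [/\ [set pgl M (ext L p) | p in curve c] = X,
      curve f = bb G @` X
    & forall i j, u 0 i * w 0 j = u 0 j * w 0 i].

Definition bb_line_param (F : finFieldType) (L : fieldExtType F)
    (G : 'M[L]_(7, 3)) (M : 'M[L]_3) (l : {vspace 'rV[L]_3}) (d : nat)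
    (f : 7.-tuple {poly_d.+1 F}) : Prop :=
  exists c : 3.-tuple {poly_2 F},
    induced_param G M [set P | subplane M P /\ (P <= l)%VS] c f.

(* The parametrisation of the conic satisfies its equation identically. *)
Definition bb_conic_param (F : finFieldType) (L : fieldExtType F)
    (G : 'M[L]_(7, 3)) (M : 'M[L]_3) (A : 'M[F]_3) (d : nat)
    (f : 7.-tuple {poly_d.+1 F}) : Prop :=
  exists2 c : 3.-tuple {poly_3 F},
    qform (map_mx polyC A) (crow idfun c) = 0
    & induced_param G M (conic M A) c f.

Definition splash_cover (F : finFieldType) (L : fieldExtType F)
    (Sigma : {vspace 'rV[F]_7}) (linf : {vspace 'rV[L]_3})
    (G : 'M[L]_(7, 3)) (M : 'M[L]_3) (X : set {vspace 'rV[F]_7}) : Prop :=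
  let SS := bb G @` splash linf M in
  [/\ forall A, X A -> flat 2 A /\ (A <= Sigma)%VS,
      X #= `I_(#|F| ^ 2 + #|F| + 1)%N,
      pairwise_disjoint X,
      forall P, flat 0 P -> (exists2 A, X A & (P <= A)%VS) <->
                            (exists2 B, SS B & (P <= B)%VS)
    & forall A B, X A -> SS B -> flat 0 (A :&: B)%VS].

Definition transversal_line (F : finFieldType) (L : fieldExtType F)
    (Sigma : {vspace 'rV[F]_7}) (X : set {vspace 'rV[F]_7})
    (g : {vspace 'rV[L]_7}) : Prop :=
  [/\ flat 1 g, (g <= ext L Sigma)%VS,
      forall P, flat 0 P -> (P <= Sigma)%VS -> ~~ (ext L P <= g)%VS
    & forall A, X A -> intersects g (ext L A)].

Definition tangent_at (F : finFieldType) (L : fieldExtType F)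
    (G : 'M[L]_(7, 3)) (M : 'M[L]_3) (P : {vspace 'rV[L]_3})
    (tl : {vspace 'rV[F]_7}) : Prop :=
  exists (l : {vspace 'rV[L]_3}) (f : 7.-tuple {poly_4 F}) (t : option F),
    [/\ subplane_lines M l /\ (P <= l)%VS,
        normal_rational_curve f, bb_line_param G M l f,
        cpoint idfun f t = bb G P
      & tl = tangent_line f t].

Definition tangent_cover (F : finFieldType) (L : fieldExtType F)
    (Sigma : {vspace 'rV[F]_7}) (linf : {vspace 'rV[L]_3})
    (G : 'M[L]_(7, 3)) (M : 'M[L]_3) (T : set {vspace 'rV[F]_7}) : Prop :=
  splash_cover Sigma linf G M T /\
  forall P, subplane M P ->
    exists TP : {vspace 'rV[F]_7},
      [/\ flat 2 TP, forall tl, tangent_at G M P tl -> (tl <= TP)%VS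
        & exists2 A, T A & (TP :&: Sigma <= A)%VS].

Definition conic_cover (F : finFieldType) (L : fieldExtType F)
    (Sigma : {vspace 'rV[F]_7}) (linf : {vspace 'rV[L]_3})
    (G : 'M[L]_(7, 3)) (M : 'M[L]_3) (C : set {vspace 'rV[F]_7}) : Prop :=
  splash_cover Sigma linf G M C /\
  exists2 T, tangent_cover Sigma linf G M T & C <> T.

(* That the cubic lies in the 3-space U is required of its extension, since
   for q = 2 its three points do not span U. *)
Definition special_twisted_cubic (F : finFieldType) (L : fieldExtType F)
    (Sigma : {vspace 'rV[F]_7}) (X : set {vspace 'rV[F]_7})
    (f : 7.-tuple {poly_4 F}) : Prop :=
  normal_rational_curve f /\
  exists U : {vspace 'rV[F]_7},
    [/\ flat 3 U, ~~ (U <= Sigma)%VS, exists2 A, X A & (A <= U)%VS,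
        forall P, curve_ext L f P -> (P <= ext L U)%VS
      & forall g, transversal_line Sigma X g ->
          exists2 P, curve_ext L f P & (P <= g)%VS].
Arguments special_twisted_cubic {F} L Sigma X f.

(* Main.v *)
(* Choose coordinates X_0, X_1, X_2 of PG(2, q^3) in which pi is the set of
   points (x, x^q, x^(q^2)), l_infinity is X_0 = 0 and its conjugates are
   X_1 = 0 and X_2 = 0; in PG(6, q) the coordinate X_0 is F-valued.  The splash
   consists of the planes X_1 = k X_2 with N(k) = -1, that is k = - z^q / z.
   A plane of a cover is the graph of a linearised polynomial
   al x + be x^q + ga x^(q^2) whose difference with each such k is singular;
   its Dickson determinant, a polynomial in k of degree at most q^2 + q, then
   vanishes identically, so al = 0 and be ga = 0.  Hence the two covers are
   {X_1 = k X_2^q} and {X_1 = k X_2^(q^2)}, and the tangents of pi lie in the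
   first one.

   If p(theta) is the coordinate x on a parametrised conic, then p, p^q and
   p^(q^2) are quadratic, and the conic is special iff p and p^q have a common
   root t.  Multiplying (p, p^q, p^(q^2)) by h = p^q p^(q^2) makes X_0 rational.
   If there is no common root this curve has degree 6 and no lift has smaller
   degree, since p, p^q and p^(q^2) all divide the rational coordinate.
   Otherwise p = k (theta - t) (theta - t^(q^2)), and h = k^-1 (theta - t^q)
   already suffices; the resulting cubic has only one pair of coordinates
   (X_1, X_2^(q^2)) and conjugates non-zero at each of t, t^q, t^(q^2), which
   places these points on the transversals of the second cover. *)
Require Import Defs.
From HB Require Import structures.
From mathcomp Require Import all_boot all_order all_algebra all_field.
From mathcomp Require Import boolp classical_sets functions cardinality.
From mathcomp Require Import all_solvable ring zify.

Set Implicit Arguments.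
Unset Strict Implicit.
Unset Printing Implicit Defensive.

Import GRing.Theory.
Local Open Scope classical_set_scope.
Local Open Scope ring_scope.

(** * The Frobenius map of the cubic extension *)

(** The field [F] may be as small as GF(2), where the points of a curve over [F] carry little
    information. The shape of the cover planes, the tangent cover and the transversal lines are
    therefore settled by identities valid for all z in [L]: a polynomial of degree below q^3
    vanishing on [L] is zero, and k = - z^(q-1) turns a polynomial of degree at most q^2 + q in k
    into one of degree at most q^3 - q in z.

    Normality is proved dually. A functional over [F] that kills the coordinates of a lift, extended
    to [L], commutes with Frobenius on coefficients. Its kernel contains h times every form of the
    degree of the original curve, hence also the conjugates of these products, and coprimality makes
    them fill the whole space.

    A conic comes as an equation, so a rational point must be produced before it can be
    parametrised. In the converse the cubic arrives with a parametrisation of its own; that the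
    points of the conic are not collinear shows that this one, too, spans all quadratic forms. *)

Lemma sum3E (V : nmodType) (E : 'I_3 -> V) : \sum_i E i = E 0 + E 1 + E 2.
Proof.
rewrite !big_ord_recl big_ord0 addr0 addrA.
by congr (E _ + E _ + E _); apply/val_inj.
Qed.

Lemma ord3P (P : 'I_3 -> Prop) : P 0 -> P 1 -> P 2 -> forall i, P i.
Proof.
move=> P0 P1 P2 [[|[|[|//]]] lti].
- by rewrite (_ : Ordinal lti = 0) //; apply/val_inj.
- by rewrite (_ : Ordinal lti = 1) //; apply/val_inj.
- by rewrite (_ : Ordinal lti = 2) //; apply/val_inj.
Qed.

Definition row3 (T : Type) (a b c : T) : 'rV[T]_3 :=
  \row_j (if j == 0 :> nat then a else if j == 1%N :> nat then b else c).

Lemma row3E (T : Type) (v : 'rV[T]_3) : v = row3 (v 0 0) (v 0 1) (v 0 2).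
Proof. by apply/rowP; elim/ord3P; rewrite mxE /=. Qed.

Lemma row3P (T : Type) (u v : 'rV[T]_3) :
  u 0 0 = v 0 0 -> u 0 1 = v 0 1 -> u 0 2 = v 0 2 -> u = v.
Proof. by rewrite [u]row3E [v]row3E !mxE /= => -> -> ->. Qed.

Section Frobenius.
Variables (F : finFieldType) (L : fieldExtType F).

Definition frob (x : L) : L := x ^+ #|F|.


Lemma frobD x y : frob (x + y) = frob x + frob y.
Proof.
have [p p_pr pcharFp] := finPcharP F.
have pcharLp : p \in [pchar L] by rewrite (fmorph_pchar (in_alg L)).
apply: exprDn_pchar; rewrite (eq_pnat _ (pcharf_eq pcharLp)) -cardsT.
exact: abelem_pgroup (fin_ring_pchar_abelem pcharFp).
Qed.

Lemma frob_zmod : zmod_morphism frob.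
Proof. by move=> x y; apply/eqP; rewrite eq_sym subr_eq -frobD subrK. Qed.

Lemma frob_monoid : monoid_morphism frob.
Proof. by split=> [|x y]; rewrite /frob ?expr1n ?exprMn. Qed.

HB.instance Definition _ := GRing.isZmodMorphism.Build L L frob frob_zmod.
HB.instance Definition _ := GRing.isMonoidMorphism.Build L L frob frob_monoid.

Lemma frob_alg (b : F) : frob b%:A = b%:A.
Proof. by rewrite /frob -in_algE -rmorphXn /= expf_card. Qed.

Lemma frob_fixed x : frob x = x -> exists b : F, x = b%:A.
Proof.
move=> frobx; apply/vlineP; rewrite -[<[_]>%VS]/(1%AS : {vspace L}).
by rewrite Fermat's_little_theorem dimv1 expn1 -[_ ^+ _]/(frob x) frobx.
Qed.

Lemma frob_eq0 x : (frob x == 0) = (x == 0).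
Proof. exact: fmorph_eq0. Qed.

Hypothesis hL : \dim {:L} = 3%N.

Lemma frob3 x : frob (frob (frob x)) = x.
Proof.
rewrite /frob -!exprM; apply/eqP.
have := Fermat's_little_theorem (fullv : {subfield L}) x.
by rewrite memvf hL !expnS expn0 muln1 mulnA => <-.
Qed.

Lemma card_L : #|finvect_type L| = (#|F| ^ 3)%N.
Proof.
pose cL := Vector.class (finvect_type L : vectType F).
by rewrite -(card_vspacef cL) card_vspace hL.
Qed.


Lemma poly_vanish (p : {poly L}) :
  (size p <= #|F| ^ 3)%N -> (forall x, p.[x] = 0) -> p = 0.
Proof.
move=> sp p0; apply/eqP; apply/negPn/negP => nzp.
pose rs : seq L := enum (finvect_type L).
have srs : size rs = (#|F| ^ 3)%N by rewrite -card_L cardE.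
have urs : uniq rs by exact: (enum_uniq (finvect_type L)).
have := max_poly_roots nzp _ urs; rewrite srs ltnNge sp => /(_ _)/negP[] //.
by apply/allP => x _; rewrite /root p0.
Qed.

(** The left side is the value at [y] of a polynomial of degree at most q^2 < q^3, which is
    therefore zero; the exponents 1, q, q^2 are distinct. *)
Lemma frob_indep (al be ga : L) :
  (forall y, al * y + be * frob y + ga * frob (frob y) = 0) ->
  [/\ al = 0, be = 0 & ga = 0].
Proof.
move=> h; have q_gt1 := finNzRing_gt1 F.
set q := #|F| in q_gt1.
pose p : {poly L} := al *: 'X + be *: 'X^q + ga *: 'X^(q ^ 2).
have p0 : p = 0.
  apply: poly_vanish => [|x].
    rewrite (leq_trans (size_polyD _ _)) // geq_max.
    rewrite (leq_trans (size_polyD _ _)) ?geq_max.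
      rewrite (leq_trans (size_scale_leq _ _)) ?size_polyXn //.
      by rewrite -/q; nia.
    rewrite !(leq_trans (size_scale_leq _ _)) ?size_polyXn ?size_polyX //.
      by rewrite -/q; nia.
    by rewrite -/q; nia.
  by rewrite !hornerE -(h x) /frob -exprM.
have c k := congr1 (fun r : {poly L} => r`_k) p0.
have := c 1%N; have := c q; have := c (q ^ 2)%N.
rewrite !(coefD, coefZ, coefX, coefXn, coef0) !eqxx.
have -> : (q ^ 2 == 1)%N = false by nia.
have -> : (q ^ 2 == q)%N = false by nia.
have -> : (q == 1)%N = false by nia.
have -> : (q == q ^ 2)%N = false by nia.
have -> : (1 == q)%N = false by nia.
have -> : (1 == q ^ 2)%N = false by nia.
by rewrite !mulr0 !mulr1 !add0r !addr0.
Qed.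

(** The seven monomials are powers of k with the exponents 0, 1, q, q^2, q + 1, q^2 + q, q^2 + 1,
    distinct as q > 1. The monomial k^(1+q+q^2) is absent because it is constant, equal to -1, on
    these k. *)
Lemma norm_indep (c0 c1 c2 c3 c4 c5 c6 : L) :
  (forall z, z != 0 -> let k := - (frob z / z) in
     c0 + c1 * k + c2 * frob k + c3 * frob (frob k) + c4 * (k * frob k)
     + c5 * (frob k * frob (frob k)) + c6 * (k * frob (frob k)) = 0) ->
  [/\ c1 = 0, c2 = 0 & c3 = 0] /\ [/\ c0 = 0, c4 = 0, c5 = 0 & c6 = 0].
Proof.
move=> h; have q_gt1 := finNzRing_gt1 F.
pose q := #|F|; rewrite -/q in q_gt1.
pose R : {poly L} := c0%:P + c1 *: 'X + c2 *: 'X^q + c3 *: 'X^(q ^ 2)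
  + c4 *: 'X^(q + 1) + c5 *: 'X^(q ^ 2 + q) + c6 *: 'X^(q ^ 2 + 1).
have sR : (size R <= q ^ 2 + q + 1)%N.
  apply/leq_sizeP => j lej; rewrite !(coefD, coefZ, coefX, coefXn, coefC).
  have -> : (j == 0)%N = false by nia.
  have -> : (j == 1)%N = false by nia.
  have -> : (j == q)%N = false by nia.
  have -> : (j == q ^ 2)%N = false by nia.
  have -> : (j == q + 1)%N = false by nia.
  have -> : (j == q ^ 2 + q)%N = false by nia.
  have -> : (j == q ^ 2 + 1)%N = false by nia.
  by rewrite !mulr0 !addr0.
have sX : size (- 'X^(q.-1) : {poly L}) = q by rewrite size_polyN size_polyXn; nia.
have R0 : R = 0.
  apply/eqP; rewrite -(@comp_poly_eq0 _ _ (- 'X^(q.-1))) ?sX //.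
  (* The composite has degree at most (q^2 + q)(q - 1) = q^3 - q. The factor ['X] makes it vanish at
     0 as well and leaves the degree below q^3. *)
  apply/eqP; suff: ('X * (R \Po - 'X^(q.-1))) = 0.
    by move/eqP; rewrite mulf_eq0 polyX_eq0 => /eqP.
  apply: poly_vanish => [|z].
    rewrite (leq_trans (size_polyMleq _ _)) // size_polyX /=.
    rewrite (leq_ltn_trans (size_comp_poly_leq _ _)) // sX -/q.
    have: ((size R).-1 <= q ^ 2 + q)%N by lia.
    by nia.
  have [->|z0] := eqVneq z 0; first by rewrite hornerM hornerX mul0r.
  rewrite hornerM horner_comp.
  suff -> : (- 'X^(q.-1)).[z] = - (frob z / z).
    have /= := h z z0; set k := - _ => hk.
    rewrite (_ : R.[k] = 0) ?mulr0 //.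
    rewrite -hk !hornerE /= !exprD expr1 -/q /frob -/q -!exprM.
    by rewrite mulnn; ring.
  rewrite !hornerE /frob -/q -[in z ^+ q](prednK (ltnW q_gt1)) exprS.
  by rewrite mulrAC divff ?mul1r.
have c k := congr1 (fun r : {poly L} => r`_k) R0.
have := c 0%N; have := c 1%N; have := c q; have := c (q ^ 2)%N.
have := c (q + 1)%N; have := c (q ^ 2 + q)%N; have := c (q ^ 2 + 1)%N.
rewrite !(coefD, coefZ, coefX, coefXn, coef0, coefC) !eqxx.
repeat match goal with |- context [(?a == ?b :> nat)] =>
  rewrite (_ : (a == b :> nat) = false); last by nia end.
by rewrite !mulr0 !mulr1 !add0r !addr0.
Qed.

End Frobenius.

(** * Subspaces, field extension and Moore matrices *)

Lemma dim_rV (K : fieldType) n : \dim {:'rV[K]_n} = n.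
Proof. by rewrite dimvf dim_matrix; exact: mul1n. Qed.

Section Subspaces.
Variable K : fieldType.

Definition kerv n m (B : 'M[K]_(n, m)) : {vspace 'rV[K]_n} :=
  lker (linfun (mulmxr B : 'rV[K]_n -> 'rV[K]_m)).

Lemma mem_kerv n m (B : 'M[K]_(n, m)) v : (v \in kerv B) = (v *m B == 0).
Proof. by rewrite memv_ker lfunE. Qed.

Lemma vs_proj n (U : {vspace 'rV[K]_n}) :
  exists2 Q : 'M[K]_n, forall v, v *m Q \in U & forall v, v \in U -> v *m Q = v.
Proof.
exists (lin1_mx (projv U)) => v; rewrite mul_rV_lin1 /=; first exact: memv_proj.
exact: projv_id.
Qed.

(** The form is a nonzero column of 1 - Q with Q a projector onto [U]: it kills [U], and the
    dimensions leave no room for a larger kernel. *)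
Lemma hyperplaneP n (U : {vspace 'rV[K]_n.+1}) : \dim U = n ->
  exists2 l : 'cV[K]_n.+1, l != 0 & forall v, (v \in U) = (v *m l == 0).
Proof.
move=> dU; have [Q QU QK] := vs_proj U.
have nQ : 1%:M - Q != 0.
  apply/negP => /eqP Q1; have: (fullv <= U)%VS.
    apply/subvP => v _; have := QU v.
    by rewrite (_ : Q = 1%:M) ?mulmx1 //; apply/esym/eqP; rewrite -subr_eq0 Q1.
  by move/dimvS; rewrite dU dim_rV ltnn.
have [j nj] : exists j, col j (1%:M - Q) != 0.
  apply/existsP; move: nQ; apply: contraR => /existsPn nQ.
  apply/eqP/matrixP => i j; have := nQ j; rewrite negbK => /eqP/matrixP/(_ i 0).
  by rewrite !mxE.
pose l := col j (1%:M - Q); exists l => // v.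
rewrite -mem_kerv; suff -> : U = kerv l by [].
apply/eqP; rewrite eqEdim dU; apply/andP; split.
  apply/subvP => w Uw; rewrite mem_kerv /l colE mulmxA mulmxBr QK //.
  by rewrite mulmx1 subrr mul0mx.
have: kerv l != fullv.
  apply: contra nj => /eqP kl; apply/eqP; rewrite -[LHS]mul1mx.
  apply/row_matrixP => i; rewrite row_mul row0.
  by apply/eqP; rewrite -mem_kerv kl memvf.
apply: contraR; rewrite -ltnNge => lt; rewrite eqEdim subvf.
by rewrite dim_rV.
Qed.

Lemma flat0P n (P : {vspace 'rV[K]_n.+1}) :
  flat 0 P -> exists2 v, v != 0 & P = <[v]>%VS.
Proof.
move=> dP; have nP : P != 0%VS by rewrite -dimv_eq0 dP.
exists (vpick P); first by rewrite vpick0.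
apply/esym/eqP; rewrite eqEdim -memvE memv_pick dP dim_vline vpick0.
by rewrite nP.
Qed.

Lemma flat0_line n (v : 'rV[K]_n.+1) : v != 0 -> flat 0 <[v]>%VS.
Proof. by move=> nv; rewrite /flat /= dim_vline nv. Qed.

Lemma eq_line n (u v : 'rV[K]_n) a : a != 0 -> u = a *: v -> <[u]>%VS = <[v]>%VS.
Proof.
move=> na ->; apply/eqP; rewrite eqEsubv -!memvE.
rewrite memvZ ?memv_line //=.
by apply/vlineP; exists a^-1; rewrite scalerA mulVf ?scale1r.
Qed.

Lemma pgl_line n (M : 'M[K]_n) v : pgl M <[v]>%VS = <[v *m M]>%VS.
Proof. by rewrite /pgl limg_line lfunE. Qed.

Lemma mem_pgl n (M : 'M[K]_n) U w :
  M \in unitmx -> (w \in pgl M U) = (w *m invmx M \in U).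
Proof.
move=> uM; apply/memv_imgP/idP => [[v vU ->]|wU].
  by rewrite lfunE /= mulmxK.
by exists (w *m invmx M) => //; rewrite lfunE /= mulmxKV.
Qed.

End Subspaces.

Section Mapv.
Variables (K1 K2 : fieldType) (f : {rmorphism K1 -> K2}) (n : nat).
Implicit Types (U : {vspace 'rV[K1]_n}) (W : {vspace 'rV[K2]_n}).

Lemma memv_mapv U v : v \in U -> map_mx f v \in mapv f U.
Proof.
move=> /coord_vbasis->; rewrite map_mx_sum rpred_sum // => i _.
rewrite map_mxZ rpredZ // memv_span // map_f //.
by rewrite mem_nth // size_tuple.
Qed.

Lemma mapv_subP U W :
  (forall v, v \in U -> map_mx f v \in W) -> (mapv f U <= W)%VS.
Proof.
by move=> h; apply/span_subvP => _ /mapP[v vU ->]; apply/h/vbasis_mem.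
Qed.

Lemma mapv_mulmx0 U m (B : 'M[K2]_(n, m)) w :
    (forall v, v \in U -> map_mx f v *m B = 0) -> w \in mapv f U ->
  w *m B = 0.
Proof.
move=> h wU; apply/eqP; rewrite -mem_kerv; apply: subvP wU.
by apply: mapv_subP => v vU; rewrite mem_kerv h.
Qed.

Lemma mapv_line (v : 'rV[K1]_n) : mapv f <[v]>%VS = <[map_mx f v]>%VS.
Proof.
apply/eqP; rewrite eqEsubv -memvE memv_mapv ?memv_line // andbT.
apply: mapv_subP => _ /vlineP[a ->].
by rewrite map_mxZ memvZ ?memv_line.
Qed.

End Mapv.

Lemma mem_mapv_ker (K1 K2 : fieldType) (f : {rmorphism K1 -> K2}) n
    (l : 'cV[K1]_n) (U : {vspace 'rV[K1]_n}) w :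
    l != 0 -> (forall v, (v \in U) = (v *m l == 0)) ->
  (w \in mapv f U) = (w *m map_mx f l == 0).
Proof.
move=> nl hU; apply/idP/idP => [wU|/eqP wl].
  by apply/eqP; apply: mapv_mulmx0 wU => v; rewrite hU -map_mxM => /eqP->; rewrite map_mx0.
have [j nj] : exists j, l j 0 != 0.
  apply/existsP; move: nl; apply: contraR => /existsPn nl.
  by apply/eqP/matrixP => j k; rewrite ord1 mxE; apply/eqP; have := nl j; rewrite negbK.
(* With [j] a pivot of [l], these vectors lie in the kernel of [l] over the small field and generate
   the kernel over the large one. *)
pose b i : 'rV[K1]_n := delta_mx 0 i - (l i 0 / l j 0) *: delta_mx 0 j.
have -> : w = \sum_i w 0 i *: map_mx f (b i).
  under eq_bigr => i _ do rewrite map_mxB map_mxZ !map_delta_mx scalerBr scalerA.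
  rewrite sumrB -row_sum_delta -scaler_suml [X in X *: _](_ : _ = 0) ?scale0r ?subr0 //.
  under eq_bigr => i _ do rewrite fmorph_div mulrA.
  rewrite -mulr_suml; move/matrixP: wl => /(_ 0 0); rewrite !mxE.
  by under eq_bigr => i _ do rewrite mxE; move=> ->; rewrite mul0r.
rewrite rpred_sum // => i _; rewrite rpredZ // memv_mapv // hU /b.
rewrite mulmxBl -scalemxAl -!rowE; apply/eqP/matrixP => k m; rewrite !mxE !ord1.
by rewrite mulfVK ?subrr.
Qed.

Section Moore.
Variables (F : finFieldType) (L : fieldExtType F).
Hypothesis hL : \dim {:L} = 3%N.

(** Linear independence over [F] of the three entries; as [L] has degree 3, they form an [F]-basis
    of [L]. *)
Definition findep (b : 'cV[L]_3) : Prop :=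
  forall v : 'rV[F]_3, (map_mx (in_alg L) v *m b) 0 0 = 0 -> v = 0.

Lemma findep_span (b : 'cV[L]_3) : findep b ->
  forall y, exists v : 'rV[F]_3, (map_mx (in_alg L) v *m b) 0 0 = y.
Proof.
move=> ib y.
pose g (v : 'rV[F]_3) : L := (map_mx (in_alg L) v *m b) 0 0.
have gl : linear g.
  by move=> k u v; rewrite /g map_mxD map_mxZ mulmxDl -scalemxAl !mxE /= mulr_algl.
pose gL := GRing.isLinear.Build F _ _ _ g gl.
pose g' : {linear 'rV[F]_3 -> L} := HB.pack g gL.
pose f := linfun g'.
have k0 : lker f = 0%VS.
  apply/eqP; rewrite -subv0; apply/subvP => v; rewrite memv_ker lfunE /= => /eqP/ib->.
  exact: mem0v.
have full : limg f = fullv.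
  apply/eqP; rewrite eqEdim subvf hL limg_dim_eq ?k0 ?capv0 //.
  by rewrite dim_rV.
have: y \in limg f by rewrite full memvf.
by case/memv_imgP => v _ ->; exists v; rewrite lfunE.
Qed.

Definition moore (b : 'cV[L]_3) : 'M[L]_3 :=
  \matrix_(i, j) iter j (@frob F L) (b i 0).

Definition frow (y : L) : 'rV[L]_3 := row3 y (frob y) (frob (frob y)).

Lemma mul_moore (b : 'cV[L]_3) (v : 'rV[F]_3) :
  map_mx (in_alg L) v *m moore b = frow ((map_mx (in_alg L) v *m b) 0 0).
Proof.
apply: row3P; rewrite !mxE !sum3E !mxE /= ?rmorphD ?rmorphM /= ?frob_alg //.
Qed.

(** A relation between the columns is a linearised polynomial vanishing on the [F]-span of [b],
    which is all of [L]. *)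
Lemma moore_unit (b : 'cV[L]_3) : findep b -> moore b \in unitmx.
Proof.
move=> ib; rewrite -unitmx_tr -row_free_unit.
apply: inj_row_free => r r0.
have h y : r 0 0 * y + r 0 1 * frob y + r 0 2 * frob (frob y) = 0.
  have [v <-] := findep_span ib y.
  have := mul_moore b v; set y' := (_ *m b) 0 0 => hv.
  have : (frow y' *m r^T) 0 0 = 0.
    by rewrite -hv -mulmxA -[moore b]trmxK -trmx_mul r0 trmx0 mulmx0 mxE.
  by rewrite !mxE sum3E !mxE /= => <-; ring.
have [r0' r1 r2] := frob_indep hL h.
by apply: row3P; rewrite mxE.
Qed.

End Moore.

(** * Rational points of conics *)

Section Chevalley.
Variable F : finFieldType.

Lemma card_field0 : #|F|%:R = 0 :> F.
Proof.
have /eqP : \sum_(x : F) x = \sum_(x : F) (1 + x).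
  by rewrite (reindex_inj (addrI (1 : F))).
by rewrite big_split /= sumr_const -[X in X == _]add0r (inj_eq (addIr _)) => /eqP.
Qed.

Lemma sum_expf0 m : (m < #|F|.-1)%N -> \sum_(x : F) x ^+ m = 0.
Proof.
move=> lem.
have [->|m0] := posnP m.
  by under eq_bigr => x _ do rewrite expr0; rewrite sumr_const card_field0.
have [g g0 gm] : exists2 g : F, g != 0 & g ^+ m != 1.
  apply: contrapT => no.
  pose p : {poly F} := 'X^m - 1.
  have np : p != 0 by rewrite monic_neq0 ?monicXnsubC.
  have := max_poly_roots np (rs := enum [pred x : F | x != 0]).
  rewrite -cardE enum_uniq size_XnsubC //.
  rewrite (eq_card (B := predC (pred1 0))); last by move=> x; rewrite !inE.
  have := cardC (pred1 (0 : F)); rewrite card1 add1n => cF.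
  move=> /(_ _ isT) h; suff /h : all (root p) (enum [pred x | x != 0]).
    by rewrite ltnS leqNgt; case/negP; move: lem; rewrite -cF.
  apply/allP => x; rewrite mem_enum inE => nx.
  rewrite /root !hornerE subr_eq0; apply/negPn/negP => gx.
  by apply: no; exists x.
apply/eqP; have /eqP : \sum_(x : F) x ^+ m = g ^+ m * \sum_(x : F) x ^+ m.
  rewrite {1}(reindex_inj (mulfI g0)) mulr_sumr.
  by apply: eq_bigr => x _; rewrite exprMn.
rewrite -subr_eq0 -[X in X - _]mul1r -mulrBl mulf_eq0 subr_eq0 eq_sym.
by rewrite (negPf gm).
Qed.

(* Warning's count of zeros modulo p: each monomial of [Q ^ (q - 1)] has some
   exponent below [q - 1], so its sum over F^3 vanishes. *)
Lemma qform_isotropic (A : 'M[F]_3) : exists2 p : 'rV[F]_3, p != 0 & qform A p = 0.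
Proof.
apply: contrapT => no.
pose n := #|F|.-1.
have n0 : (0 < n)%N by rewrite /n -subn1 subn_gt0 finNzRing_gt1.
(* If 0 were the sole zero, each of the other q^3 - 1 vectors would contribute 1. *)
have s1 : \sum_(v : 'rV[F]_3) qform A v ^+ n = -1.
  rewrite (bigD1 0) //= /qform !mul0mx mxE expr0n eqn0Ngt n0 add0r.
  rewrite (eq_bigr (fun => 1)).
    rewrite sumr_const; apply/eqP; rewrite -subr_eq0 opprK.
    rewrite -[X in _ + X]/(1%:R) -natrD.
    rewrite (eq_card (B := predC (pred1 0))); last by move=> x; rewrite !inE.
    have := cardC (pred1 (0 : 'rV[F]_3)); rewrite card1 addnC => ->.
    by rewrite card_mx mul1n !expnS natrM card_field0 mul0r.
  move=> v nv; set x := _ 0 0.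
  have nx : x != 0 by apply/negP => /eqP x0; apply: no; exists v.
  apply: (mulfI nx); rewrite -exprS prednK ?expf_card ?mulr1 //.
  exact: ltnW (finNzRing_gt1 F).
have s0 : \sum_(v : 'rV[F]_3) qform A v ^+ n = 0.
  have qE v : qform A v ^+ n = \sum_(g : {ffun 'I_n -> 'I_3 * 'I_3})
      \prod_k (A (g k).1 (g k).2 * (v 0 (g k).1 * v 0 (g k).2)).
    rewrite -(bigA_distr_bigA (fun k (ij : 'I_3 * 'I_3) =>
      A ij.1 ij.2 * (v 0 ij.1 * v 0 ij.2))) prodr_const card_ord.
    congr (_ ^+ n); rewrite -(pair_big xpredT xpredT (fun i j => A i j * (v 0 i * v 0 j))) /=.
    rewrite /qform mxE exchange_big /=; apply: eq_bigr => j _.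
    rewrite !mxE mulr_suml; apply: eq_bigr => i _; ring.
  under eq_bigr => v _ do rewrite qE.
  rewrite exchange_big big1 // => g _.
  under eq_bigr => v _ do rewrite big_split /=.
  rewrite -mulr_sumr.
  pose m i := (#|[pred k | (g k).1 == i]| + #|[pred k | (g k).2 == i]|)%N.
  have mE (v : 'rV[F]_3) : \prod_k (v 0 (g k).1 * v 0 (g k).2) = \prod_i v 0 i ^+ m i.
    rewrite big_split /= (partition_big (fun k => (g k).1) xpredT) //=.
    rewrite [X in _ * X](partition_big (fun k => (g k).2) xpredT) //=.
    rewrite -big_split; apply: eq_bigr => i _; rewrite exprD.
    by congr (_ * _); rewrite -prodr_const; apply: eq_bigr => k /eqP->.
  rewrite (eq_bigr _ (fun v _ => mE v)).
  rewrite (reindex (fun h : {ffun 'I_3 -> F} => \row_i h i)); last first.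
    exists (fun v : 'rV[F]_3 => [ffun i => v 0 i]) => [h _|v _].
      by apply/ffunP => i; rewrite ffunE mxE.
    by apply/rowP => i; rewrite mxE ffunE.
  have hE (h : {ffun 'I_3 -> F}) :
      \prod_i (\row_i h i : 'rV[F]_3) 0 i ^+ m i = \prod_i h i ^+ m i.
    by apply: eq_bigr => i _; rewrite mxE.
  rewrite (eq_bigr _ (fun h _ => hE h)).
  rewrite -(bigA_distr_bigA (fun i x => x ^+ m i)).
  have ms : (\sum_i m i = n + n)%N.
    rewrite big_split /=; congr (_ + _)%N.
      rewrite -[RHS]card_ord -sum1_card (partition_big (fun k => (g k).1) xpredT) //=.
      by apply: eq_bigr => i _; rewrite -sum1_card.
    rewrite -[RHS]card_ord -sum1_card (partition_big (fun k => (g k).2) xpredT) //=.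
    by apply: eq_bigr => i _; rewrite -sum1_card.
  (* The total degree is 2n, so three exponents cannot all reach n. *)
  have [i mi] : exists i, (m i < n)%N.
    apply/existsP; apply: contraT => /existsPn h.
    suff: (\sum_(i < 3) n <= \sum_i m i)%N.
      by rewrite ms sum_nat_const card_ord; lia.
    by apply: leq_sum => i _; have := h i; rewrite -leqNgt.
  by rewrite (bigD1 i) //= sum_expf0 ?mul0r ?mulr0.
by move/eqP: s1; rewrite s0 eq_sym oppr_eq0 oner_eq0.
Qed.

End Chevalley.

(** * Parametrisation of irreducible conics *)

Section NormalForm.

(** [A] need not be symmetric; [bform A u v + bform A v u] is the polar form of [qform A],
    meaningful also in characteristic 2. *)
Definition bform (R : comNzRingType) (A : 'M[R]_3) (u v : 'rV[R]_3) : R :=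
  (u *m A *m v^T) 0 0.

Section Bform.
Variables (R : comNzRingType) (A : 'M[R]_3).
Implicit Types u v w : 'rV[R]_3.

Lemma bformDl u v w : bform A (u + v) w = bform A u w + bform A v w.
Proof. by rewrite /bform !mulmxDl mxE. Qed.

Lemma bformDr u v w : bform A w (u + v) = bform A w u + bform A w v.
Proof. by rewrite /bform linearD mulmxDr mxE. Qed.

Lemma bformZl a u v : bform A (a *: u) v = a * bform A u v.
Proof. by rewrite /bform -!scalemxAl mxE. Qed.

Lemma bformZr a u v : bform A u (a *: v) = a * bform A u v.
Proof. by rewrite /bform linearZ -scalemxAr mxE. Qed.

Lemma bform_row (T : 'M[R]_3) i j : (T *m A *m T^T) i j = bform A (row i T) (row j T).
Proof.
by rewrite /bform tr_row -!row_mul colE mulmxA -colE !mxE.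
Qed.

Lemma qformE w : qform A w =
  w 0 0 * w 0 0 * A 0 0 + w 0 1 * w 0 1 * A 1 1 + w 0 2 * w 0 2 * A 2 2
  + w 0 0 * w 0 1 * (A 0 1 + A 1 0) + w 0 0 * w 0 2 * (A 0 2 + A 2 0)
  + w 0 1 * w 0 2 * (A 1 2 + A 2 1).
Proof. rewrite /qform !mxE !sum3E !mxE !sum3E; ring. Qed.

Lemma qform_mulmx (T : 'M[R]_3) w : qform A (w *m T) = qform (T *m A *m T^T) w.
Proof. by rewrite /qform trmx_mul !mulmxA. Qed.

End Bform.

Definition rows3 (R : Type) (p r s : 'rV[R]_3) : 'M[R]_3 :=
  \matrix_(i, j) (if i == 0 :> nat then p 0 j else if i == 1%N :> nat then r 0 j else s 0 j).

Lemma row_rows3 (R : Type) (p r s : 'rV[R]_3) :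
  [/\ row 0 (rows3 p r s) = p, row 1 (rows3 p r s) = r & row 2 (rows3 p r s) = s].
Proof. by split; apply/rowP => j; rewrite !mxE. Qed.

Lemma mul_rows3 (R : pzRingType) (p r s w : 'rV[R]_3) :
  w *m rows3 p r s = w 0 0 *: p + w 0 1 *: r + w 0 2 *: s.
Proof. by rewrite mulmx_sum_row sum3E; have [-> -> ->] := row_rows3 p r s. Qed.

Variables (F : finFieldType) (A : 'M[F]_3).

Lemma quadratic_root (d e f : F) : d != 0 ->
  exists (K : fieldExtType F) (x : K), d%:A * x ^+ 2 + e%:A * x + f%:A = 0.
Proof.
move=> nd; pose g : {poly F} := d *: 'X^2 + e *: 'X + f%:P.
have sg : size g = 3%N.
  rewrite /g -addrA size_polyDl ?size_scale ?size_polyXn //.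
  rewrite (leq_ltn_trans (size_polyD _ _)) // gtn_max (leq_ltn_trans (size_polyC_leq1 _)) //.
  by rewrite (leq_ltn_trans (size_scale_leq _ _)) // size_polyX.
have ng : g != 0 by rewrite -size_poly_gt0 sg.
have [K [rs erg _]] := FinSplittingFieldFor ng.
have := eqp_size erg; rewrite size_map_poly sg size_prod_XsubC => -[].
case: rs erg => [|x rs] // erg _; exists K, x.
have: root (map_poly (in_alg K) g) x.
  by rewrite (eqp_root erg) root_prod_XsubC mem_head.
rewrite /root /g !rmorphD /= !map_polyZ map_polyXn map_polyX map_polyC !hornerE /=.
by move/eqP.
Qed.

(** An isotropic point [p] outside the radical of the polar form is completed to a hyperbolic pair,
    whose polar complement contributes the square term. If [p] lies in the radical, the form is
    binary and splits over an extension, against irreducibility. *)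
Lemma conic_normal_form (L : fieldExtType F) : irreducible_conic A ->
  exists (T : 'M[F]_3) (f : F), [/\ T \in unitmx, f != 0 &
    forall (R : comNzRingType) (g : {rmorphism F -> R}) (w : 'rV[R]_3),
      qform (map_mx g A) (w *m map_mx g T) = w 0 0 * w 0 1 + g f * w 0 2 ^+ 2].
Proof.
move=> irrA; have [p np Ap] := qform_isotropic A.
have qE (T : 'M[F]_3) (R : comNzRingType) (g : {rmorphism F -> R}) (w : 'rV[R]_3) :
    qform (map_mx g A) (w *m map_mx g T) = qform (map_mx g (T *m A *m T^T)) w.
  by rewrite qform_mulmx !map_mxM map_trmx.
have [[r0 nr0]|pol0] := pselect (exists r0, bform A p r0 + bform A r0 p != 0).
  pose c := bform A p r0 + bform A r0 p.
  (* The multiple of [p] makes [r] isotropic, and the factor [c^-1] makes its polar product with [p]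
     equal to 1. *)
  pose r := c^-1 *: (r0 - (bform A r0 r0 / c) *: p).
  have Ap' : bform A p p = 0 by [].
  have pr : bform A p r + bform A r p = 1.
    rewrite /r bformZr bformZl -scaleNr !(bformDr, bformDl, bformZr, bformZl) Ap'.
    by rewrite !mulr0 !addr0 -mulrDr mulVf.
  have rr : bform A r r = 0.
    rewrite /r bformZr bformZl -scaleNr !(bformDr, bformDl, bformZr, bformZl) Ap'.
    rewrite !mulr0 !addr0; set b := bform A r0 r0.
    suff -> : b + - (b / c) * bform A p r0 + - (b / c) * bform A r0 p = 0 by rewrite !mulr0.
    by rewrite -addrA -mulrDr -/c mulNr mulfVK ?subrr.
  move: r pr rr => r pr rr.
  have [s ns [ps rs]] : exists2 s, s != 0 &
      bform A p s + bform A s p = 0 /\ bform A r s + bform A s r = 0.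
    (* The polar forms of [p] and of [r] are two linear conditions on three coordinates, so they
       have a common nonzero solution. *)
    pose B : 'M[F]_(3, 1 + 1) := row_mx ((p *m A)^T + A *m p^T) ((r *m A)^T + A *m r^T).
    have : kermx B != 0.
      by rewrite kermx_eq0 /row_free neq_ltn (leq_ltn_trans (rank_leq_col _)).
    case/rowV0Pn => s /sub_kermxP sB ns; exists s => //.
    move: sB; rewrite /B mul_mx_row => /eqP; rewrite row_mx_eq0 !mulmxDr => /andP[/eqP sp /eqP sr].
    have tr t : bform A t s + bform A s t = (s *m (t *m A)^T + s *m (A *m t^T)) 0 0.
      rewrite mxE /bform mulmxA; congr (_ + _).
      transitivity ((t *m A *m s^T)^T 0 0); first by rewrite [RHS]mxE.
      by rewrite trmx_mul trmxK.
    by rewrite !tr sp sr mxE.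
  pose T := rows3 p r s.
  have uT : T \in unitmx.
    rewrite -row_free_unit; apply: inj_row_free => w; rewrite mul_rows3 => w0.
    have b0 u : bform A u 0 + bform A 0 u = 0.
      by rewrite /bform trmx0 mulmx0 !mul0mx mxE addr0.
    have := b0 p; have := b0 r.
    rewrite -[X in bform A r X]w0 -[X in bform A X r]w0 -[X in bform A p X]w0 -[X in bform A X p]w0.
    rewrite !(bformDr, bformDl, bformZr, bformZl) Ap' rr.
    move=> h1 h2.
    have w1 : w 0 1 = 0.
      rewrite -h2; transitivity (w 0 1 * (bform A p r + bform A r p) + w 0 2 * (bform A p s + bform A s p)).
        by rewrite pr ps mulr1 mulr0 addr0.
      by ring.
    have w0' : w 0 0 = 0.
      rewrite -h1; transitivity (w 0 0 * (bform A p r + bform A r p) + w 0 2 * (bform A r s + bform A s r)).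
        by rewrite pr rs mulr1 mulr0 addr0.
      by ring.
    move: w0; rewrite w1 w0' !scale0r !add0r => /eqP; rewrite scaler_eq0 (negPf ns) orbF => /eqP w2.
    by apply: row3P; rewrite ?mxE.
  have [r0' r1' r2'] := row_rows3 p r s; rewrite -/T in r0' r1' r2'.
  exists T, (bform A s s).
  have main (R : comNzRingType) (g : {rmorphism F -> R}) (w : 'rV[R]_3) :
      qform (map_mx g A) (w *m map_mx g T) = w 0 0 * w 0 1 + g (bform A s s) * w 0 2 ^+ 2.
    rewrite qE qformE ![map_mx _ _ _ _]mxE -!rmorphD !bform_row r0' r1' r2'.
    rewrite pr ps rs Ap' rr rmorph0 rmorph1; ring.
  (* Without the square term the form would be the product of two coordinates. *)
  split=> //; apply/negP => /eqP s0.
  apply: (irrA L (invmx (map_mx (in_alg L) T) *m delta_mx 0 0)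
                 (invmx (map_mx (in_alg L) T) *m delta_mx 1 0)) => v.
  have uTL : map_mx (in_alg L) T \in unitmx by rewrite map_unitmx.
  rewrite -[v in LHS](mulmxKV uTL) main s0 rmorph0 mul0r addr0.
  by rewrite !mulmxA -!colE !mxE.
(* Radical case: with [p] as first basis vector, the first coordinate disappears from the form. *)
have [U uU e0U] : {U : 'M[F]_3 | U \in unitmx & row 0 U = p}.
  pose e : 'rV[F]_3 := delta_mx 0 0.
  have efp : e *m (e^T *m p) = p.
    by rewrite mulmxA trmx_delta mul_delta_mx -[delta_mx 0 0](_ : 1%:M = _) ?mul1mx //;
       apply/matrixP => i j; rewrite !mxE !ord1.
  have [|U uU eU] := @complete_unitmx F 1 3 e (e^T *m p).
    by rewrite efp !rank_rV np -mxrank_eq0 mxrank_delta.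
  by exists U; rewrite // rowE -eU efp.
have pol u : bform A p u + bform A u p = 0.
  by apply/eqP; apply: contrapT => h; apply: pol0; exists u; apply/negP.
pose B := U *m A *m U^T.
have B00 : B 0 0 = 0 by rewrite /B bform_row e0U.
have B01 : B 0 1 + B 1 0 = 0 by rewrite /B !bform_row e0U pol.
have B02 : B 0 2 + B 2 0 = 0 by rewrite /B !bform_row e0U pol.
have irrB (K : fieldExtType F) (a b : 'cV[K]_3) : ~ (forall w : 'rV[K]_3,
    w 0 1 * w 0 1 * in_alg K (B 1 1) + w 0 2 * w 0 2 * in_alg K (B 2 2)
    + w 0 1 * w 0 2 * in_alg K (B 1 2 + B 2 1) = (w *m a) 0 0 * (w *m b) 0 0).
  move=> h; have uUK : map_mx (in_alg K) U \in unitmx by rewrite map_unitmx.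
  apply: (irrA K (invmx (map_mx (in_alg K) U) *m a) (invmx (map_mx (in_alg K) U) *m b)) => v.
  rewrite -[v in LHS](mulmxKV uUK) qE -/B !mulmxA -h qformE ![map_mx _ _ _ _]mxE.
  by rewrite -!rmorphD B00 B01 B02 rmorph0 !mulr0 add0r !addr0.
clearbody B.
(* If this coefficient vanishes, the last coordinate divides the binary form; otherwise a root [x]
   in an extension gives a linear factor. *)
have [b11|nb11] := eqVneq (B 1 1) 0.
  case: (irrB L (row3 0 0 1)^T (row3 0 (in_alg L (B 1 2 + B 2 1)) (in_alg L (B 2 2)))^T) => w.
  by rewrite b11 rmorph0 !mxE !sum3E !mxE /=; ring.
have [K [x hx]] := quadratic_root (B 1 2 + B 2 1) (B 2 2) nb11.
case: (irrB K (row3 0 1 (- x))^T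
  (row3 0 (in_alg K (B 1 1)) (in_alg K (B 1 2 + B 2 1) + in_alg K (B 1 1) * x))^T) => w.
rewrite !mxE !sum3E !mxE /=.
have -> : (B 2 2)%:A = - ((B 1 1)%:A * x ^+ 2 + (B 1 2 + B 2 1)%:A * x).
  by apply/eqP; rewrite -addr_eq0 addrC; apply/eqP.
by ring.
Qed.
End NormalForm.

(** * Values of curves as binary forms, infinity included *)

Section Curves.
Variables (F K : fieldType) (iota : {rmorphism F -> K}).

(** The formal degree [d] is kept as an argument so that factors of different formal degrees can be
    evaluated separately at infinity. *)
Definition ev (R : fieldType) (d : nat) (t : option R) (p : {poly R}) : R :=
  if t is Some x then p.[x] else p`_d.

Lemma evD (R : fieldType) d (t : option R) p q : ev d t (p + q) = ev d t p + ev d t q.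
Proof. by case: t => [x|] /=; rewrite ?hornerE ?coefD. Qed.

Lemma evCM (R : fieldType) d (t : option R) a p : ev d t (a%:P * p) = a * ev d t p.
Proof. by case: t => [x|] /=; rewrite ?hornerE ?coefCM. Qed.

Lemma ev0 (R : fieldType) d (t : option R) : ev d t 0 = 0.
Proof. by case: t => [x|] /=; rewrite ?horner0 ?coef0. Qed.

Lemma evM (R : fieldType) d m e (t : option R) (p q : {poly R}) :
  d = (m + e)%N -> (size p <= m.+1)%N -> (size q <= e.+1)%N ->
  ev d t (p * q) = ev m t p * ev e t q.
Proof.
move=> ->; case: t => [x|] sp sq /=; first by rewrite hornerM.
rewrite coefM (bigD1 (inord m)) //= inordK ?ltnS ?leq_addr //.
rewrite addKn big1 ?addr0 // => i ni.
have [lt|] := ltnP i m; last rewrite leq_eqVlt => /predU1P[im|lt].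
- by rewrite [q`__]nth_default ?mulr0 // (leq_trans sq) //; lia.
- by case/eqP: ni; apply/val_inj; rewrite /= inordK ?ltnS ?leq_addr.
by rewrite nth_default ?mul0r // (leq_trans sp).
Qed.

Lemma map_ev_mul (R : fieldType) d (t : option R) m n k (Y : 'M[{poly R}]_(m, n)) (B : 'M[R]_(n, k)) :
  map_mx (ev d t) (Y *m map_mx polyC B) = map_mx (ev d t) Y *m B.
Proof.
apply/matrixP => i j; rewrite !mxE (big_morph _ (evD d t) (ev0 d t)).
by apply: eq_bigr => l _; rewrite !mxE mulrC evCM mulrC.
Qed.

Lemma ev_map d (t : option F) p : ev d (omap iota t) (map_poly iota p) = iota (ev d t p).
Proof. by case: t => [x|] /=; rewrite ?horner_map ?coef_map. Qed.

Variables (n d : nat).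
Implicit Type f : n.-tuple {poly_d.+1 F}.

Lemma cvalE f t : cval iota f t = map_mx (ev d t) (crow iota f).
Proof. by []. Qed.

Lemma map_cval f (t : option F) :
  map_mx iota (cval idfun f t) = cval iota f (omap iota t).
Proof.
apply/matrixP => i j; rewrite !mxE map_poly_id //.
by rewrite -[LHS](ev_map d t).
Qed.

Lemma size_crow f j : (size (crow iota f 0%R j) <= d.+1)%N.
Proof. by rewrite mxE size_map_poly size_npoly. Qed.

Definition mkcurve (y : 'I_n -> {poly F}) : n.-tuple {poly_d.+1 F} :=
  [tuple npolyp d.+1 (y j) | j < n].

Lemma crow_mkcurve (y : 'I_n -> {poly F}) : (forall j, (size (y j) <= d.+1)%N) ->
  crow iota (mkcurve y) = \row_j map_poly iota (y j).
Proof. by move=> sy; apply/rowP => j; rewrite !mxE tnth_mktuple npolypK. Qed.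

End Curves.

(** * The quadratic parametrisation of a conic in normal form *)

Section ConicParam.
Variables (F : finFieldType) (A : 'M[F]_3) (T : 'M[F]_3) (f : F).
Hypotheses (uT : T \in unitmx) (f0 : f != 0).
Hypothesis qT : forall (R : comNzRingType) (g : {rmorphism F -> R}) (w : 'rV[R]_3),
  qform (map_mx g A) (w *m map_mx g T) = w 0 0 * w 0 1 + g f * w 0 2 ^+ 2.

Let w (R : fieldType) (f : R) : 'rV[{poly R}]_3 := row3 (- f *: 'X^2) 1 'X.

Definition conic_param : 3.-tuple {poly_3 F} :=
  mkcurve 2 (fun j => (w f *m map_mx polyC T) 0 j).

Lemma crow_conic (K : fieldType) (iota : {rmorphism F -> K}) :
  crow iota conic_param = w (iota f) *m map_mx polyC (map_mx iota T).
Proof.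
rewrite crow_mkcurve => [|j].
  apply/rowP => j; rewrite !mxE !sum3E !mxE /= !(rmorphD, rmorphM) /=.
  by rewrite !map_polyC map_polyZ map_polyXn map_polyX /= rmorph1 rmorphN.
rewrite !mxE sum3E !mxE /=; apply/leq_sizeP => -[|[|[|k]]] // _.
by rewrite !(coefD, coefMC, coefZ, coefXn, coefX, coef1) /= mulr0 !mul0r !addr0.
Qed.

Lemma conic_param_eq : qform (map_mx polyC A) (crow idfun conic_param) = 0.
Proof.
rewrite crow_conic map_mx_id // qT !mxE /=.
by rewrite mulr1 -mul_polyC rmorphN mulNr addNr.
Qed.

Section Ext.
Variables (K : fieldType) (iota : {rmorphism F -> K}).

Let uTK : map_mx iota T \in unitmx. Proof. by rewrite map_unitmx. Qed.

Let wv (t : option K) : 'rV[K]_3 :=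
  if t is Some x then row3 (- iota f * x ^+ 2) 1 x else row3 (- iota f) 0 0.

Lemma cval_conic t : cval iota conic_param t = wv t *m map_mx iota T.
Proof.
rewrite cvalE crow_conic map_ev_mul; congr (_ *m _).
by case: t => [x|]; apply: row3P; rewrite !mxE /= ?hornerE //
  ?coefZ ?coefXn ?coefC ?coefX ?mulr1.
Qed.

Lemma qform_cval_conic t : qform (map_mx iota A) (cval iota conic_param t) = 0.
Proof.
rewrite cval_conic qT; case: t => [x|]; rewrite !mxE /=; last by rewrite expr0n /= !mulr0 addr0.
by rewrite mulr1 mulNr addNr.
Qed.

Lemma conic_pointP v : v != 0 -> qform (map_mx iota A) v = 0 ->
  exists t, exists2 a, a != 0 & v = a *: cval iota conic_param t.
Proof.
move=> nv; pose y := v *m invmx (map_mx iota T).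
have vE : v = y *m map_mx iota T by rewrite mulmxKV.
clearbody y.
rewrite vE qT => /eqP; rewrite addr_eq0 => /eqP yE.
have fK : iota f != 0 by rewrite fmorph_eq0.
have [y1|ny1] := eqVneq (y 0 1) 0.
  have y2 : y 0 2 = 0.
    move/eqP: yE; rewrite y1 mulr0 eq_sym oppr_eq0 mulf_eq0 (negPf fK) expf_eq0 /=.
    by move/eqP.
  have ny0 : y 0 0 != 0.
    apply: contraNneq nv => y0; rewrite vE (_ : y = 0) ?mul0mx //.
    by apply: row3P; rewrite ?mxE.
  exists None, (- y 0 0 / iota f); first by rewrite mulf_neq0 ?oppr_eq0 ?invr_eq0.
  rewrite cval_conic scalemxAl; congr (_ *m _).
  by apply: row3P; rewrite !mxE /= ?y1 ?y2 ?mulr0 // !mulNr mulrN opprK mulfVK.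
exists (Some (y 0 2 / y 0 1)), (y 0 1) => //.
rewrite cval_conic scalemxAl; congr (_ *m _).
apply: row3P; rewrite !mxE /= ?mulr1 //; last by rewrite mulrC mulfVK.
apply: (mulIf ny1); rewrite yE; field.
exact: ny1.
Qed.

Lemma cval_conic_neq0 t : cval iota conic_param t != 0.
Proof.
rewrite cval_conic; apply/negP => /eqP h.
have := congr1 (fun v => v *m invmx (map_mx iota T)) h.
rewrite /= mulmxK // mul0mx; case: t {h} => [x|] /rowP h.
  by have := h 1; rewrite !mxE /= => /eqP; rewrite oner_eq0.
have := h 0; rewrite !mxE /= => /eqP.
by rewrite oppr_eq0 fmorph_eq0 (negPf f0).
Qed.

Lemma conic_span (q : {poly K}) : (size q <= 3)%N ->
  exists l : 'cV[K]_3, q%:M = crow iota conic_param *m map_mx polyC l.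
Proof.
move=> sq; pose y : 'cV[K]_3 := (row3 (- q`_2 / iota f) q`_0 q`_1)^T.
exists (invmx (map_mx iota T) *m y).
rewrite crow_conic -mulmxA -map_mxM mulKVmx //.
apply/matrixP => i j; rewrite !ord1 !mxE sum3E !mxE /= mulr1n.
have fK : iota f != 0 by rewrite fmorph_eq0.
apply/polyP => k; rewrite -!mul_polyC !(coefD, coefMC, coefCM, coefX, coefXn, coef1).
case: k => [|[|[|k]]] /=; rewrite ?(mulr0, mul0r, mul1r, mulr1, add0r, addr0) //.
- by field.
- by rewrite nth_default // (leq_trans sq).
Qed.

End Ext.

(** The points (0, 1, 0), (1, 0, 0) and (-f, 1, 1) of the normal form are not collinear. They exist
    even for q = 2. *)
Lemma conic_indep (K : fieldType) (iota : {rmorphism F -> K}) (l : 'cV[K]_3) :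
    (forall v : 'rV[F]_3, v != 0 -> qform A v = 0 -> map_mx iota v *m l = 0) ->
  l = 0.
Proof.
move=> h; have h' (y : 'rV[F]_3) : y != 0 -> y 0 0 * y 0 1 + f * y 0 2 ^+ 2 = 0 ->
    map_mx iota y *m (map_mx iota T *m l) = 0.
  move=> ny hy; rewrite mulmxA -map_mxM h //.
    apply: contraNneq ny => yT.
    by rewrite -[y](mulmxK uT) yT mul0mx.
  by have := qT idfun y; rewrite !map_mx_id // hy.
have uTK : map_mx iota T \in unitmx by rewrite map_unitmx.
suff Tl : map_mx iota T *m l = 0 by rewrite -[l](mulKmx uTK) Tl mulmx0.
set m := _ *m l in h' *; clearbody m.
have nrow (a b c : F) : b != 0 -> row3 a b c != 0.
  by apply: contraNneq => /rowP/(_ 1); rewrite !mxE /= => ->.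
have m1 : m 1 0 = 0.
  have := h' (row3 0 1 0) (nrow _ _ _ (oner_neq0 _)).
  rewrite !mxE /= mul0r expr0n mulr0 addr0 => /(_ erefl)/matrixP/(_ 0 0).
  by rewrite !mxE sum3E !mxE /= rmorph0 rmorph1 !mul0r mul1r add0r addr0.
have m0 : m 0 0 = 0.
  have n1 : row3 1 0 0 != 0 :> 'rV[F]_3.
    by apply/negP => /eqP/rowP/(_ 0); rewrite !mxE => /eqP; rewrite oner_eq0.
  have := h' _ n1.
  rewrite !mxE /= mulr0 expr0n mulr0 addr0 => /(_ erefl)/matrixP/(_ 0 0).
  by rewrite !mxE sum3E !mxE /= rmorph0 rmorph1 !mul0r mul1r !addr0.
have m2 : m 2 0 = 0.
  have := h' (row3 (- f) 1 1) (nrow _ _ _ (oner_neq0 _)).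
  rewrite !mxE /= expr1n !mulr1 addNr => /(_ erefl)/matrixP/(_ 0 0).
  by rewrite !mxE sum3E !mxE /= rmorph1 !mul1r m0 m1 mulr0 !add0r.
by apply/matrixP => i j; rewrite [j]ord1 [RHS]mxE; elim/ord3P: i.
Qed.

Lemma curve_conic : curve conic_param = qpoints A.
Proof.
rewrite /curve; apply/seteqP; split => [_ [t _ <-]|p [fp hp]] /=.
  split; first by apply: flat0_line; apply: cval_conic_neq0.
  move=> v /vlineP[a ->].
  have := qform_cval_conic idfun t; rewrite map_mx_id // => h.
  rewrite /qform -scalemxAl -scalemxAl linearZ /= -scalemxAr scalerA.
  rewrite (_ : _ *m _ = 0) ?scaler0 ?mxE //.
  by apply/matrixP => i j; rewrite !ord1 [RHS]mxE; exact: h.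
have [v nv pE] := flat0P fp; subst p.
have [|t [a na vE]] := @conic_pointP F idfun v nv.
  by rewrite map_mx_id // hp ?memv_line.
by exists t => //; rewrite (eq_line na vE).
Qed.

End ConicParam.

(** * The Bruck-Bose coordinates *)

Section BruckBose.
Variables (F : finFieldType) (L : fieldExtType F).
Hypothesis hL : \dim {:L} = 3%N.

Local Notation emb := (map_mx (in_alg L)).

Lemma mem_bb (G : 'M[L]_(7, 3)) U (x : 'rV[F]_7) : (x \in bb G U) = (emb x *m G \in U).
Proof.
apply/idP/idP => [xU|xU]; last by rewrite memv_span // mem_enum.
rewrite (@coord_span _ _ _ (in_tuple _) _ xU) map_mx_sum mulmx_suml rpred_sum // => i _.
rewrite map_mxZ -scalemxAl rpredZ //.
by have := mem_nth 0 (ltn_ord i); rewrite mem_enum.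
Qed.

Variables (Sigma : {vspace 'rV[F]_7}) (S : set {vspace 'rV[F]_7}).
Variables (linf : {vspace 'rV[L]_3}) (G : 'M[L]_(7, 3)).
Hypotheses (hSigma : flat 5 Sigma) (hS : regular_spread Sigma S).
Hypotheses (hlinf : flat 1 linf) (hG : bruck_bose Sigma S linf G).

Lemma Sigma_proper : exists v : 'rV[F]_7, v \notin Sigma.
Proof.
apply: contrapT => no; have: (fullv <= Sigma)%VS.
  apply/subvP => v _; apply: contrapT => /negP h; apply: no; by exists v.
by move/dimvS; rewrite hSigma dim_rV.
Qed.

(** A vector killed by [G] lies in [bb G P] for every [P], hence on every affine point, since each
    of these is some [bb G P]. It then lies on both [v] and [v + s], with [s] in [Sigma] and [v]
    outside. *)
Lemma bb_inj (x : 'rV[F]_7) : emb x *m G = 0 -> x = 0.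
Proof.
move=> xG; have [hpt _ _ _] := hG.
have [_ _ surj] := hpt.
have inline v : v \notin Sigma -> exists a, x = a *: v.
  move=> nv; have nv0 : v != 0 by apply: contraNneq nv => ->; rewrite mem0v.
  have [|P fP PE] := surj <[v]>%VS.
    by left; split; [apply: flat0_line | rewrite -memvE].
  have: x \in bb G P by rewrite mem_bb xG mem0v.
  by rewrite PE => /vlineP.
have [v nv] := Sigma_proper.
have [s sS ns] : exists2 s, s \in Sigma & s != 0.
  exists (vpick Sigma); rewrite ?memv_pick // vpick0 -dimv_eq0.
  by rewrite hSigma.
have [a xv] := inline v nv.
have [|b xvs] := inline (v + s); first by rewrite rpredDr.
have: (b - a) *: v = - (b *: s).
  by apply/eqP; rewrite -addr_eq0 scalerBl addrAC -scalerDr -xvs -xv subrr.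
have [ba h|nba h] := eqVneq b a.
  move: h; rewrite ba subrr scale0r => /esym/eqP; rewrite oppr_eq0 scaler_eq0.
  by rewrite (negPf ns) orbF => /eqP a0; rewrite xv a0 scale0r.
case/negP: nv; rewrite -[v](scalerK (a := b - a)) ?subr_eq0 // h.
by rewrite rpredZ // rpredN rpredZ.
Qed.

Lemma mem_Sigma x : (x \in Sigma) = (emb x *m G \in linf).
Proof. by have [_ _ _ <-] := hG; rewrite mem_bb. Qed.

(* Every point of [linf] corresponds to a spread plane, whose q^3 vectors must
   map onto the q^3 vectors of that point. *)
Lemma linf_lift y : y \in linf -> exists x : 'rV[F]_7, emb x *m G = y.
Proof.
move=> yl; have [->|ny] := eqVneq y 0; first by exists 0; rewrite map_mx0 mul0mx.
have [hpt _ hinc hli] := hG; have [hfun _ _] := hpt.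
have fy := flat0_line ny.
have dB : \dim (bb G <[y]>) = 3%N.
  have [[_ nS]|Sy] := hfun _ fy; last by have [/(_ _ Sy)[]] := hS.
  by case/negP: nS; rewrite -hli hinc // -memvE.
set B := bb G _ in dB.
have bB i : (vbasis B)`_i \in B.
  have [lt|ge] := ltnP i (size (vbasis B)); first by rewrite vbasis_mem ?mem_nth.
  by rewrite nth_default // mem0v.
have mu i : exists c, emb (vbasis B)`_i *m G = c *: y.
  by apply/vlineP; rewrite -mem_bb.
have [c hc] := choice mu.
pose b : 'cV[L]_3 := \col_i c i.
have comb (v : 'rV[F]_3) :
    emb (\sum_i v 0 i *: (vbasis B)`_i) *m G = (emb v *m b) 0 0 *: y.
  rewrite map_mx_sum mulmx_suml mxE scaler_suml; apply: eq_bigr => i _.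
  by rewrite map_mxZ -scalemxAl hc scalerA !mxE.
have ib : findep b.
  move=> v vb; have := comb v; rewrite vb scale0r => /bb_inj h.
  have fr := basis_free (vbasisP B).
  have sB : size (vbasis B) = 3%N by rewrite size_tuple dB.
  have /freeP fr' : free (tcast dB (vbasis B)).
    by rewrite val_tcast.
  apply/rowP => i; rewrite mxE; apply: (fr' (fun i => v 0 i)).
  by rewrite -[RHS]h; apply: eq_bigr => j _; rewrite val_tcast.
have [v hv] := findep_span hL ib 1.
by exists (\sum_i v 0 i *: (vbasis B)`_i); rewrite comb hv scale1r.
Qed.

(** The form defining [linf] is scaled to take the value 1 on the image of a vector [e] outside
    [Sigma]. As [Sigma] and [e] span everything, its values on the image of [G] lie in [F];
    subtracting a multiple of the image of [e] reduces lifting to points of [linf]. *)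
Lemma bruck_bose_coord : exists l : 'cV[L]_3,
  [/\ forall y, (y \in linf) = (y *m l == 0),
      forall x : 'rV[F]_7, exists b : F, (emb x *m G *m l) 0 0 = b%:A
    & forall y (b : F), (y *m l) 0 0 = b%:A -> exists x : 'rV[F]_7, emb x *m G = y].
Proof.
have [l0 nl0 hl0] := hyperplaneP hlinf.
have [e ne] := Sigma_proper.
pose c := (emb e *m G *m l0) 0 0.
have nc : c != 0.
  move: ne; rewrite mem_Sigma hl0; apply: contraNneq => c0.
  by apply/eqP/matrixP => i j; rewrite !ord1 [RHS]mxE.
pose l := c^-1 *: l0.
have hl y : (y \in linf) = (y *m l == 0).
  by rewrite hl0 /l -scalemxAr scaler_eq0 invr_eq0 (negPf nc).
have el : (emb e *m G *m l) 0 0 = 1 by rewrite /l -scalemxAr mxE mulVf.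
exists l; split=> // [x|y b yb].
  have : x \in (Sigma + <[e]>)%VS.
    suff -> : (Sigma + <[e]>)%VS = fullv by rewrite memvf.
    apply/eqP; rewrite eqEdim subvf dim_rV.
    have ->: \dim (Sigma + <[e]>) = (6 + 1)%N; last by [].
    rewrite dimv_disjoint_sum ?hSigma ?dim_vline.
      by rewrite (contraNneq _ ne) // => ->; rewrite mem0v.
    apply/eqP; rewrite -subv0; apply/subvP => u; rewrite memv_cap => /andP[uS].
    case/vlineP => k uk; rewrite uk memv0 scaler_eq0.
    have [//|nk] := eqVneq k 0; case/negP: ne.
    by rewrite -[e](scalerK nk) -uk rpredZ.
  case/memv_addP => s sS [_ /vlineP[k ->] ->]; exists k.
  move: sS; rewrite mem_Sigma hl => /eqP sl.
  by rewrite map_mxD map_mxZ !mulmxDl sl add0r -!scalemxAl mxE el mulr1.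
have : y - b%:A *: (emb e *m G) \in linf.
  rewrite hl; apply/eqP/matrixP => i j; rewrite !ord1 mulmxBl -scalemxAl.
  by rewrite !mxE in yb el *; rewrite yb el mulr1 subrr.
case/linf_lift => x hx; exists (x + b *: e).
by rewrite map_mxD map_mxZ mulmxDl -scalemxAl hx subrK.
Qed.

End BruckBose.

(** * Exterior splashes and their covers *)

Lemma dim_kerv_col (K : fieldType) n (l : 'cV[K]_n.+1) : l != 0 -> \dim (kerv l) = n.
Proof.
move=> nl; have := limg_ker_dim (linfun (mulmxr l : 'rV[K]_n.+1 -> 'rV[K]_1)) fullv.
rewrite capfv dim_rV -/(kerv l).
have : (\dim (limg (linfun (mulmxr l : 'rV[K]_n.+1 -> 'rV[K]_1))) <= 1)%N.
  by rewrite (leq_trans (dimvS (subvf _))) // dim_rV.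
have : limg (linfun (mulmxr l : 'rV[K]_n.+1 -> 'rV[K]_1)) != 0%VS.
  apply: contra nl => /eqP l0; apply/eqP; rewrite -[l]mul1mx; apply/row_matrixP => i.
  rewrite row_mul row0; apply/eqP; rewrite -memv0 -l0.
  by apply/memv_imgP; exists (row i 1%:M); rewrite ?memvf // lfunE.
rewrite -dimv_eq0; set d1 := \dim _; set d2 := \dim _; move: d1 d2 => d1 d2.
by case: d1 => [|[|d1]] //= _ _; rewrite addn1 => -[].
Qed.

(* Coordinates in which the order-q-subplane is {(x, x^q, x^(q^2))}, the line
   at infinity is X_0 = 0 and its conjugates are X_1 = 0 and X_2 = 0. *)
Record bb_frame (F : finFieldType) (L : fieldExtType F) (Sigma : {vspace 'rV[F]_7})
    (linf : {vspace 'rV[L]_3}) (G : 'M[L]_(7, 3)) (M H : 'M[L]_3) (a : 'cV[L]_3) : Prop :=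
  BBFrame {
    frame_dim : \dim {:L} = 3%N;
    frame_indep : findep a;
    frame_unit : M \in unitmx;
    frame_moore : M *m H = moore a;
    frame_linf : forall y, (y \in linf) = ((y *m H) 0 0 == 0);
    frame_Sigma : forall x, (x \in Sigma) = ((map_mx (in_alg L) x *m G *m H) 0 0 == 0);
    frame_base : forall x : 'rV[F]_7, exists b : F,
      (map_mx (in_alg L) x *m G *m H) 0 0 = b%:A;
    frame_inj : forall x : 'rV[F]_7, map_mx (in_alg L) x *m G = 0 -> x = 0;
    frame_lift : forall y (b : F), (y *m H) 0 0 = b%:A ->
      exists x : 'rV[F]_7, map_mx (in_alg L) x *m G = y }.

Section Coordinates.
Variables (F : finFieldType) (L : fieldExtType F).

Local Notation emb := (map_mx (in_alg L)).
Local Notation frob := (@frob F L).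

Variables (Sigma : {vspace 'rV[F]_7}) (linf : {vspace 'rV[L]_3}).
Variables (G : 'M[L]_(7, 3)) (M H : 'M[L]_3) (a : 'cV[L]_3).
Hypothesis fr : bb_frame Sigma linf G M H a.

Let hL := frame_dim fr.
Let ia := frame_indep fr.
Let uM := frame_unit fr.
Let hMH := frame_moore fr.
Let hlinf := frame_linf fr.
Let hSigma := frame_Sigma fr.
Let hinj := frame_inj fr.
Let hlift := frame_lift fr.

Definition bbc (x : 'rV[F]_7) : 'rV[L]_3 := emb x *m G *m H.

Lemma unit_H : H \in unitmx.
Proof.
have := moore_unit hL ia; rewrite -hMH !unitmxE det_mulmx unitrM.
by case/andP.
Qed.

Lemma bbcD x y : bbc (x + y) = bbc x + bbc y.
Proof. by rewrite /bbc map_mxD !mulmxDl. Qed.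

Lemma bbcZ (b : F) x : bbc (b *: x) = b%:A *: bbc x.
Proof. by rewrite /bbc map_mxZ -!scalemxAl. Qed.

Lemma bbc_inj x y : bbc x = bbc y -> x = y.
Proof.
move=> h; apply/eqP; rewrite -subr_eq0; apply/eqP/hinj.
apply: (can_inj (mulmxK unit_H)); rewrite mul0mx -/(bbc _).
by rewrite bbcD -scaleN1r bbcZ h scaleNr scale1r scaleN1r subrr.
Qed.

Lemma bbc_lift (b : F) y1 y2 : exists x, bbc x = row3 b%:A y1 y2.
Proof.
have [|x hx] := @hlift (row3 b%:A y1 y2 *m invmx H) b.
  by rewrite mulmxKV ?unit_H // mxE.
by exists x; rewrite /bbc hx mulmxKV ?unit_H.
Qed.

(** Applying Frobenius to the equation permutes the columns of the Moore matrix cyclically and fixes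
    the right side, so [rho] equals its own shifted conjugate. These are the dual coordinates of the
    lines of the subplane. *)
Lemma moore_fixed (rho : 'cV[L]_3) (l : 'cV[F]_3) : moore a *m rho = emb l ->
  rho 1 0 = frob (rho 0 0) /\ rho 2 0 = frob (rho 1 0).
Proof.
move=> h; pose rho' : 'cV[L]_3 := (row3 (frob (rho 2 0)) (frob (rho 0 0)) (frob (rho 1 0)))^T.
suff e : rho = rho'.
  by split; rewrite {1}e !mxE.
apply: (can_inj (mulKmx (moore_unit hL ia))); rewrite h.
apply/matrixP => i j; rewrite ord1; move/matrixP: h => /(_ i 0).
rewrite !mxE !sum3E !mxE /= => h; rewrite -(frob_alg L (l i 0)) -h !rmorphD !rmorphM /= frob3 //.
ring.
Qed.

(** A line of the subplane has dual coordinates (z^(q^2), z, z^q), and its equation on X_0 = 0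
    becomes z X_1 + z^q X_2 = 0. *)
Lemma splashP y : y != 0 ->
  splash linf M <[y]>%VS <->
  (y *m H) 0 0 = 0 /\
  exists2 z, z != 0 & z * (y *m H) 0 1 = - frob z * (y *m H) 0 2.
Proof.
move=> ny; split=> [[_ yl [l [l0 fl0 <-]]]|[y0 [z nz hz]]].
  rewrite -memvE mem_pgl // => yl0.
  have [la nla hla] := hyperplaneP fl0.
  move: yl0; rewrite (mem_mapv_ker _ _ nla hla) => /eqP yla.
  have y0 : (y *m H) 0 0 = 0 by apply/eqP; rewrite -hlinf.
  split=> //; pose rho := invmx (moore a) *m emb la.
  have hrho : moore a *m rho = emb la by rewrite mulKVmx ?moore_unit.
  have [r1 r2] := moore_fixed hrho.
  have : y *m H *m rho = 0.
    rewrite -[H](mulKmx uM) hMH /rho !mulmxA mulmxK ?moore_unit //.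
  move=> /matrixP/(_ 0 0); rewrite mxE sum3E y0 [RHS]mxE mul0r add0r r2 => yr.
  exists (rho 1 0).
    rewrite r1 frob_eq0; apply: contra nla => /eqP r0.
    have rho0 : rho = 0.
      apply/matrixP => i j; rewrite ord1 [RHS]mxE.
      by elim/ord3P: i; rewrite ?r2 ?r1 r0 ?rmorph0.
    apply/eqP/matrixP => i j; move/matrixP: hrho => /(_ i j).
    by rewrite rho0 mulmx0 !mxE => /esym/eqP; rewrite fmorph_eq0 => /eqP.
  by apply/eqP; rewrite mulNr -addr_eq0 mulrC [X in _ + X]mulrC yr.
pose rho : 'cV[L]_3 := (row3 (frob (frob z)) z (frob z))^T.
have hla i : exists b : F, (moore a *m rho) i 0 = b%:A.
  apply: frob_fixed; rewrite !mxE !sum3E !mxE /= !rmorphD !rmorphM /= !frob3 //.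
  by ring.
have [la0 hla0] := choice hla; pose la : 'cV[F]_3 := \col_i la0 i.
have hrho : moore a *m rho = emb la.
  by apply/matrixP => i j; rewrite ord1 hla0 !mxE.
have nla : la != 0.
  apply: contra nz => /eqP la00; move: hrho; rewrite la00 map_mx0 => hrho.
  have : rho = 0 by rewrite -[rho](mulKmx (moore_unit hL ia)) hrho mulmx0.
  by move=> /matrixP/(_ 1 0); rewrite !mxE /= => ->.
split; first exact: flat0_line.
  by rewrite -memvE hlinf y0.
exists (pgl M (ext L (kerv la))).
  by exists (kerv la) => //; apply: dim_kerv_col.
rewrite -memvE mem_pgl // (mem_mapv_ker _ _ nla (mem_kerv la)) -hrho.
rewrite -hMH !mulmxA mulmxKV //; apply/eqP/matrixP => i j; rewrite !ord1 mxE sum3E y0.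
have r1 : rho 1 0 = z by rewrite mxE mxE.
have r2 : rho 2 0 = frob z by rewrite mxE mxE.
rewrite mul0r add0r [RHS]mxE r1 r2.
by rewrite [X in X + _]mulrC hz mulNr mulrC addNr.
Qed.

Lemma emb_mul_neq0 (x : 'rV[F]_7) : x != 0 -> emb x *m G != 0.
Proof. by apply: contraNneq => /hinj ->. Qed.

Definition on_splash (y : 'rV[L]_3) : Prop :=
  y 0 0 = 0 /\ exists2 z, z != 0 & z * y 0 1 = - frob z * y 0 2.

Lemma mem_splash_planes x : x != 0 ->
  (exists2 B, (bb G @` splash linf M)%classic B & x \in B) <-> on_splash (bbc x).
Proof.
move=> nx; have ny := emb_mul_neq0 nx; split=> [[_ [P sP <-] xP]|h].
  have [fP _ _] := sP; have [y _ Py] := flat0P fP.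
  move: xP; rewrite mem_bb Py => /vlineP[c xc].
  have nc : c != 0 by apply: contraNneq ny => c0; rewrite xc c0 scale0r.
  by apply/(splashP ny); rewrite (eq_line nc xc) -Py.
exists (bb G <[emb x *m G]>%VS); last by rewrite mem_bb memv_line.
by exists <[emb x *m G]>%VS => //; apply/(splashP ny).
Qed.

(** The plane X_1 = k t(X_2) with k = - z^q / z. The parameter [z] matters only up to a factor from
    [F]. *)
Definition ctype (t : L -> L) (z : L) (A : {vspace 'rV[F]_7}) : Prop :=
  forall x, x \in A <->
    bbc x 0 0 = 0 /\ z * bbc x 0 1 = - frob z * t (bbc x 0 2).

Lemma ctype_eq t z A B : ctype t z A -> ctype t z B -> A = B.
Proof. by move=> hA hB; apply/vspaceP => x; apply/idP/idP => [/hA ?|/hB ?]; [apply/hB|apply/hA]. Qed.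

Section Cover.
Variable X : set {vspace 'rV[F]_7}.
Hypothesis hX : splash_cover Sigma linf G M X.

Lemma cover_points x : x != 0 -> (exists2 A, X A & x \in A) <-> on_splash (bbc x).
Proof.
move=> nx; have [_ _ _ h _] := hX.
by rewrite -(mem_splash_planes nx); apply: (h _ (flat0_line nx)).
Qed.

Section Element.
Variable A : {vspace 'rV[F]_7}.
Hypothesis XA : X A.

Lemma cover_c0 x : x \in A -> bbc x 0 0 = 0.
Proof.
have [h _ _ _ _] := hX; have [_ AS] := h _ XA.
by move/(subvP AS); rewrite hSigma => /eqP.
Qed.

Lemma cover_splash x : x \in A -> x != 0 -> on_splash (bbc x).
Proof. by move=> xA nx; apply/(cover_points nx); exists A. Qed.

Lemma cover_meets z : z != 0 ->
  exists2 x, x \in A & x != 0 /\ z * bbc x 0 1 = - frob z * bbc x 0 2.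
Proof.
move=> nz; pose r : 'rV[L]_3 := row3 0 (- frob z / z) 1.
pose y := r *m invmx H.
have yH : y *m H = r by rewrite mulmxKV ?unit_H.
have ny : y != 0.
  apply/negP => /eqP y0; move: yH; rewrite y0 mul0mx => /rowP/(_ 2).
  by rewrite !mxE /= => /esym/eqP; rewrite oner_eq0.
have sy : splash linf M <[y]>%VS.
  apply/(splashP ny); rewrite yH !mxE /=; split=> //.
  by exists z => //; rewrite mulr1 mulrC mulfVK.
have [_ _ _ _ h] := hX.
have [|v nv Av] := flat0P (h A (bb G <[y]>%VS) XA _); first by exists <[y]>%VS.
have := memv_line v; rewrite -Av memv_cap => /andP[vA].
rewrite mem_bb => /vlineP[c vc]; exists v => //; split=> //.
rewrite /bbc vc -scalemxAl yH !mxE /= mulr1.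
by field.
Qed.

(** On a splash plane X_2 = 0 forces X_1 = 0. Hence X_2 maps the three-dimensional cover plane
    bijectively onto [L], and the plane is the graph of an [F]-linear map. *)
Lemma cover_inj2 x : x \in A -> bbc x 0 2 = 0 -> x = 0.
Proof.
move=> xA x2; apply/eqP; apply/negPn/negP => nx.
have [x0 [z nz]] := cover_splash xA nx; rewrite x2 mulr0 => /eqP.
rewrite mulf_eq0 (negPf nz) => /eqP x1.
case/negP: nx; apply/eqP/bbc_inj; apply: row3P.
- by rewrite x0 /bbc map_mx0 !mul0mx mxE.
- by rewrite x1 /bbc map_mx0 !mul0mx mxE.
- by rewrite x2 /bbc map_mx0 !mul0mx mxE.
Qed.

Lemma cover_dim : \dim A = 3%N.
Proof. by have [h _ _ _ _] := hX; have [] := h _ XA. Qed.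

Lemma bbc_sum (I : finType) (v : I -> F) (e : I -> 'rV[F]_7) :
  bbc (\sum_i v i *: e i) = \sum_i (v i)%:A *: bbc (e i).
Proof.
rewrite /bbc map_mx_sum !mulmx_suml; apply: eq_bigr => i _.
by rewrite map_mxZ -!scalemxAl.
Qed.

Let e : 3.-tuple 'rV[F]_7 := tcast cover_dim (vbasis A).

Let eb : basis_of A e. Proof. by rewrite /e val_tcast; exact: vbasisP. Qed.

Let eA (i : 'I_3) : e`_i \in A.
Proof. by rewrite (basis_mem eb) // mem_nth ?size_tuple. Qed.

Let b : 'cV[L]_3 := \col_i bbc (e`_i) 0 2.

Let bE (v : 'rV[F]_3) : bbc (\sum_i v 0 i *: e`_i) 0 2 = (emb v *m b) 0 0.
Proof.
rewrite bbc_sum summxE [RHS]mxE; apply: eq_bigr => i _.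
by rewrite mxE [b _ _]mxE [emb v _ _]mxE.
Qed.

Let ib : findep b.
Proof.
move=> v; rewrite -bE => h.
have sA : \sum_i v 0 i *: e`_i \in A by apply: rpred_sum => i _; rewrite rpredZ.
have s0 := cover_inj2 sA h.
have /freeP free_e := basis_free eb.
by apply/rowP => i; rewrite mxE; apply: (free_e (fun i => v 0 i)).
Qed.

Lemma cover_surj2 y : exists2 x, x \in A & bbc x 0 2 = y.
Proof.
have [v hv] := findep_span hL ib y; exists (\sum_i v 0 i *: e`_i); last by rewrite bE.
by apply: rpred_sum => i _; rewrite rpredZ.
Qed.

(** Interpolation with the Moore matrix of a basis: every [F]-linear map from [L] to [L] is a
    linearised polynomial of this form. *)
Lemma cover_graph : exists al be ga, forall x, x \in A ->
  bbc x 0 1 = al * bbc x 0 2 + be * frob (bbc x 0 2) + ga * frob (frob (bbc x 0 2)).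
Proof.
pose c1 : 'cV[L]_3 := \col_i bbc (e`_i) 0 1.
pose r := invmx (moore b) *m c1.
exists (r 0 0), (r 1 0), (r 2 0) => x xA.
pose v : 'rV[F]_3 := \row_i coord e i x.
have xv : x = \sum_i v 0 i *: e`_i.
  rewrite {1}(coord_basis eb xA); apply: eq_bigr => i _; by rewrite mxE.
have : emb v *m c1 = frow ((emb v *m b) 0 0) *m r.
  by rewrite -mul_moore /r mulmxA mulmxK ?moore_unit.
rewrite -bE -xv => /matrixP/(_ 0 0); rewrite [RHS]mxE sum3E ![frow _ _ _]mxE /=.
rewrite ![_ * r _ _]mulrC => <-.
rewrite [RHS]mxE {1}xv bbc_sum summxE; apply: eq_bigr => i _.
by rewrite mxE [emb v _ _]mxE [c1 _ _]mxE.
Qed.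

(* For [al + be frob + ga frob^2 - k] to be singular its Dickson determinant
   must vanish, for all k of norm -1. *)
Lemma cover_elementP : exists2 z, z != 0 & ctype frob z A \/ ctype (frob \o frob) z A.
Proof.
have [al [be [ga hA]]] := cover_graph.
pose f := frob.
(* These are the coefficients of the Dickson determinant in k, k^q, k^(q^2), the product k k^q
   k^(q^2) = -1 being absorbed in [c0]. *)
have [|[c1 _ _] [_ c4 _ _]] := norm_indep hL
  (c0 := al * f al * f (f al) + 1 - al * f be * f (f ga) - be * f ga * f (f al)
         + be * f be * f (f be) + ga * f ga * f (f ga) - ga * f al * f (f be))
  (c1 := f be * f (f ga) - f al * f (f al))
  (c2 := ga * f (f be) - al * f (f al))
  (c3 := be * f ga - al * f al)
  (c4 := f (f al)) (c5 := al) (c6 := f al).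
  move=> z nz k; have [x xA [nx hz]] := cover_meets nz.
  pose y := bbc x 0 2.
  have ny : y != 0 by apply: contra nx => /eqP/(cover_inj2 xA)->.
  have yk : bbc x 0 1 = k * y.
    by apply: (mulfI nz); rewrite hz -/y /k; field.
  have kk : k * f k * f (f k) = - 1.
    rewrite /k /f !rmorphN !fmorph_div /= frob3 //; field.
    by rewrite !frob_eq0 nz.
  clearbody k.
  have E0 : (al - k) * y + be * f y + ga * f (f y) = 0.
    by rewrite mulrBl -yk hA // -/y -/f; ring.
  have E1 := congr1 f E0; have E2 := congr1 f E1.
  rewrite /f !(rmorphD, rmorphM, rmorphN, rmorph0) /= frob3 // -/f in E1 E2.
  apply: (mulfI ny); rewrite mulr0 -/f.
  move: (f y) (f (f y)) (f k) (f (f k)) (f al) (f (f al)) (f be) (f (f be)) (f ga)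
    (f (f ga)) E0 E1 E2 kk => y1 y2 k1 k2 al1 al2 be1 be2 ga1 ga2 E0 E1 E2 kk.
  (* The cofactors of the first column combine the singularity equation and its two conjugates into
     the determinant times [y]. *)
  transitivity (((al1 - k1) * (al2 - k2) - be1 * ga2) * ((al - k) * y + be * y1 + ga * y2)
    - (be * (al2 - k2) - ga * ga2) * ((al1 - k1) * y1 + be1 * y2 + ga1 * y)
    + (be * be1 - ga * (al1 - k1)) * ((al2 - k2) * y2 + be2 * y + ga2 * y1)
    + y * (1 + k * k1 * k2)); first by ring.
  by rewrite E0 E1 E2 kk subrr; ring.
have al0 : al = 0 by apply/eqP; rewrite -[al == 0]frob_eq0 -[frob al == 0]frob_eq0 -[X in X == _]/(f (f al)) c4.
(* At X_2 = 1 the graph gives X_1 = be + ga, and lying on the splash identifies this sum as - z^q /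
   z; one of the two terms will turn out to be 0. *)
have [x xA x2] := cover_surj2 1.
have nx : x != 0.
  apply/negP => /eqP x0; move: x2; rewrite x0 /bbc map_mx0 !mul0mx mxE => /esym/eqP.
  by rewrite oner_eq0.
have [x0 [z nz hz]] := cover_splash xA nx.
have hz' : z * (be + ga) = - frob z.
  suff <- : bbc x 0 1 = be + ga by rewrite hz x2 mulr1.
  by rewrite hA // x2 !rmorph1 al0 !mulr1 add0r.
have conv (t : L -> L) : (forall x, x \in A -> bbc x 0 1 = (be + ga) * t (bbc x 0 2)) ->
    ctype t z A.
  move=> ht y; split=> [yA|[y0 hy]].
    by split; [exact: cover_c0 | rewrite ht // mulrA hz'].
  have [y' y'A y'2] := cover_surj2 (bbc y 0 2).
  suff -> : y = y' by [].
  apply/bbc_inj/row3P => //; first by rewrite y0 cover_c0.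
  by apply: (mulfI nz); rewrite hy ht // y'2 mulrA hz'.
exists z => //.
move: c1; rewrite al0 /f !rmorph0 mul0r subr0 => /eqP; rewrite mulf_eq0 !frob_eq0.
case/orP => /eqP h0; [right | left]; apply: conv => u uA.
  by rewrite hA // al0 h0 !mul0r !add0r.
by rewrite hA // al0 h0 !mul0r add0r !addr0.
Qed.
End Element.

(** The point (0, - z^q / z, 1) is covered, and as [t] fixes 1 the plane through it has the same
    constant k. *)
Lemma cover_full t : t 1 = 1 ->
  (forall A, X A -> exists2 z, z != 0 & ctype t z A) ->
  forall z, z != 0 -> exists2 A, X A & ctype t z A.
Proof.
move=> t1 hX' z nz; have [x hx] := bbc_lift 0 (- frob z / z) 1.
have nx : x != 0.
  apply/negP => /eqP x0; move: hx; rewrite x0 /bbc map_mx0 !mul0mx.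
  by move=> /rowP/(_ 2); rewrite !mxE => /esym/eqP; rewrite oner_eq0.
have sx : on_splash (bbc x).
  rewrite hx /on_splash !mxE /= scale0r; split=> //; exists z => //.
  by rewrite mulr1 mulrC mulfVK.
have [A XA xA] := (cover_points nx).2 sx.
have [z' nz' hA] := hX' A XA; exists A => // y.
have hz : z' * (- frob z / z) = - frob z'.
  by have [_] := (hA x).1 xA; rewrite hx !mxE /= t1 mulr1.
have hz' : - frob z = z * (- frob z' / z') by rewrite -hz; field; rewrite nz nz'.
split=> [/hA[y0 h]|[y0]]; rewrite hz'.
  by split=> //; rewrite -[bbc y 0 1](mulKf nz') h; field.
rewrite -mulrA => /(mulfI nz) h; apply/hA; split=> //.
by rewrite h; field.
Qed.

(* A plane X_1 = k X_2^q and a plane X_1 = k' X_2^(q^2), both contained in the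
   splash, meet, so a cover cannot contain planes of both kinds. *)
Lemma cover_type :
  (forall A, X A -> exists2 z, z != 0 & ctype frob z A) \/
  (forall A, X A -> exists2 z, z != 0 & ctype (frob \o frob) z A).
Proof.
have [|/existsNP[A]] := pselect (forall A, X A -> exists2 z, z != 0 & ctype frob z A).
  by left.
move=> /not_implyP[XA nA]; right => B XB.
have [z nz [hB|]] := cover_elementP XB; last by exists z.
have [z' nz' [hA|hA]] := cover_elementP XA; first by case: nA; exists z'.
have [AB|nAB] := eqVneq A B; first by case: nA; exists z; rewrite ?AB.
(* With u = z / z', the two equations require X_2^(q^2) / X_2^q = u^(q-1), which X_2^q = u
   solves. *)
have [x hx] := bbc_lift 0 (- (frob z / z) * (z / z')) (frob (frob (z / z'))).
have xA : x \in A.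
  apply/hA; rewrite hx !mxE /= scale0r; split=> //; rewrite frob3 // fmorph_div.
  by field; rewrite nz nz' frob_eq0 nz'.
have xB : x \in B.
  apply/hB; rewrite hx !mxE /= scale0r; split=> //; rewrite frob3 //.
  by field; rewrite nz nz'.
have [_ _ disj _ _] := hX.
have x0 : x = 0.
  by apply/eqP; rewrite -memv0 -(disj _ _ XA XB (elimN eqP nAB)) memv_cap xA.
move: hx; rewrite x0 /bbc map_mx0 !mul0mx => /rowP/(_ 2); rewrite !mxE /=.
by move=> /esym/eqP; rewrite !frob_eq0 mulf_eq0 invr_eq0 (negPf nz) (negPf nz').
Qed.

End Cover.

End Coordinates.

(** * Lifting curves to PG(6, q) *)

(** Duality: the coefficient matrix has full column rank as soon as no nonzero functional [psi]
    kills all coordinates. *)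
Lemma nrc_criterion (F : finFieldType) n d (f : n.-tuple {poly_d.+1 F}) :
    (forall psi : 'cV[F]_d.+1,
       (forall j, \sum_(k < d.+1) (tnth f j : {poly F})`_k * psi k 0 = 0) -> psi = 0) ->
  normal_rational_curve f.
Proof.
move=> h; pose C : 'M[F]_(n, d.+1) := \matrix_(j, k) (tnth f j : {poly F})`_k.
have fullC : row_full C.
  suff: row_free C^T by rewrite /row_free mxrank_tr.
  apply: inj_row_free => v v0.
  suff vT : v^T = 0 by rewrite -[v]trmxK vT trmx0.
  apply: h => j; move: v0 => /(congr1 trmx); rewrite trmx_mul trmxK trmx0 => /matrixP/(_ j 0).
  by rewrite !mxE => vj; rewrite -[RHS]vj; apply: eq_bigr => k _; rewrite [C _ _]mxE.
have /row_fullP[B BC] := fullC.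
apply/eqP; rewrite eqEsubv subvf; apply/subvP => q _.
pose v : 'rV[F]_d.+1 := \row_k (q : {poly F})`_k.
have -> : q = \sum_j (v *m B) 0 j *: tnth f j.
  apply/npolyP => k /=.
  have [lt|ge] := ltnP k d.+1; last by rewrite !big_coef_npoly.
  have : v 0 (Ordinal lt) = (v *m B *m C) 0 (Ordinal lt) by rewrite -mulmxA BC mulmx1.
  rewrite mxE /= => ->; rewrite [LHS]mxE raddf_sum coef_sum; apply: eq_bigr => j _.
  by rewrite [C _ _]mxE /= coefZ.
by apply: rpred_sum => j _; rewrite rpredZ // memv_span // mem_tnth.
Qed.

Lemma span_coprime (K : fieldType) (Q : {poly K} -> Prop) (u v e : {poly K}) m n :
    (forall p q, Q p -> Q q -> Q (p + q)) -> coprimep u v ->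
    size u = m.+1 -> size v = m.+1 -> (m <= n.+1)%N ->
    (forall s : {poly K}, (size s <= n.+1)%N -> Q (u * s * e)) ->
    (forall s : {poly K}, (size s <= n.+1)%N -> Q (v * s * e)) ->
  forall s : {poly K}, (size s <= (m + n).+1)%N -> Q (s * e).
Proof.
move=> QD cuv su sv lemn Qu Qv s ss.
have nv : v != 0 by rewrite -size_poly_gt0 sv.
have /Bezout_eq1_coprimepP[[x y] /= xy] := cuv.
pose A := (s * x) %% v; pose B := s * y + (s * x) %/ v * u.
have sE : s = u * A + v * B.
  have := divp_eq (s * x) v; rewrite -/A => hA.
  rewrite -[s in LHS]mulr1 -xy mulrDr !mulrA hA /B; ring.
have sA : (size A <= m)%N by rewrite -ltnS -sv ltn_modp.
have sB : (size B <= n.+1)%N.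
  have [->|nB] := eqVneq B 0; first by rewrite size_poly0.
  have : (size (v * B)%R <= (m + n).+1)%N.
    have -> : v * B = s - u * A by rewrite {1}sE; ring.
    rewrite (leq_trans (size_polyD _ _)) // size_polyN geq_max ss /=.
    rewrite (leq_trans (size_polyMleq _ _)) // su.
    by move: sA; move: (size A) => sA' ?; lia.
  by rewrite size_mul // sv; move: (size B) => sB'; lia.
rewrite {1}sE mulrDl; apply: QD; last exact: Qv.
by apply: Qu; move: sA; move: (size A) => sA' ?; lia.
Qed.

Section Frob.
Variables (F : finFieldType) (L : fieldExtType F).
Hypothesis hL : \dim {:L} = 3%N.
Local Notation frob := (@frob F L).
Local Notation fr := (map_poly frob).

Lemma frp3 (p : {poly L}) : fr (fr (fr p)) = p.
Proof. by apply/polyP => k; rewrite !coef_map /= frob3. Qed.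

Lemma frp_alg (p : {poly F}) : fr (map_poly (in_alg L) p) = map_poly (in_alg L) p.
Proof. by apply/polyP => k; rewrite !coef_map /= frob_alg. Qed.

Lemma frp_fixed (p : {poly L}) k : fr p = p -> exists b : F, p`_k = b%:A.
Proof. by move=> h; apply: frob_fixed; rewrite -[in RHS]h coef_map. Qed.

Lemma size_frp (p : {poly L}) : size (fr p) = size p.
Proof. exact: size_map_poly. Qed.

(** [Q] stands for the kernel of a functional defined over [F], which is closed under sums and under
    conjugation of coefficients. *)
Definition spanning (d e : nat) (h : {poly L}) : Prop :=
  forall Q : {poly L} -> Prop, (forall p q, Q p -> Q q -> Q (p + q)) ->
    (forall p, Q p -> Q (fr p)) ->
    (forall q : {poly L}, (size q <= e.+1)%N -> Q (h * q)) ->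
  forall q : {poly L}, (size q <= d.+1)%N -> Q q.

(** With p1, p2 the conjugates of p, the multiples of p1 p2 and p p2 fill those of p2 in degree 3m.
    Conjugating fills those of p, and the coprime pair p, p2 then fills everything. *)
Lemma norm_spanning d m (p : {poly L}) : d = (m + (m + m))%N -> size p = m.+1 ->
  coprimep p (fr p) -> spanning d m (fr p * fr (fr p)).
Proof.
move=> -> sp cp Q QD Qf Qh.
have cp1 : coprimep (fr p) (fr (fr p)) by rewrite coprimep_map.
have cp2 : coprimep (fr (fr p)) p by rewrite -[X in coprimep _ X]frp3 coprimep_map.
have Q2 (s : {poly L}) : (size s <= m.+1)%N -> Q (p * s * fr (fr p)).
  move=> ss; have -> : p * s * fr (fr p) = fr (fr p * fr (fr p) * fr (fr s)).
    by rewrite !rmorphM /= !frp3; ring.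
  by apply/Qf/Qh; rewrite !size_frp.
have QA (s : {poly L}) : (size s <= (m + m).+1)%N -> Q (s * fr (fr p)).
  apply: (span_coprime QD (u := fr p) (v := p)); rewrite ?size_frp //.
  - by rewrite coprimep_sym.
  - by move=> s' ss'; rewrite mulrAC; apply: Qh.
have QB (s : {poly L}) : (size s <= (m + m).+1)%N -> Q (s * p).
  move=> ss; have := Qf _ (QA (fr (fr s)) _); rewrite !size_frp => /(_ ss).
  by rewrite rmorphM /= !frp3.
move=> q sq; rewrite -[q]mulr1.
apply: (span_coprime QD (u := fr (fr p)) (v := p) (m := m) (n := m + m)); rewrite ?size_frp //.
- by lia.
- by move=> s ss; rewrite mulr1 mulrC; apply: QA.
- by move=> s ss; rewrite mulr1 mulrC; apply: QB.
Qed.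

Lemma linear_spanning (c t : L) : c != 0 -> frob t != t ->
  spanning 3 2 (c%:P * ('X - t%:P)).
Proof.
move=> nc nt Q QD Qf Qh q sq.
have Q0 (s : {poly L}) : (size s <= 3)%N -> Q (('X - t%:P) * s).
  move=> ss; have := Qh (c^-1%:P * s); rewrite mulrACA -polyCM mulfV // mul1r.
  by apply; rewrite mul_polyC size_scale ?invr_eq0.
have Q1 (s : {poly L}) : (size s <= 3)%N -> Q (('X - (frob t)%:P) * s).
  move=> ss; have := Qf _ (Q0 (fr (fr s)) _); rewrite !size_frp => /(_ ss).
  by rewrite rmorphM rmorphB /= map_polyX map_polyC frp3.
rewrite -[q]mulr1; apply: (span_coprime QD (u := 'X - t%:P) (v := 'X - (frob t)%:P) (m := 1) (n := 2));
  rewrite ?size_XsubC //.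
- by rewrite coprimep_XsubC root_XsubC.
- by move=> s ss; rewrite mulr1; apply: Q0.
- by move=> s ss; rewrite mulr1; apply: Q1.
Qed.

End Frob.

Section CurveLift.
Variables (F : finFieldType) (L : fieldExtType F).

Local Notation emb := (map_mx (in_alg L)).
Local Notation frob := (@frob F L).
Local Notation fr := (map_poly frob).

Variables (Sigma : {vspace 'rV[F]_7}) (linf : {vspace 'rV[L]_3}).
Variables (G : 'M[L]_(7, 3)) (M H : 'M[L]_3) (a : 'cV[L]_3).
Hypothesis hfr : bb_frame Sigma linf G M H a.

Let hL := frame_dim hfr.

Definition ccoord d (f : 7.-tuple {poly_d.+1 F}) : 'rV[{poly L}]_3 :=
  crow (in_alg L) f *m map_mx polyC (G *m H).

Definition pcoord e (c : 3.-tuple {poly_e.+1 F}) : 'rV[{poly L}]_3 :=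
  crow (in_alg L) c *m map_mx polyC (moore a).

(** The coordinate x along the curve; the other two frame coordinates are its conjugates. *)
Definition ppoly e (c : 3.-tuple {poly_e.+1 F}) : {poly L} := pcoord c 0 0.

Lemma pcoordE e (c : 3.-tuple {poly_e.+1 F}) :
  pcoord c = row3 (ppoly c) (fr (ppoly c)) (fr (fr (ppoly c))).
Proof.
have pE j : pcoord c 0 j = iter j (map_poly frob) (ppoly c).
  have pE' k : pcoord c 0 k = \sum_i map_poly (in_alg L) (tnth c i) * (iter k frob (a i 0))%:P.
    by rewrite mxE; apply: eq_bigr => i _; rewrite !mxE.
  rewrite pE' /ppoly pE' /=; elim: (nat_of_ord j) => [|k IH] //=.
  rewrite -IH rmorph_sum; apply: eq_bigr => i _.
  by rewrite rmorphM /= map_polyC frp_alg.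
by apply: row3P; rewrite pE mxE.
Qed.

Lemma ppolyE e (c : 3.-tuple {poly_e.+1 F}) :
  ppoly c = (crow (in_alg L) c *m map_mx polyC a) 0 0.
Proof.
rewrite /ppoly !mxE; apply: eq_bigr => i _; by rewrite !mxE.
Qed.

Lemma size_ppoly e (c : 3.-tuple {poly_e.+1 F}) : (size (ppoly c) <= e.+1)%N.
Proof.
rewrite ppolyE mxE (leq_trans (size_sum _ _ _)) //; apply/bigmax_leqP => i _.
rewrite [map_mx _ _ _ _]mxE mulrC mul_polyC (leq_trans (size_scale_leq _ _)) //.
exact: size_crow.
Qed.

Lemma size_pcoord e (c : 3.-tuple {poly_e.+1 F}) j :
  (size (pcoord c 0%R j) <= e.+1)%N.
Proof. by rewrite pcoordE; elim/ord3P: j; rewrite !mxE /= ?size_frp size_ppoly. Qed.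

Definition coefrow d (f : 7.-tuple {poly_d.+1 F}) (k : nat) : 'rV[F]_7 :=
  \row_j (tnth f j : {poly F})`_k.

Lemma bbc_coefrow d (f : 7.-tuple {poly_d.+1 F}) k j :
  bbc G H (coefrow f k) 0 j = (ccoord f 0 j)`_k.
Proof.
rewrite /bbc -mulmxA mxE [in RHS]mxE coef_sum; apply: eq_bigr => i _.
by rewrite !mxE coefMC coef_map.
Qed.

Lemma ev_conj e (t : option F) p :
  ev e (omap (in_alg L) t) (fr p) = frob (ev e (omap (in_alg L) t) p).
Proof.
case: t => [x|] /=; last by rewrite coef_map.
by rewrite -[in LHS](frob_alg L x) horner_map.
Qed.

Lemma ev_ppoly e (c : 3.-tuple {poly_e.+1 F}) (t : option F) :
  ev e (omap (in_alg L) t) (ppoly c) = (emb (cval idfun c t) *m a) 0 0.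
Proof.
rewrite map_cval cvalE -map_ev_mul ppolyE.
by rewrite [RHS]mxE.
Qed.

Lemma ev_ppoly_neq0 e (c : 3.-tuple {poly_e.+1 F}) (t : option F) :
  cval idfun c t != 0 -> ev e (omap (in_alg L) t) (ppoly c) != 0.
Proof. by apply: contraNneq; rewrite ev_ppoly => /(frame_indep hfr)->. Qed.

(** Two lifts of one affine point are proportional over [L], and the ratio of their [F]-valued
    coordinates X_0 puts the factor in [F]. *)
Lemma bb_line (x : 'rV[F]_7) y mu :
  emb x *m G = mu *: y -> bbc G H x 0 0 != 0 -> bb G <[y]>%VS = <[x]>%VS.
Proof.
move=> xy x0; apply/vspaceP => v; rewrite mem_bb.
have nmu : mu != 0.
  by apply: contraNneq x0 => mu0; rewrite /bbc xy mu0 scale0r mul0mx mxE.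
apply/vlineP/vlineP => [[c vc]|[k ->]]; last first.
  by exists (k%:A * mu); rewrite map_mxZ -scalemxAl xy scalerA.
have vx : bbc G H v = (c / mu) *: bbc G H x.
  by rewrite /bbc vc xy -!scalemxAl scalerA mulfVK.
have [bv hv] := frame_base hfr v; have [bx hx] := frame_base hfr x.
rewrite -/(bbc G H _) in hv hx.
have nbx : bx%:A != 0 :> L by rewrite -hx.
exists (bv / bx); apply: (bbc_inj hfr); rewrite bbcZ vx; congr (_ *: _).
apply: (mulIf nbx); rewrite -[in LHS]hx.
have -> : c / mu * bbc G H x 0 0 = bv%:A by rewrite -hv vx [RHS]mxE.
rewrite -!in_algE -rmorphM /= divfK //.
by apply: contraNneq nbx => ->; rewrite scale0r.
Qed.

(** The lift is taken coefficient by coefficient: each coefficient vector has its first entry in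
    [F]. *)
Lemma lift_curve d (y : 'rV[{poly L}]_3) :
    (forall j, (size (y 0%R j) <= d.+1)%N) -> (fr (y 0 0) = y 0 0) ->
  exists f : 7.-tuple {poly_d.+1 F}, ccoord f = y.
Proof.
move=> sy yF.
have hx k : exists x, bbc G H x = \row_j (y 0 j)`_k.
  have [b hb] := frp_fixed k yF.
  have [x hx] := bbc_lift hfr b (y 0 1)`_k (y 0 2)`_k.
  by exists x; rewrite hx; apply: row3P; rewrite !mxE /= ?hb.
have [xs hxs] := choice hx.
exists (mkcurve d (fun j => \poly_(k < d.+1) xs k 0 j)).
apply/rowP => j; apply/polyP => k.
rewrite -bbc_coefrow.
have [lt|ge] := ltnP k d.+1; last first.
  rewrite [RHS]nth_default ?(leq_trans (sy j)) //.
  rewrite (_ : coefrow _ _ = 0) ?/bbc ?map_mx0 ?mul0mx ?mxE //.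
  by apply/rowP => i; rewrite !mxE nth_default // (leq_trans (size_npoly _)).
have -> : coefrow (mkcurve d (fun j => \poly_(k < d.+1) xs k 0 j)) k = xs k.
  apply/rowP => i; rewrite !mxE tnth_mktuple npolypK ?size_poly //.
  by rewrite coef_poly lt.
by rewrite hxs mxE.
Qed.

Lemma ccoord_eq d e m (f : 7.-tuple {poly_d.+1 F}) (c : 3.-tuple {poly_e.+1 F}) (h : {poly L})
    (t : option F) :
    d = (m + e)%N -> (size h <= m.+1)%N -> ccoord f = h *: pcoord c ->
  emb (cval idfun f t) *m G =
    ev m (omap (in_alg L) t) h *: (emb (cval idfun c t) *m M).
Proof.
move=> de sh fc; apply: (can_inj (mulmxK (unit_H hfr))).
rewrite -scalemxAl -[X in _ = _ *: X]mulmxA (frame_moore hfr).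
rewrite !map_cval !cvalE -mulmxA -!map_ev_mul -/(ccoord f) -/(pcoord c) fc.
apply/rowP => j; have := size_pcoord c j.
by move: (pcoord c) => p sp; rewrite !mxE (evM _ de).
Qed.

Lemma induced_curve d e m (c : 3.-tuple {poly_e.+1 F}) (h : {poly L}) :
    d = (m + e)%N -> (size h <= m.+1)%N ->
    (forall t, cval idfun c t != 0) ->
    (forall t : option F, ev m (omap (in_alg L) t) h != 0) ->
    fr (h * ppoly c) = h * ppoly c ->
  exists f : 7.-tuple {poly_d.+1 F}, [/\ ccoord f = h *: pcoord c,
    forall t, cpoint idfun f t = bb G (pgl M (ext L (cpoint idfun c t))) &
    induced_param G M [set pgl M (ext L p) | p in curve c]%classic c f].
Proof.
move=> de sh c0 h0 hF; have [j||f fc] := @lift_curve d (h *: pcoord c).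
- rewrite (_ : (h *: pcoord c) 0 j = h * pcoord c 0 j) ?[LHS]mxE // (leq_trans (size_polyMleq _ _)) //.
  by have := size_pcoord c j; rewrite de; move: (size (pcoord c _ _)) => k; lia.
- by rewrite mxE.
have pts t : cpoint idfun f t = bb G (pgl M (ext L (cpoint idfun c t))).
  rewrite /cpoint /ext mapv_line pgl_line.
  have h1 := ccoord_eq t de sh fc.
  rewrite (bb_line h1) // /bbc h1 -scalemxAl mxE -mulmxA (frame_moore hfr).
  rewrite (mul_moore a) mxE /= mulf_neq0 ?h0 //.
  by rewrite -ev_ppoly ev_ppoly_neq0.
exists f; split=> //; split=> // [|i j].
  apply/seteqP; split => [_ [t _ <-]|_ [_ [_ [t _ <-] <-] <-]] /=.
    exists (pgl M (ext L (cpoint idfun c t))); last by rewrite pts.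
    by exists (cpoint idfun c t) => //; exists t.
  by exists t => //; rewrite pts.
have uv : crow (in_alg L) f *m map_mx polyC G = h *: (crow (in_alg L) c *m map_mx polyC M).
  have uHp : map_mx polyC H \in unitmx by rewrite map_unitmx ?(unit_H hfr).
  apply: (can_inj (mulmxK uHp)); rewrite -mulmxA -map_mxM -/(ccoord f) fc.
  by rewrite -scalemxAl -mulmxA -map_mxM (frame_moore hfr).
by rewrite uv !mxE; ring.
Qed.

(** A functional killing the coordinates of [f] kills all h q with q of degree at most e, since
    these are [L]-combinations of the three coordinates [ccoord]. *)
Lemma nrc_spanning d e (f : 7.-tuple {poly_d.+1 F}) (c : 3.-tuple {poly_e.+1 F}) h :
    ccoord f = h *: pcoord c ->
    (forall q : {poly L}, (size q <= e.+1)%N ->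
       exists l : 'cV[L]_3, q%:M = crow (in_alg L) c *m map_mx polyC l) ->
    spanning d e h ->
  normal_rational_curve f.
Proof.
move=> fc cspan hs; apply: nrc_criterion => psi psi0.
pose Psi (q : {poly L}) := \sum_(k < d.+1) q`_k * (psi k 0)%:A.
have PsiD p q : Psi (p + q) = Psi p + Psi q.
  by rewrite -big_split; apply: eq_bigr => k _; rewrite coefD mulrDl.
have Psi0 : Psi 0 = 0.
  by rewrite /Psi big1 // => k _; rewrite coef0 mul0r.
have PsiC p b : Psi (p * b%:P) = Psi p * b.
  by rewrite /Psi mulr_suml; apply: eq_bigr => k _; rewrite coefMC mulrAC.
have Psif j : Psi (ccoord f 0 j) = 0.
  rewrite mxE (big_morph Psi PsiD Psi0) big1 // => i _.
  rewrite [map_mx _ _ _ _]mxE PsiC [crow _ _ _ _]mxE.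
  suff -> : Psi (map_poly (in_alg L) (tnth f i)) = 0 by rewrite mul0r.
  transitivity ((\sum_(k < d.+1) (tnth f i : {poly F})`_k * psi k 0)%:A : L).
    rewrite -in_algE rmorph_sum; apply: eq_bigr => k _.
    by rewrite coef_map rmorphM.
  by rewrite psi0 scale0r.
have Psi1 : forall q : {poly L}, (size q <= d.+1)%N -> Psi q = 0.
  apply: hs => [p q p0 q0|p p0|q sq].
  - by rewrite PsiD p0 q0 addr0.
  - rewrite -(rmorph0 frob) -p0 rmorph_sum; apply: eq_bigr => k _.
    by rewrite coef_map rmorphM /= frob_alg.
  have [l hl] := cspan q sq.
  have -> : h * q = \sum_j ccoord f 0 j * ((invmx (moore a) *m l) j 0)%:P.
    set r := invmx _ *m l.
    have pr : pcoord c *m map_mx polyC r = q%:M.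
      by rewrite hl /pcoord -mulmxA -map_mxM mulKVmx ?(moore_unit hL (frame_indep hfr)).
    transitivity ((ccoord f *m map_mx polyC r) 0 0).
      by rewrite fc -scalemxAl pr !mxE mulr1n.
    by rewrite [LHS]mxE; apply: eq_bigr => j _; rewrite [map_mx _ _ _ _]mxE.
  rewrite (big_morph Psi PsiD Psi0) big1 // => j _.
  by rewrite PsiC Psif mul0r.
apply/matrixP => k j; rewrite ord1 [RHS]mxE; apply/eqP.
rewrite -(fmorph_eq0 (in_alg L)); apply/eqP.
have := Psi1 'X^k; rewrite size_polyXn ltn_ord => /(_ isT) <-.
rewrite /Psi (bigD1 k) //= coefXn eqxx mul1r big1 ?addr0 // => i ik.
by rewrite coefXn -[_ == _]/(i == k) (negPf ik) mul0r.
Qed.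

End CurveLift.

(** * The tangent cover *)

Section Tangent.
Variables (F : finFieldType) (L : fieldExtType F).

Local Notation emb := (map_mx (in_alg L)).
Local Notation frob := (@frob F L).
Local Notation fr := (map_poly frob).

Variables (Sigma : {vspace 'rV[F]_7}) (linf : {vspace 'rV[L]_3}).
Variables (G : 'M[L]_(7, 3)) (M H : 'M[L]_3) (a : 'cV[L]_3).
Hypothesis hfr : bb_frame Sigma linf G M H a.

Let hL := frame_dim hfr.

(** The multiplier p^q p^(q^2) turns p into its norm, and p has no zero at parameters over [F]. It
    serves lines with m = 1 and conics with m = 2. *)
Lemma norm_curve d m (c : 3.-tuple {poly_m.+1 F}) :
    d = (m + m + m)%N ->
    (forall t, cval idfun c t != 0) ->
    (forall q : {poly L}, (size q <= m.+1)%N ->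
       exists l : 'cV[L]_3, q%:M = crow (in_alg L) c *m map_mx polyC l) ->
    let p := ppoly a c in
    size p = m.+1 -> coprimep p (fr p) ->
  exists f : 7.-tuple {poly_d.+1 F},
    [/\ ccoord G H f = (fr p * fr (fr p)) *: pcoord a c,
      forall t, cpoint idfun f t = bb G (pgl M (ext L (cpoint idfun c t))),
      induced_param G M [set pgl M (ext L p) | p in curve c]%classic c f
    & normal_rational_curve f].
Proof.
move=> de c0 cspan p sp cp.
have sh : (size (fr p * fr (fr p))%R <= (m + m).+1)%N.
  rewrite (leq_trans (size_polyMleq _ _)) // !size_frp sp; lia.
have [t||f [fc pts ind]] := induced_curve hfr de sh c0.
- have p0 := ev_ppoly_neq0 hfr (c0 t); rewrite -/p in p0.
  rewrite (@evM _ _ m m) ?size_frp ?sp // !ev_conj.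
  by rewrite mulf_neq0 // !frob_eq0.
- by rewrite -/p !rmorphM /= frp3 //; ring.
exists f; split=> //; apply: (nrc_spanning hfr fc cspan).
by apply: norm_spanning => //; rewrite de addnA.
Qed.

Definition line_param (v0 v1 : 'rV[F]_3) : 3.-tuple {poly_2 F} :=
  mkcurve 1 (fun j => (v0 0 j)%:P + v1 0 j *: 'X).

Lemma crow_line (K : fieldType) (iota : {rmorphism F -> K}) v0 v1 :
  crow iota (line_param v0 v1) =
  map_mx polyC (map_mx iota v0) + 'X *: map_mx polyC (map_mx iota v1).
Proof.
rewrite crow_mkcurve => [|j].
  apply/rowP => j; rewrite !mxE rmorphD /= map_polyC map_polyZ map_polyX.
  by rewrite -mul_polyC mulrC.
apply/leq_sizeP => -[|[|k]] // _.
by rewrite coefD coefZ coefC coefX mulr0 addr0.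
Qed.

Lemma cval_line (K : fieldType) (iota : {rmorphism F -> K}) v0 v1 t :
  cval iota (line_param v0 v1) t =
  if t is Some x then map_mx iota v0 + x *: map_mx iota v1 else map_mx iota v1.
Proof.
rewrite cvalE crow_line; apply/rowP => j; case: t => [x|]; rewrite !mxE /= ?hornerE //.
by rewrite coefD coefC coefXM coefC add0r.
Qed.

Lemma ppoly_line v0 v1 : ppoly a (line_param v0 v1) =
  ((emb v0 *m a) 0 0)%:P + ((emb v1 *m a) 0 0) *: 'X.
Proof.
rewrite ppolyE crow_line mulmxDl -scalemxAl -!map_mxM !mxE.
by rewrite -mul_polyC mulrC.
Qed.

Lemma line_span v0 v1 (q : {poly L}) : 
    (forall k0 k1, k0 *: v0 + k1 *: v1 = 0 -> k0 = 0 /\ k1 = 0) ->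
    (size q <= 2)%N ->
  exists l : 'cV[L]_3, q%:M = crow (in_alg L) (line_param v0 v1) *m map_mx polyC l.
Proof.
move=> iv sq; pose A : 'M[F]_(1 + 1, 3) := col_mx v0 v1.
have fA : row_free A.
  apply: inj_row_free => w; rewrite -[w]hsubmxK mul_row_col.
  rewrite [lsubmx w]mx11_scalar [rsubmx w]mx11_scalar !mul_scalar_mx.
  by case/iv => -> ->; rewrite raddf0 row_mx0.
have /row_freeP[B AB] := fA.
have : col_mx v0 v1 *m B = col_mx (row_mx 1%:M 0) (row_mx 0 1%:M).
  by rewrite [LHS]AB -[RHS]/(block_mx 1%:M 0 0 1%:M) -scalar_mx_block.
rewrite mul_col_mx => /eq_col_mx[B0 B1].
exists (emb B *m col_mx (q`_0)%:M (q`_1)%:M).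
rewrite crow_line mulmxDl -scalemxAl -!map_mxM !mulmxA -![emb _ *m emb B]map_mxM B0 B1.
rewrite !map_row_mx !map_mx1 !map_mx0 !mul_row_col !mul1mx !mul0mx addr0 add0r.
apply/matrixP => i j; rewrite !ord1 !mxE !mulr1n.
apply/polyP => k; rewrite coefD coefC coefXM coefC.
case: k => [|[|k]] /=; rewrite ?addr0 ?add0r //.
by rewrite nth_default // (leq_trans sq).
Qed.

Lemma coef1M (R : nzRingType) (p q : {poly R}) : (p * q)`_1 = p`_0 * q`_1 + p`_1 * q`_0.
Proof. by rewrite coefM !big_ord_recl big_ord0 addr0. Qed.

(** A projector onto [U] with entries in [F] also fixes every vector of the extension. *)
Lemma mem_ext n (U : {vspace 'rV[F]_n}) v : (emb v \in ext L U) = (v \in U).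
Proof.
apply/idP/idP => [vU|]; last exact: memv_mapv.
have [Q QU QK] := vs_proj U.
have : emb v *m (emb Q - 1%:M) = 0.
  apply: mapv_mulmx0 vU => u uU.
  by rewrite mulmxBr mulmx1 -map_mxM QK // subrr.
rewrite mulmxBr mulmx1 -map_mxM => /eqP; rewrite subr_eq0 => /eqP/map_mx_inj <-.
exact: QU.
Qed.

Lemma pgl_ext_inj : injective (fun U : {vspace 'rV[F]_3} => pgl M (ext L U)).
Proof.
move=> U V UV; apply/vspaceP => v.
have e (W : {vspace 'rV[F]_3}) : (v \in W) = (emb v *m M \in pgl M (ext L W)).
  by rewrite mem_pgl ?mulmxK ?(frame_unit hfr) // mem_ext.
by rewrite !e UV.
Qed.

(* At the point with x = 1, the tangent to the line 1 + theta x leaves in the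
   direction (0, x^q - x, x^(q^2) - x) of Sigma. *)
Lemma tangent_direction x v0 TP : frob x != x ->
    (emb v0 *m a) 0 0 = 1 ->
    (forall tl, tangent_at G M (pgl M (ext L <[v0]>%VS)) tl -> (tl <= TP)%VS) ->
  exists2 u, u \in TP & bbc G H u = row3 0 (frob x - x) (frob (frob x) - x).
Proof.
move=> nx v0a hTP.
have [v1 v1a] := findep_span hL (frame_indep hfr) x.
have iv (k0 k1 : F) : k0 *: v0 + k1 *: v1 = 0 -> k0 = 0 /\ k1 = 0.
  move=> k01; have kx : k0%:A + k1%:A * x = 0.
    transitivity ((emb (k0 *: v0 + k1 *: v1) *m a) 0 0); last by rewrite k01 map_mx0 mul0mx mxE.
    have lin : (emb (k0 *: v0 + k1 *: v1) *m a) 0 0 =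
        k0%:A * (emb v0 *m a) 0 0 + k1%:A * (emb v1 *m a) 0 0.
      by rewrite map_mxD !map_mxZ mulmxDl -!scalemxAl !mxE.
    by rewrite lin v0a v1a mulr1.
  have [k1z|nk1] := eqVneq k1 0.
    move: kx; rewrite k1z scale0r mul0r addr0 -in_algE => /eqP.
    by rewrite fmorph_eq0 => /eqP.
  case/eqP: nx; have -> : x = (- k0 / k1)%:A; last by rewrite frob_alg.
  rewrite -in_algE fmorph_div rmorphN /=.
  have nk : in_alg L k1 != 0 by rewrite fmorph_eq0.
  apply: (mulfI nk); rewrite [RHS]mulrC mulfVK //.
  by apply/eqP; rewrite -addr_eq0 addrC; apply/eqP.
pose c := line_param v0 v1.
have c0 t : cval idfun c t != 0.
  rewrite cval_line !map_mx_id //; apply/negP; case: t => [y|] /eqP h.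
    have [|/eqP] := iv 1 y; first by rewrite scale1r.
    by rewrite oner_eq0.
  have [|_ /eqP] := iv 0 1; first by rewrite scale0r scale1r add0r.
  by rewrite oner_eq0.
have pE : ppoly a c = 1 + x *: 'X by rewrite ppoly_line v0a v1a.
have nx0 : x != 0 by apply: contraNneq nx => ->; rewrite rmorph0.
have sp : size (ppoly a c) = 2%N.
  by rewrite pE addrC size_polyDl ?size_scale ?size_polyX ?size_poly1.
have p1E : fr (1 + x *: 'X) = 1 + frob x *: 'X.
  by rewrite rmorphD rmorph1 /= map_polyZ map_polyX.
have cp : coprimep (ppoly a c) (fr (ppoly a c)).
  have nd : frob x - x != 0 by rewrite subr_eq0.
  apply/Bezout_eq1_coprimepP.
  (* From x^q (1 + x X) - x (1 + x^q X) = x^q - x. *)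
  exists ((frob x / (frob x - x))%:P, (- x / (frob x - x))%:P) => /=.
  rewrite pE p1E.
  apply/polyP => -[|[|k]]; rewrite coefD !coefCM !coefD !coefZ !coefX !coef1 /= ?mulr1 ?mulr0 ?addr0 ?add0r.
  - by field.
  - by field.
  - by rewrite ?mulr0 ?addr0.
have [|f [fc pts ind nf]] := @norm_curve 3 1 c erefl c0 _ sp cp.
  by move=> q sq; apply: line_span.
have l0d : \dim (<[v0]> + <[v1]>) = 2%N.
  rewrite dimv_disjoint_sum ?dim_vline.
    have [n0 n1] : v0 != 0 /\ v1 != 0.
      by have := c0 (Some 0); have := c0 None; rewrite !cval_line !map_mx_id // scale0r addr0.
    by rewrite n0 n1.
  apply/eqP; rewrite -subv0; apply/subvP => u; rewrite memv_cap => /andP[/vlineP[k0 u0] /vlineP[k1 u1]].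
  have [|k00 _] := iv k0 (- k1); first by rewrite scaleNr -u0 -u1 subrr.
  by rewrite u0 k00 scale0r mem0v.
set l0 := (<[v0]> + <[v1]>)%VS in l0d.
have v0l : v0 \in l0 by rewrite -[v0]addr0 memv_add ?memv_line ?mem0v.
have v1l : v1 \in l0 by rewrite -[v1]add0r memv_add ?memv_line ?mem0v.
pose l := pgl M (ext L l0).
have bl : bb_line_param G M l f.
  exists c; suff -> : [set P | subplane M P /\ (P <= l)%VS]%classic =
    [set pgl M (ext L p) | p in curve c]%classic by [].
  apply/seteqP; split => [P [[p fp <-] Pl]|P [_ [t _ <-] <-]] /=.
    have [v nv pv] := flat0P fp.
    move: Pl; rewrite pv /ext mapv_line pgl_line -memvE mem_pgl ?(frame_unit hfr) //.
    rewrite mulmxK ?(frame_unit hfr) // mem_ext.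
    case/memv_addP => _ /vlineP[k0 ->] [_ /vlineP[k1 ->] vE].
    have [k00|nk0] := eqVneq k0 0.
      exists (cpoint idfun c None); first by exists None.
      rewrite /cpoint cval_line map_mx_id // mapv_line pgl_line.
      have nk1 : k1 != 0.
        by apply: contraNneq nv => k10; rewrite vE k00 k10 !scale0r addr0.
      apply/esym/(@eq_line _ _ _ _ k1%:A); first by rewrite -in_algE fmorph_eq0.
      by rewrite vE k00 scale0r add0r map_mxZ -scalemxAl.
    exists (cpoint idfun c (Some (k1 / k0))); first by exists (Some (k1 / k0)).
    rewrite /cpoint cval_line !map_mx_id // mapv_line pgl_line.
    apply/esym/(@eq_line _ _ _ _ k0%:A); first by rewrite -in_algE fmorph_eq0.
    rewrite vE scalemxAl -[_%:A]/(in_alg L k0) -map_mxZ scalerDr scalerA.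
    by rewrite mulrC divfK.
  split.
    by exists (cpoint idfun c t) => //; apply: flat0_line.
  rewrite /cpoint /ext mapv_line pgl_line -memvE mem_pgl ?(frame_unit hfr) //.
  rewrite mulmxK ?(frame_unit hfr) // mem_ext cval_line.
  by case: t => [y|]; rewrite !map_mx_id // rpredD // rpredZ.
have : (tangent_line f (Some 0%R) <= TP)%VS.
  apply: hTP; exists l, f, (Some 0%R); split=> //.
  - split; first by exists l0.
    rewrite /ext mapv_line pgl_line -memvE mem_pgl ?(frame_unit hfr) //.
    by rewrite mulmxK ?(frame_unit hfr) // mem_ext.
  - by rewrite pts /cpoint cval_line !map_mx_id // scale0r addr0.
have x0E : cval idfun f (Some 0) = coefrow f 0.
  by apply/rowP => j; rewrite !mxE map_poly_id // horner_coef0.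
have x1E : map_mx (fun p : {poly F} => p^`().[0]) (crow idfun f) = coefrow f 1.
  by apply/rowP => j; rewrite !mxE map_poly_id // horner_coef0 coef_deriv.
rewrite /tangent_line x0E x1E subv_add -!memvE => /andP[x0T x1T].
(* The constant and linear coefficients of X_0, the norm of 1 + x X, are 1 and the trace of x;
   subtracting the trace times the point moves the tangent vector into [Sigma]. *)
pose tr := x + frob x + frob (frob x).
have [b hb] : exists b : F, tr = b%:A.
  by apply: frob_fixed; rewrite /tr !rmorphD /= frob3 //; ring.
exists (coefrow f 1 - b *: coefrow f 0); first by rewrite rpredB // rpredZ.
rewrite -scaleNr bbcD bbcZ.
have pcE : ccoord G H f = (fr (1 + x *: 'X) * fr (fr (1 + x *: 'X))) *:
    row3 (1 + x *: 'X) (fr (1 + x *: 'X)) (fr (fr (1 + x *: 'X))).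
  by rewrite fc pcoordE pE.
have p2E : fr (1 + frob x *: 'X) = 1 + frob (frob x) *: 'X.
  by rewrite rmorphD rmorph1 /= map_polyZ map_polyX.
rewrite p1E p2E in pcE.
rewrite scaleNr -hb /tr.
have e0 : bbc G H (coefrow f 0) = row3 1 1 1.
  apply: row3P; rewrite bbc_coefrow pcE !mxE /= !coef0M !coefD !coefZ !coefX !coef1 /=; ring.
have e1 : bbc G H (coefrow f 1) = row3 (x + frob x + frob (frob x))
    (frob x + frob x + frob (frob x)) (frob x + frob (frob x) + frob (frob x)).
  apply: row3P; rewrite bbc_coefrow pcE !mxE /= !coef1M !coef0M !coefD !coefZ !coefX !coef1 /=; ring.
rewrite e0 e1; apply: row3P; rewrite !mxE /=; ring.
Qed.

(** If the cover were of the second kind, inserting the tangent directions at the point x = 1 would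
    give a linearised identity in y whose coefficient of y is - z. *)
Lemma tangent_cover_type T : tangent_cover Sigma linf G M T ->
  forall A, T A -> exists2 z, z != 0 & ctype G H frob z A.
Proof.
move=> [covT tanT]; have [//|h2] := cover_type hfr covT.
have [v0 v0a] := findep_span hL (frame_indep hfr) 1.
have [|TP [_ hTP [A TA TPA]]] := tanT (pgl M (ext L <[v0]>%VS)).
  exists <[v0]>%VS => //; apply: flat0_line; apply/negP => /eqP v00.
  by move: v0a; rewrite v00 map_mx0 mul0mx mxE => /esym/eqP; rewrite oner_eq0.
have [z nz hA] := h2 A TA.
have ind y : (- z) * y + (z + frob z) * frob y + (- frob z) * frob (frob y) = 0.
  have [fy|nfy] := eqVneq (frob y) y; first by rewrite !fy; ring.
  have [u uT uE] := tangent_direction nfy v0a hTP.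
  have uA : u \in A.
    by apply: (subvP TPA); rewrite memv_cap uT (frame_Sigma hfr) -/(bbc G H u) uE mxE /= eqxx.
  have [_] := (hA u).1 uA; rewrite uE !mxE /= rmorphB rmorphB /= frob3 // => h.
  have {}h : z * (frob y - y) - (- frob z * (frob y - frob (frob y))) = 0.
    by rewrite h subrr.
  by rewrite -h; ring.
have [/eqP z0 _ _] := frob_indep hL ind.
by move: z0; rewrite oppr_eq0 (negPf nz).
Qed.

End Tangent.

(** * Special conics *)

Lemma map_qform (R1 R2 : comNzRingType) (g : {rmorphism R1 -> R2}) (A : 'M[R1]_3) v :
  qform (map_mx g A) (map_mx g v) = g (qform A v).
Proof. by rewrite /qform map_trmx -!map_mxM mxE. Qed.

Section Special.
Variables (F : finFieldType) (L : fieldExtType F).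

Local Notation emb := (map_mx (in_alg L)).
Local Notation frob := (@frob F L).
Local Notation fr := (map_poly frob).

Variables (Sigma : {vspace 'rV[F]_7}) (linf : {vspace 'rV[L]_3}).
Variables (G : 'M[L]_(7, 3)) (M H : 'M[L]_3) (a : 'cV[L]_3).
Hypothesis hfr : bb_frame Sigma linf G M H a.

Let hL := frame_dim hfr.
Let uM := frame_unit hfr.
Let uD : moore a \in unitmx := moore_unit hL (frame_indep hfr).

(** In coordinates of the subplane the lines X_j = 0 are given by the columns of the Moore matrix,
    which Frobenius permutes. *)
Lemma mem_conjugate (U : {vspace 'rV[L]_3}) (j1 j2 : 'I_3) :
    map_mx frob (col j1 (moore a)) = col j2 (moore a) ->
    (forall y, (y \in U) = ((y *m H) 0 j1 == 0)) ->
  forall y, (y \in conjugate M U) = ((y *m H) 0 j2 == 0).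
Proof.
move=> hj hU y; rewrite /conjugate mem_pgl //.
rewrite -[mapv _ _]/(mapv frob (pgl (invmx M) U)).
have colE' (B : 'rV[L]_3) j : (B *m col j (moore a) == 0) = ((B *m moore a) 0 j == 0).
  rewrite colE mulmxA -colE; apply/eqP/eqP => [/matrixP/(_ 0 0)|h].
    by rewrite [LHS]mxE [RHS]mxE.
  by apply/matrixP => i k; rewrite !ord1 [LHS]mxE [RHS]mxE.
rewrite (@mem_mapv_ker _ _ _ _ (col j1 (moore a))) => [||v].
- by rewrite hj colE' -(frame_moore hfr) mulmxA mulmxKV.
- apply/negP => /eqP h; have /matrixP/(_ j1 0) : invmx (moore a) *m col j1 (moore a) = 0.
    by rewrite h mulmx0.
  rewrite colE mulmxA mulVmx // mul1mx !mxE !eqxx => /eqP.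
  by rewrite oner_eq0.
by rewrite mem_pgl ?unitmx_inv // invmxK hU colE' -mulmxA (frame_moore hfr).
Qed.

Lemma conic_ext_vertex (A : 'M[F]_3) (U : {vspace 'rV[L]_3}) (i1 i2 j : 'I_3) :
    (forall i, [|| i == i1, i == i2 | i == j]) ->
    (forall y, (y \in U) = ((y *m H) 0 i1 == 0) && ((y *m H) 0 i2 == 0)) ->
  conic_ext M A U <-> exists2 v : 'rV[L]_3, v != 0 /\ qform (emb A) v = 0 &
    (v *m moore a) 0 i1 = 0 /\ (v *m moore a) 0 i2 = 0.
Proof.
move=> hi hU; split=> [[P [fP qP] PU]|[v [nv qv] [v1 v2]]].
  have [v nv Pv] := flat0P fP; exists v.
    by split=> //; apply: qP; rewrite Pv memv_line.
  have : v *m M \in U by rewrite -PU Pv pgl_line memv_line.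
  by rewrite hU -mulmxA (frame_moore hfr) => /andP[/eqP-> /eqP->].
exists <[v]>%VS.
  split=> [|_ /vlineP[k ->]]; first exact: flat0_line.
  rewrite /qform -scalemxAl -scalemxAl linearZ /= -scalemxAr scalerA.
  rewrite (_ : _ *m _ = 0) ?scaler0 ?mxE //.
  by apply/matrixP => i k'; rewrite !ord1 [RHS]mxE; exact: qv.
rewrite pgl_line.
have vj : (v *m moore a) 0 j != 0.
  apply: contraNneq nv => vj; apply/eqP/(can_inj (mulmxK uD)); rewrite mul0mx.
  by apply/rowP => i; rewrite [RHS]mxE; case/or3P: (hi i) => /eqP->.
apply/vspaceP => y; rewrite hU; apply/vlineP/andP => [[k ->]|[/eqP y1 /eqP y2]].
  rewrite -scalemxAl -mulmxA (frame_moore hfr).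
  by split; rewrite [X in X == _]mxE ?v1 ?v2 mulr0.
exists ((y *m H) 0 j / (v *m moore a) 0 j).
apply: (can_inj (mulmxK (unit_H hfr))); rewrite -scalemxAl -mulmxA (frame_moore hfr).
apply/rowP => i; rewrite [RHS]mxE.
by case/or3P: (hi i) => /eqP->; rewrite ?y1 ?y2 ?v1 ?v2 ?mulr0 // divfK.
Qed.

Definition vertex_on_conic (A : 'M[F]_3) (i1 i2 : 'I_3) : Prop :=
  exists2 v : 'rV[L]_3, v != 0 /\ qform (emb A) v = 0 &
    (v *m moore a) 0 i1 = 0 /\ (v *m moore a) 0 i2 = 0.

Lemma special_conicP A : special_conic linf M A <->
  [/\ vertex_on_conic A 0 1, vertex_on_conic A 0 2 & vertex_on_conic A 1 2].
Proof.
have h0 := frame_linf hfr.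
have h1 := @mem_conjugate linf 0 1 _ h0.
have {}h1 : forall y, (y \in conjugate M linf) = ((y *m H) 0 1 == 0).
  by apply: h1; apply/matrixP => i j; rewrite !mxE.
have h2 : forall y, (y \in conjugate M (conjugate M linf)) = ((y *m H) 0 2 == 0).
  by apply: (mem_conjugate _ h1); apply/matrixP => i j; rewrite !mxE.
have E01 := @conic_ext_vertex A (linf :&: conjugate M linf)%VS 0 1 2.
have E02 := @conic_ext_vertex A (linf :&: conjugate M (conjugate M linf))%VS 0 2 1.
have E12 := @conic_ext_vertex A (conjugate M linf :&: conjugate M (conjugate M linf))%VS 1 2 0.
rewrite /special_conic /vertex_on_conic /=.
by split=> [[/E01 H1 /E02 H2 /E12 H3]|[/E01 H1 /E02 H2 /E12 H3]]; split;
   (apply: H1 || apply: H2 || apply: H3);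
   (try by elim/ord3P); move=> y; rewrite memv_cap ?h0 ?h1 ?h2.
Qed.

Definition cspan e (c : 3.-tuple {poly_e.+1 F}) : Prop :=
  forall q : {poly L}, (size q <= e.+1)%N ->
    exists l : 'cV[L]_3, q%:M = crow (in_alg L) c *m map_mx polyC l.

Section Poly.
Variable c : 3.-tuple {poly_3 F}.
Hypothesis span_c : cspan c.
Local Notation p := (ppoly a c).

Lemma pcoord_span (q : {poly L}) : (size q <= 3)%N ->
  exists l0 l1 l2, q = l0 *: p + l1 *: fr p + l2 *: fr (fr p).
Proof.
move=> sq; have [l hl] := span_c sq.
pose r := invmx (moore a) *m l; exists (r 0 0), (r 1 0), (r 2 0).
have := hl; rewrite -[l](mulKVmx uD) map_mxM mulmxA -/(pcoord a c) -/r pcoordE.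
move=> /matrixP/(_ 0 0); rewrite mxE mulr1n => ->.
by rewrite [LHS]mxE sum3E !mxE /= ![_ * _%:P]mulrC !mul_polyC.
Qed.

(** The conjugates of p have the same degree and span all quadratics. *)
Lemma size_ppoly3 : size p = 3%N.
Proof.
apply/eqP; rewrite eqn_leq size_ppoly ltnNge; apply/negP => sp.
have [|l0 [l1 [l2 e]]] := @pcoord_span 'X^2; first by rewrite size_polyXn.
have : (size ('X^2 : {poly L}) <= 2)%N.
  apply/leq_sizeP => k lek; rewrite e !coefD !coefZ !coef_map.
  by rewrite [p`_k]nth_default ?(leq_trans sp) //= !rmorph0 !mulr0 !addr0.
by rewrite size_polyXn.
Qed.

Lemma cval_ext_neq0 (t : option L) : cval (in_alg L) c t != 0.
Proof.
pose q : {poly L} := if t is Some _ then 1 else 'X^2.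
have [|l hl] := span_c (q := q).
  by rewrite /q; case: (t) => [?|]; rewrite ?size_poly1 ?size_polyXn.
apply/negP => /eqP c0.
have := congr1 (map_mx (ev 2 t)) hl; rewrite map_ev_mul -cvalE c0 mul0mx.
move=> /matrixP/(_ 0 0); rewrite !mxE mulr1n /q.
case: (t) => [x|] /=; rewrite ?hornerE ?coefXn => /eqP; by rewrite oner_eq0.
Qed.

(** Otherwise all conjugates would be multiples of p, and the span would be one-dimensional. *)
Lemma ppoly_not_eqp : ~~ (p %= fr p).
Proof.
apply/negP => /eqpf_eq[k nk pk].
have nk' : fr p = k^-1 *: p by rewrite {2}pk scalerA mulVf ?scale1r.
have line (q : {poly L}) : (size q <= 3)%N -> exists l, q = l *: p.
  move=> sq; have [l0 [l1 [l2 ->]]] := pcoord_span sq.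
  exists (l0 + l1 * k^-1 + l2 * (frob k^-1 * k^-1)).
  by rewrite nk' map_polyZ nk' !scalerA !scalerDl !mulrA.
have [|l e1] := line 1; first by rewrite size_poly1.
have l0 : l != 0 by apply: contra_eq_neq e1 => ->; rewrite scale0r oner_eq0.
have : size (1 : {poly L}) = 3%N by rewrite e1 size_scale // size_ppoly3.
by rewrite size_poly1.
Qed.

(** Equivalently t and t^(q^2) are roots of p. *)
Definition conj_root (t : L) : Prop := root p t /\ root (fr p) t.

Lemma coprime_or_conj_root : coprimep p (fr p) \/ exists t, conj_root t.
Proof.
have [|ncp] := boolP (coprimep p (fr p)); [by left | right].
have np : p != 0 by rewrite -size_poly_gt0 size_ppoly3.
pose d := gcdp p (fr p).
have nd : d != 0 by rewrite gcdp_eq0 negb_and np.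
have dp : d %| p := dvdp_gcdl _ _.
have dq : d %| fr p := dvdp_gcdr _ _.
have : (size d <= 3)%N by rewrite -size_ppoly3 dvdp_leq.
rewrite /coprimep -/d in ncp; rewrite -size_poly_gt0 in nd.
case sd: (size d) ncp nd => [|[|[|[|k]]]] // _ _ _.
  have [r rd] := poly2_root sd; exists r.
  by rewrite -dvdp_XsubCl in rd; split; rewrite -dvdp_XsubCl; apply: dvdp_trans rd _.
have := dvdp_size_eqp dp; rewrite sd size_ppoly3 eqxx => /esym d1.
have := dvdp_size_eqp dq; rewrite sd size_frp size_ppoly3 eqxx => /esym d2.
case/negP: ppoly_not_eqp; rewrite eqp_sym in d1.
exact: eqp_trans d1 d2.
Qed.

Variable A : 'M[F]_3.
Hypothesis eq_c : qform (map_mx polyC A) (crow idfun c) = 0.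

Lemma qform_cval t : qform (emb A) (cval (in_alg L) c (Some t)) = 0.
Proof.
have -> : cval (in_alg L) c (Some t) = map_mx (horner_eval t) (map_mx (map_poly (in_alg L)) (crow idfun c)).
  by apply/rowP => j; rewrite !mxE /= map_poly_id.
have -> : emb A = map_mx (horner_eval t) (map_mx (map_poly (in_alg L)) (map_mx polyC A)).
  by apply/matrixP => i j; rewrite !mxE map_polyC horner_evalE hornerC.
by rewrite !map_qform eq_c !rmorph0.
Qed.

Lemma cval_moore (t : option L) :
  cval (in_alg L) c t *m moore a = row3 (ev 2 t p) (ev 2 t (fr p)) (ev 2 t (fr (fr p))).
Proof.
rewrite cvalE -map_ev_mul -/(pcoord a c) pcoordE.
by apply: row3P; rewrite !mxE.
Qed.

Lemma horner_frp (q : {poly L}) s : (fr q).[frob s] = frob q.[s].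
Proof. by rewrite horner_map. Qed.

Lemma conj_root_special t : conj_root t -> special_conic linf M A.
Proof.
move=> [/rootP p0 /rootP p1]; apply/special_conicP.
(* The parameters t, t^(q^2) and t^q annihilate the coordinate pairs (0, 1), (0, 2) and (1, 2),
   giving the three vertices. *)
have vert s i1 i2 : (cval (in_alg L) c (Some s) *m moore a) 0 i1 = 0 ->
    (cval (in_alg L) c (Some s) *m moore a) 0 i2 = 0 -> vertex_on_conic A i1 i2.
  move=> h1 h2; exists (cval (in_alg L) c (Some s)); last by [].
  by split; [exact: cval_ext_neq0 | exact: qform_cval].
split.
- by apply: (@vert t); rewrite cval_moore !mxE.
- apply: (@vert (frob (frob t))); rewrite cval_moore !mxE /=.
    apply/eqP; rewrite -[_ == 0]frob_eq0 -horner_frp frob3 //; exact/eqP.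
  by rewrite !horner_frp p0 !rmorph0.
- apply: (@vert (frob t)); rewrite cval_moore !mxE /=.
    by rewrite horner_frp p0 rmorph0.
  by rewrite horner_frp p1 rmorph0.
Qed.

(* If p, p^q and p^(q^2) are pairwise coprime, their product divides the
   F-rational coordinate X_0 of any lift of the conic. *)
Lemma coprime_degree d (f : 7.-tuple {poly_d.+1 F}) X :
    (d < 6)%N -> coprimep p (fr p) ->
    induced_param G M X c f -> ~ normal_rational_curve f.
Proof.
move=> d6 cp [_ _ prop] nf.
pose u := crow (in_alg L) f *m map_mx polyC G.
pose w := crow (in_alg L) c *m map_mx polyC M.
pose U := ccoord G H f.
have UE : U = u *m map_mx polyC H by rewrite /U /ccoord map_mxM mulmxA.
have pE : pcoord a c = w *m map_mx polyC H.
  by rewrite /w -mulmxA -map_mxM (frame_moore hfr).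
have outer (x y : 'rV[{poly L}]_3) i j : (x^T *m y) i j = x 0 i * y 0 j.
  by rewrite !mxE big_ord1 mxE.
have cross : u^T *m w = w^T *m u.
  by apply/matrixP => i j; rewrite !outer prop mulrC.
clearbody u w.
have Up i j : U 0 i * pcoord a c 0 j = U 0 j * pcoord a c 0 i.
  have : U^T *m pcoord a c = (pcoord a c)^T *m U.
    by rewrite UE pE !trmx_mul -!mulmxA [u^T *m _]mulmxA cross !mulmxA.
  by move=> /matrixP/(_ i j); rewrite !outer => ->; rewrite mulrC.
have np : p != 0 by rewrite -size_poly_gt0 size_ppoly3.
have U0F : fr (U 0 0) = U 0 0.
  apply/polyP => k; rewrite coef_map /= -bbc_coefrow.
  by have [b hb] := frame_base hfr (coefrow f k); rewrite /bbc hb frob_alg.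
have sU : (size (U 0%R 0%R) <= d.+1)%N.
  rewrite mxE (leq_trans (size_sum _ _ _)) //; apply/bigmax_leqP => i _.
  rewrite [map_mx _ _ _ _]mxE mulrC mul_polyC (leq_trans (size_scale_leq _ _)) //.
  exact: size_crow.
have pU : p %| U 0 0.
  (* Proportionality reads U_0 p^q = U_1 p, and p is coprime to p^q. *)
  have := Up 0 1; rewrite pcoordE !mxE /= => e.
  rewrite -(Gauss_dvdpl _ cp) e dvdp_mull //.
have p1U : fr p %| U 0 0 by rewrite -U0F dvdp_map.
have p2U : fr (fr p) %| U 0 0 by rewrite -U0F dvdp_map.
have cp1 : coprimep (fr p) (fr (fr p)) by rewrite coprimep_map.
have cp2 : coprimep (fr (fr p)) p by rewrite -[X in coprimep _ X](frp3 hL) coprimep_map.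
have U0 : U 0 0 = 0.
  have dv : p * fr p * fr (fr p) %| U 0 0.
    rewrite Gauss_dvdp ?Gauss_dvdp ?pU ?p1U // coprimepMl cp1 coprimep_sym cp2 //.
  apply/eqP; apply/negPn/negP => nU; have := dvdp_leq nU dv.
  rewrite !size_mul ?mulf_neq0 ?map_poly_eq0 // !size_frp size_ppoly3 /=.
  by move: (size _) sU d6 => k; lia.
have Uj : U = 0.
  apply/rowP => j; rewrite [RHS]mxE; have := Up 0 j.
  rewrite U0 mul0r => /esym/eqP; rewrite mulf_eq0 pcoordE [X in _ || (X == _)]mxE /=.
  by rewrite (negPf np) orbF => /eqP.
have f0 j : tnth f j = 0.
  apply/npolyP => k; have : coefrow f k = 0.
    apply: (bbc_inj hfr); apply/rowP => i; rewrite bbc_coefrow -/U Uj.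
    by rewrite /bbc map_mx0 !mul0mx !mxE coef0.
  by move=> /rowP/(_ j); rewrite !mxE coef0.
have : (npolyp d.+1 1 : {poly_d.+1 F}) \in <<f>>%VS by rewrite nf memvf.
have -> : (<<f>> = 0)%VS.
  apply/eqP; rewrite -subv0; apply/span_subvP => _ /tnthP[j ->].
  by rewrite f0 mem0v.
rewrite memv0 => /eqP/(congr1 (fun q : {poly_d.+1 F} => (q : {poly F})`_0)).
rewrite npolypK ?size_poly1 // coef1 /= coef0 => /eqP.
by rewrite oner_eq0.
Qed.

End Poly.

End Special.

(** * Transversal lines *)

Section Transversal.
Variables (F : finFieldType) (L : fieldExtType F).

Local Notation emb := (map_mx (in_alg L)).
Local Notation frob := (@frob F L).

Variables (Sigma : {vspace 'rV[F]_7}) (linf : {vspace 'rV[L]_3}).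
Variables (G : 'M[L]_(7, 3)) (M H : 'M[L]_3) (a : 'cV[L]_3).
Hypothesis hfr : bb_frame Sigma linf G M H a.

Let hL := frame_dim hfr.

Definition lf (l : 'cV[L]_7) (w : 'rV[L]_7) : L := (w *m l) 0 0.

Lemma lfD l u w : lf l (u + w) = lf l u + lf l w.
Proof. by rewrite /lf mulmxDl mxE. Qed.

Lemma lfZ l k w : lf l (k *: w) = k * lf l w.
Proof. by rewrite /lf -scalemxAl mxE. Qed.

Lemma lfB l u w : lf l (u - w) = lf l u - lf l w.
Proof. by rewrite -scaleN1r lfD lfZ mulN1r. Qed.

(* The coordinate X_j^(q^i), extended linearly from PG(6, q) to PG(6, q^3). *)
Definition cf (i : nat) (j : 'I_3) : 'cV[L]_7 :=
  map_mx (iter i frob) (col j (G *m H)).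

Lemma lf_emb i j x : lf (cf i j) (emb x) = iter i frob (bbc G H x 0 j).
Proof.
have fixed b : iter i frob (in_alg L b) = in_alg L b.
  by elim: i => //= i ->; rewrite frob_alg.
have iD : {morph iter i frob : u v / u + v}.
  by elim: i {fixed} => [|i IH] u v //; rewrite !iterS IH rmorphD.
have iM : {morph iter i frob : u v / u * v}.
  by elim: i {fixed iD} => [|i IH] u v //; rewrite !iterS IH rmorphM.
have i0 : iter i frob 0 = 0 by elim: i {fixed iD iM} => //= i ->; rewrite rmorph0.
rewrite /lf /bbc -mulmxA mxE [in RHS]mxE (big_morph _ iD i0).
by apply: eq_bigr => k _; rewrite iM [cf _ _ _ _]mxE [emb x _ _]mxE fixed [col _ _ _ _]mxE.
Qed.

Definition al (i : 'I_3) : 'cV[L]_7 := cf i 1.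
(** The shift by 2 pairs [be i] with [al i]: together they express the i-th conjugate of X_1 = k
    X_2^(q^2). *)
Definition be (i : 'I_3) : 'cV[L]_7 := cf i.+2 2.

(** These seven forms are a basis of the dual space. X_0 appears once because it is its own
    conjugate, and the shift in [be] still runs over all conjugates of X_2. *)
Lemma lf_inj w : lf (cf 0 0) w = 0 ->
  (forall i, lf (al i) w = 0) -> (forall i, lf (be i) w = 0) -> w = 0.
Proof.
move=> w0 wal wbe.
have hv j : exists v : 'rV[F]_3, (emb v *m a) 0 0 = w 0 j.
  exact: (findep_span hL (frame_indep hfr) (w 0 j)).
have [v hv'] := choice hv.
pose x i : 'rV[F]_7 := \row_j v j 0 i.
(* Writing w over the [F]-basis [a] of [L] reduces the claim to rational vectors, separated by the
   Moore matrix. *)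
have wE : w = \sum_i a i 0 *: emb (x i).
  apply/rowP => j; rewrite -hv' mxE summxE; apply: eq_bigr => i _.
  by rewrite !mxE mulrC.
have lfE i j : lf (cf i j) w = \sum_k a k 0 * iter i frob (bbc G H (x k) 0 j).
  rewrite wE /lf mulmx_suml summxE; apply: eq_bigr => k _.
  by rewrite -lf_emb -/(lf _ _) lfZ.
have coord0 j : (forall i, lf (cf i j) w = 0) -> forall k, bbc G H (x k) 0 j = 0.
  move=> h; pose y : 'rV[L]_3 := \row_k bbc G H (x k) 0 j.
  suff y0 : y = 0.
    by move=> k; move/rowP: y0 => /(_ k); rewrite !mxE.
  apply: (can_inj (mulmxK (moore_unit hL (frame_indep hfr)))); rewrite mul0mx.
  have := h 0%N; have := h 1%N; have := h 2%N; rewrite !lfE !sum3E /= => h2 h1 h0.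
  apply: row3P; rewrite [RHS]mxE mxE sum3E ![y _ _]mxE ![moore _ _ _]mxE /=.
  - by rewrite -h0; ring.
  - have := congr1 (fun u => frob (frob u)) h2.
    rewrite !(rmorphD, rmorphM, rmorph0) /= !frob3 // => h2'.
    have := congr1 frob h2; rewrite !(rmorphD, rmorphM, rmorph0) /= !frob3 // => h2''.
    by rewrite -h2''; ring.
  - have := congr1 (fun u => frob (frob u)) h1.
    rewrite !(rmorphD, rmorphM, rmorph0) /= !frob3 // => h1'.
    by rewrite -h1'; ring.
have per i j u : lf (cf i.+3 j) u = lf (cf i j) u.
  congr (lf _ _); apply/colP => k; rewrite !mxE /=.
  by rewrite frob3.
have perM n i j u : lf (cf (n * 3 + i) j) u = lf (cf i j) u.
  by elim: n => [|n IH] //; rewrite mulSn -addnA -[(3 + _)%N]/((n * 3 + i).+3) per.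
have x0 k : x k = 0.
  apply: (bbc_inj hfr); rewrite [RHS]/bbc map_mx0 !mul0mx.
  apply: row3P; rewrite [RHS]mxE.
  - have hb k' : exists b : F, bbc G H (x k') 0 0 = b%:A := frame_base hfr (x k').
    have [b hb'] := choice hb.
    suff b0 : \row_k' b k' = 0 :> 'rV[F]_3.
      by rewrite hb'; move/rowP: b0 => /(_ k); rewrite !mxE => ->; rewrite scale0r.
    apply: (frame_indep hfr); rewrite mxE -[RHS]w0 lfE; apply: eq_bigr => k' _.
    by rewrite [map_mx _ _ _ _]mxE [X in in_alg L X]mxE /= -hb' mulrC.
  - apply: coord0 => i; rewrite -(wal (inord (i %% 3))) /al inordK ?ltn_pmod //.
    by rewrite {1}(divn_eq i 3) perM.
  - apply: coord0 => i; rewrite -(wbe (inord (i.+1 %% 3))) /be inordK ?ltn_pmod //.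
    by rewrite -[in LHS]per {1}(divn_eq i.+1 3) -!addnS perM.
by rewrite wE big1 // => k _; rewrite x0 map_mx0 scaler0.
Qed.

Lemma ext_ctype z A w (i : 'I_3) : ctype G H (frob \o frob) z A -> w \in ext L A ->
  iter i frob z * lf (al i) w = - iter i.+1 frob z * lf (be i) w.
Proof.
move=> hA wA; pose l := iter i frob z *: al i + iter i.+1 frob z *: be i.
have lfl u : lf l u = iter i frob z * lf (al i) u + iter i.+1 frob z * lf (be i) u.
  by rewrite /lf mulmxDr -!scalemxAr [LHS]mxE [X in X + _]mxE [X in _ + X]mxE.
suff : w *m l = 0.
  move=> /matrixP/(_ 0 0); rewrite [RHS]mxE -[LHS]/(lf l w) lfl => /eqP.
  by rewrite addr_eq0 -mulNr => /eqP.
apply: mapv_mulmx0 wA => v /hA[_ hv].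
apply/matrixP => k1 k2; rewrite !ord1 [RHS]mxE -[LHS]/(lf l (emb v)) lfl !lf_emb.
have iM k : {morph iter k frob : x y / x * y}.
  by elim: k => [|k IH] x y //; rewrite !iterS IH rmorphM.
have iN k : {morph iter k frob : x / - x}.
  by elim: k => [|k IH] x //; rewrite !iterS IH rmorphN.
have := congr1 (iter i frob) hv; rewrite !iM iN /= => ->.
rewrite -[frob (frob (bbc G H v 0 2))]/(iter 2 frob (bbc G H v 0 2)) -iterD addn2.
by rewrite -iterSr /=; ring.
Qed.

(** A Plücker coordinate of the line PQ. *)
Definition wedge (P Q : 'rV[L]_7) (l m : 'cV[L]_7) : L := lf l P * lf m Q - lf l Q * lf m P.

Lemma wedge_antisym P Q l m : wedge P Q m l = - wedge P Q l m.
Proof. by rewrite /wedge; ring. Qed.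

Section Line.
Variables (CC : set {vspace 'rV[F]_7}) (g : {vspace 'rV[L]_7}).
Hypothesis hCC : forall z, z != 0 -> exists2 A, CC A & ctype G H (frob \o frob) z A.
Hypothesis hg : transversal_line Sigma CC g.

Variables P Q : 'rV[L]_7.
Hypothesis gPQ : forall w, w \in g -> exists s t, w = s *: P + t *: Q.

Lemma transversal_pencil z : z != 0 -> exists s t, (s != 0) || (t != 0) /\
  forall i, lf (al i) (s *: P + t *: Q) =
    iter i frob (- (frob z / z)) * lf (be i) (s *: P + t *: Q).
Proof.
move=> nz; have [A CA hA] := hCC nz; have [_ _ _ meet] := hg.
have /meet : CC A := CA.
rewrite /intersects -vpick0; set w := vpick _ => nw.
have := memv_pick (g :&: ext L A)%VS; rewrite -/w memv_cap => /andP[wg wA].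
have [s [t wE]] := gPQ wg; exists s, t; split.
  apply: contraNT nw; rewrite negb_or !negbK => /andP[/eqP s0 /eqP t0].
  by rewrite wE s0 t0 !scale0r addr0.
move=> i; rewrite -wE; have := ext_ctype i hA wA.
have inz : iter i frob z != 0 by elim: (nat_of_ord i) => //= k IH; rewrite frob_eq0.
have -> : iter i frob (- (frob z / z)) = - (iter i.+1 frob z / iter i frob z).
  rewrite iterSr; elim: (nat_of_ord i) => //= k ->.
  by rewrite rmorphN fmorph_div.
by move=> h; apply: (mulfI inz); rewrite h; field.
Qed.

(** A point of the line satisfies the i-th and the j-th equation for k, so the minor of these two
    equations on P, Q vanishes. It is a polynomial in two conjugates of k, and [norm_indep] kills
    each of its coefficients. *)
Lemma wedge_zero i j : i != j ->
  [/\ wedge P Q (al i) (al j) = 0, wedge P Q (al i) (be j) = 0,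
      wedge P Q (be i) (al j) = 0 & wedge P Q (be i) (be j) = 0].
Proof.
have rel z : z != 0 -> let k := - (frob z / z) in forall i j,
    wedge P Q (al i) (al j) - iter j frob k * wedge P Q (al i) (be j)
    - iter i frob k * wedge P Q (be i) (al j)
    + iter i frob k * iter j frob k * wedge P Q (be i) (be j) = 0.
  move=> nz k i' j'; have [s [t [st hst]]] := transversal_pencil nz.
  have := hst i'; have := hst j'; rewrite -/k !lfD !lfZ /wedge.
  move: (iter i' frob k) (iter j' frob k) => ki kj.
  move: (lf (al i') P) (lf (al i') Q) (lf (al j') P) (lf (al j') Q) => a1 a2 a3 a4.
  move: (lf (be i') P) (lf (be i') Q) (lf (be j') P) (lf (be j') Q) => b1 b2 b3 b4.
  move=> h1 h2.
  have e1 : s * (a1 - ki * b1) + t * (a2 - ki * b2) = 0.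
    by transitivity (s * a1 + t * a2 - ki * (s * b1 + t * b2)); [ring | rewrite h2 subrr].
  have e2 : s * (a3 - kj * b3) + t * (a4 - kj * b4) = 0.
    by transitivity (s * a3 + t * a4 - kj * (s * b3 + t * b4)); [ring | rewrite h1 subrr].
  case/orP: st => [ns|nt]; [apply: (mulfI ns) | apply: (mulfI nt)]; rewrite mulr0.
    transitivity ((s * (a1 - ki * b1) + t * (a2 - ki * b2)) * (a4 - kj * b4)
      - (s * (a3 - kj * b3) + t * (a4 - kj * b4)) * (a2 - ki * b2)); first by ring.
    by rewrite e1 e2; ring.
  transitivity ((s * (a3 - kj * b3) + t * (a4 - kj * b4)) * (a1 - ki * b1)
    - (s * (a1 - ki * b1) + t * (a2 - ki * b2)) * (a3 - kj * b3)); first by ring.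
  by rewrite e1 e2; ring.
pose W := wedge P Q.
pose good i j := [/\ W (al i) (al j) = 0, W (al i) (be j) = 0,
      W (be i) (al j) = 0 & W (be i) (be j) = 0].
have sym i' j' : good i' j' -> good j' i'.
  by rewrite /good /W => -[h1 h2 h3 h4]; split; rewrite wedge_antisym ?h1 ?h2 ?h3 ?h4 oppr0.
have g01 : good 0 1.
  have [|[c1 c2 _] [c0 c4 _ _]] := norm_indep hL (c0 := W (al 0) (al 1))
    (c1 := - W (be 0) (al 1)) (c2 := - W (al 0) (be 1)) (c3 := 0)
    (c4 := W (be 0) (be 1)) (c5 := 0) (c6 := 0).
    by move=> z nz k; rewrite -[RHS](rel z nz 0 1) /= -/k -/W; ring.
  by split=> //; apply/eqP; rewrite -oppr_eq0 ?c1 ?c2.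
have g12 : good 1 2.
  have [|[_ c2 c3] [c0 _ c5 _]] := norm_indep hL (c0 := W (al 1) (al 2))
    (c1 := 0) (c2 := - W (be 1) (al 2)) (c3 := - W (al 1) (be 2))
    (c4 := 0) (c5 := W (be 1) (be 2)) (c6 := 0).
    by move=> z nz k; rewrite -[RHS](rel z nz 1 2) /= -/k -/W; ring.
  by split=> //; apply/eqP; rewrite -oppr_eq0 ?c2 ?c3.
have g02 : good 0 2.
  have [|[c1 _ c3] [c0 _ _ c6]] := norm_indep hL (c0 := W (al 0) (al 2))
    (c1 := - W (be 0) (al 2)) (c2 := 0) (c3 := - W (al 0) (be 2))
    (c4 := 0) (c5 := 0) (c6 := W (be 0) (be 2)).
    by move=> z nz k; rewrite -[RHS](rel z nz 0 2) /= -/k -/W; ring.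
  by split=> //; apply/eqP; rewrite -oppr_eq0 ?c1 ?c3.
by elim/ord3P: i; elim/ord3P: j => // _; try exact: g01; try exact: g12; try exact: g02;
   apply: sym.
Qed.

Hypotheses (Pg : P \in g) (Qg : Q \in g) (nP : P != 0).
Hypothesis indPQ : forall s t, s *: P + t *: Q = 0 -> s = 0 /\ t = 0.

Lemma transversal_x0 w : w \in g -> lf (cf 0 0) w = 0.
Proof.
move=> wg; have [_ gS _ _] := hg; have wS := subvP gS _ wg.
have /matrixP/(_ 0 0) : w *m cf 0 0 = 0; last by rewrite [RHS]mxE.
apply: mapv_mulmx0 wS => v vS; apply/matrixP => k1 k2; rewrite !ord1 [RHS]mxE.
by rewrite -[LHS]/(lf (cf 0 0) (emb v)) lf_emb /=; apply/eqP; rewrite -(frame_Sigma hfr).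
Qed.

(** If these minors vanished as well, all minors of P, Q would, and P and Q would be
    proportional. *)
Lemma transversal_pair : exists i, wedge P Q (al i) (be i) != 0.
Proof.
apply: contrapT => no.
have ab i : wedge P Q (al i) (be i) = 0.
  by apply/eqP; apply: contrapT => h; apply: no; exists i; apply/negP.
have self l : wedge P Q l l = 0 by rewrite /wedge; ring.
have key (l : 'cV[L]_7) : lf l P != 0 ->
    (forall i, wedge P Q l (al i) = 0) -> (forall i, wedge P Q l (be i) = 0) -> False.
  move=> nl hal hbe.
  have [|_ /eqP] := indPQ (s := - lf l Q) (t := lf l P); last by rewrite (negPf nl).
  apply: lf_inj => [|i|i]; rewrite lfD !lfZ.
  - by rewrite !transversal_x0 // !mulr0 addr0.
  - by rewrite -(hal i) /wedge; ring.
  - by rewrite -(hbe i) /wedge; ring.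
have allal i j : wedge P Q (al i) (al j) = 0 /\ wedge P Q (al i) (be j) = 0.
  by have [->|nij] := eqVneq i j; [rewrite self ab | have [] := wedge_zero nij].
have allbe i j : wedge P Q (be i) (al j) = 0 /\ wedge P Q (be i) (be j) = 0.
  have [->|nij] := eqVneq i j; last by have [] := wedge_zero nij.
  by rewrite self wedge_antisym ab oppr0.
case/eqP: nP; apply: lf_inj => [|i|i]; first exact: transversal_x0.
  apply/eqP; apply: contrapT => /negP h.
  by apply: (key _ h) => j; have [] := allal i j.
apply/eqP; apply: contrapT => /negP h.
by apply: (key _ h) => j; have [] := allbe i j.
Qed.

Lemma transversal_full : exists i : 'I_3, forall w, lf (cf 0 0) w = 0 ->
  (forall j, j != i -> lf (al j) w = 0 /\ lf (be j) w = 0) -> w \in g.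
Proof.
have [i ni] := transversal_pair; exists i => w w0 wj.
set d := wedge P Q (al i) (be i) in ni.
(* Cramer's rule in the coordinates ([al i], [be i]); the other pairs vanish on P and Q by the
   Plücker identity used in [vanish]. *)
pose s := (lf (al i) w * lf (be i) Q - lf (be i) w * lf (al i) Q) / d.
pose t := (lf (al i) P * lf (be i) w - lf (be i) P * lf (al i) w) / d.
have vanish (l : 'cV[L]_7) : wedge P Q (al i) l = 0 -> wedge P Q (be i) l = 0 ->
    lf l P = 0 /\ lf l Q = 0.
  move=> h1 h2; split; apply: (mulfI ni); rewrite mulr0.
    transitivity (wedge P Q (al i) l * lf (be i) P - wedge P Q (be i) l * lf (al i) P).
      by rewrite /d /wedge; ring.
    by rewrite h1 h2; ring.
  transitivity (wedge P Q (al i) l * lf (be i) Q - wedge P Q (be i) l * lf (al i) Q).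
    by rewrite /d /wedge; ring.
  by rewrite h1 h2; ring.
suff : w - (s *: P + t *: Q) = 0.
  by move/eqP; rewrite subr_eq0 => /eqP->; rewrite rpredD // rpredZ.
apply: lf_inj => [|j|j]; rewrite lfB lfD !lfZ.
- by rewrite w0 !transversal_x0 // !mulr0 addr0 subr0.
- have [->|nj] := eqVneq j i.
    by rewrite /s /t /d /wedge; field; exact: ni.
  have [wa wb] := wj _ nj; rewrite eq_sym in nj; have [h1 h2 h3 h4] := wedge_zero nj.
  by have [-> ->] := vanish _ h1 h3; rewrite wa !mulr0 addr0 subr0.
- have [->|nj] := eqVneq j i.
    by rewrite /s /t /d /wedge; field; exact: ni.
  have [wa wb] := wj _ nj; rewrite eq_sym in nj; have [h1 h2 h3 h4] := wedge_zero nj.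
  by have [-> ->] := vanish _ h2 h4; rewrite wb !mulr0 addr0 subr0.
Qed.

End Line.

(* Each transversal line consists of the points at infinity where the pairs
   (al j, be j) vanish for j different from some fixed i. *)
Lemma transversal_lineP CC g :
    (forall z, z != 0 -> exists2 A, CC A & ctype G H (frob \o frob) z A) ->
    transversal_line Sigma CC g ->
  exists i : 'I_3, forall w, lf (cf 0 0) w = 0 ->
    (forall j, j != i -> lf (al j) w = 0 /\ lf (be j) w = 0) -> w \in g.
Proof.
move=> hCC hg; have [fg _ _ _] := hg.
have sb : size (vbasis g) = 2%N by rewrite size_tuple fg.
have bg := vbasisP g.
case: (tval (vbasis g)) sb bg => [|P [|Q [|R s]]] // _ bg.
have [Pg Qg] : P \in g /\ Q \in g.
  by split; apply: (basis_mem bg); rewrite !inE eqxx ?orbT.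
have fr := basis_free bg.
have nP : P != 0 by apply: (free_not0 fr); rewrite mem_head.
apply: (transversal_full hCC hg) Pg Qg nP _ => [w|s t].
  rewrite -(span_basis bg) span_cons span_seq1 => /memv_addP[_ /vlineP[s ->] [_ /vlineP[t ->] ->]].
  by exists s, t.
move=> st; move: fr; rewrite free_cons span_seq1 seq1_free => /andP[nPQ nQ].
have s0 : s = 0.
  apply/eqP; apply: contraNT nPQ => ns; apply/vlineP; exists (- (t / s)).
  apply: (scalerI ns); rewrite scalerA mulrN mulrC divfK // scaleNr.
  by apply/eqP; rewrite -addr_eq0 st.
split=> //; move/eqP: st; rewrite s0 scale0r add0r scaler_eq0 (negPf nQ) orbF.
by move/eqP.
Qed.

End Transversal.

(** * The twisted cubic of a special conic *)

Section Cubic.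
Variables (F : finFieldType) (L : fieldExtType F).

Local Notation emb := (map_mx (in_alg L)).
Local Notation frob := (@frob F L).
Local Notation fr := (map_poly frob).

Variables (Sigma : {vspace 'rV[F]_7}) (linf : {vspace 'rV[L]_3}).
Variables (G : 'M[L]_(7, 3)) (M H : 'M[L]_3) (a : 'cV[L]_3).
Hypothesis hfr : bb_frame Sigma linf G M H a.

Let hL := frame_dim hfr.

Lemma crow_conj (f : 7.-tuple {poly_4 F}) i j :
  (crow (in_alg L) f *m map_mx polyC (cf G H i j)) 0 0 = iter i (map_poly frob) (ccoord G H f 0 j).
Proof.
elim: i => [|i IH] /=.
  by rewrite /ccoord [LHS]mxE [RHS]mxE; apply: eq_bigr => k _; rewrite !mxE.
rewrite -IH !mxE rmorph_sum; apply: eq_bigr => k _.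
by rewrite !mxE rmorphM /= map_polyC frp_alg.
Qed.

Lemma lf_cval (f : 7.-tuple {poly_4 F}) i j s :
  lf (cf G H i j) (cval (in_alg L) f (Some s)) = (iter i (map_poly frob) (ccoord G H f 0 j)).[s].
Proof. by rewrite -crow_conj /lf cvalE -map_ev_mul [LHS]mxE. Qed.

Section Roots.
Variable c : 3.-tuple {poly_3 F}.
Hypotheses (span_c : cspan L c) (c0 : forall t, cval idfun c t != 0).
Local Notation p := (ppoly a c).
Variable t : L.
Hypothesis ht : conj_root a c t.

Let k := lead_coef p.
Let t1 := frob t.
Let t2 := frob (frob t).

(** A point with coordinates in [F] has x nonzero, by independence of [a], so no root of p lies in
    [F]. *)
Lemma root_not_base s : root p s -> frob s != s.
Proof.
move=> /rootP ps; apply/negP => /eqP /frob_fixed[b sb].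
have := ev_ppoly_neq0 hfr (c0 (Some b)).
by rewrite /= -sb ps eqxx.
Qed.

Let nt : t1 != t. Proof. by apply: root_not_base; case: ht. Qed.

Let nt2 : t2 != t.
Proof.
by rewrite /t2; apply: contra nt => /eqP h; rewrite /t1 -{1}h frob3.
Qed.

Let nt12 : t2 != t1.
Proof. by apply: contra nt => /eqP/(fmorph_inj frob)/eqP. Qed.

Let t3 : frob t2 = t. Proof. exact: frob3. Qed.

Let k0 : k != 0.
Proof. by rewrite lead_coef_eq0 -size_poly_gt0 (size_ppoly3 hfr span_c). Qed.

Let e0 : {poly L} := 'X - t%:P.
Let e1 : {poly L} := 'X - t1%:P.
Let e2 : {poly L} := 'X - t2%:P.

Let fe s : fr ('X - s%:P) = 'X - (frob s)%:P.
Proof. by rewrite rmorphB /= map_polyX map_polyC. Qed.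

Lemma ppoly_roots : p = k%:P * (e0 * e2).
Proof.
have [r0 r1] := ht.
have r2 : root p t2.
  apply/rootP/eqP; rewrite -[_ == 0]frob_eq0 -horner_frp t3; exact: r1.
have ur : uniq_roots [:: t; t2] by rewrite uniq_rootsE /= inE eq_sym nt2.
have pE : p = lead_coef p *: \prod_(z <- [:: t; t2]) ('X - z%:P).
  by apply: all_roots_prod_XsubC ur; rewrite ?(size_ppoly3 hfr span_c) //= r0 r2.
by rewrite {1}pE !big_cons big_nil mulr1 -mul_polyC.
Qed.

Definition special_factor : {poly L} := (k^-1)%:P * ('X - t1%:P).
Local Notation h := special_factor.

Let k1 := frob k.
Let k2 := frob (frob k).
Let k2n : k2 != 0. Proof. by rewrite !frob_eq0. Qed.

Let frp1 : fr p = k1%:P * (e1 * e0).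
Proof. by rewrite {1}ppoly_roots !rmorphM /= map_polyC !fe t3. Qed.

Let frp2 : fr (fr p) = k2%:P * (e2 * e1).
Proof. by rewrite frp1 !rmorphM /= map_polyC !fe. Qed.

Let hp0 : h * p = e0 * e1 * e2.
Proof.
rewrite {1}ppoly_roots /h -/e1 mulrACA -polyCM mulVf // mul1r; ring.
Qed.

Let hp1 : h * fr p = (k1 / k)%:P * (e1 * e1 * e0).
Proof. by rewrite frp1 /h -/e1 polyCM; ring. Qed.

Let hp2 : h * fr (fr p) = (k2 / k)%:P * (e1 * e1 * e2).
Proof. by rewrite frp2 /h -/e1 polyCM; ring. Qed.

Lemma special_curve : exists f : 7.-tuple {poly_4 F},
  [/\ ccoord G H f = h *: pcoord a c,
      induced_param G M [set pgl M (ext L p) | p in curve c]%classic c f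
    & normal_rational_curve f].
Proof.
have sh : (size h <= 2)%N by rewrite /h mul_polyC size_scale ?invr_eq0 // size_XsubC.
have [s||f [fc pts ind]] := @induced_curve _ _ _ _ _ _ _ _ hfr 3 2 1 c h erefl sh c0.
- rewrite /h evCM mulf_neq0 ?invr_eq0 //; case: s => [x|] /=.
    rewrite !hornerE subr_eq0; apply: contra nt => /eqP h1.
    have h2 : frob t1 = t1 by rewrite -h1; exact: frob_alg.
    exact/eqP/(fmorph_inj frob).
  by rewrite coefB coefX coefC subr0 oner_eq0.
- by rewrite hp0 !rmorphM /= !fe t3; rewrite mulrC mulrA.
exists f; split=> //.
apply: (nrc_spanning hfr fc span_c); apply: linear_spanning => //.
by rewrite invr_eq0.
Qed.

Variable f : 7.-tuple {poly_4 F}.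
Hypothesis fc : ccoord G H f = h *: pcoord a c.

Let cc0 : ccoord G H f 0 0 = e0 * e1 * e2.
Proof. by rewrite fc pcoordE !mxE /= hp0. Qed.
Let cc1 : ccoord G H f 0 1 = (k1 / k)%:P * (e1 * e1 * e0).
Proof. by rewrite fc pcoordE !mxE /= hp1. Qed.
Let cc2 : ccoord G H f 0 2 = (k2 / k)%:P * (e1 * e1 * e2).
Proof. by rewrite fc pcoordE !mxE /= hp2. Qed.

Lemma special_curve_pair (i : 'I_3) : exists s,
  lf (cf G H 0 0) (cval (in_alg L) f (Some s)) = 0 /\
  forall j, j != i -> lf (al G H j) (cval (in_alg L) f (Some s)) = 0 /\
                      lf (be G H j) (cval (in_alg L) f (Some s)) = 0.
Proof.
have fe0 : fr e0 = e1 by rewrite fe.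
have fe1 : fr e1 = e2 by rewrite fe.
have fe2 : fr e2 = e0 by rewrite fe t3.
have r0 : e0.[t] = 0 by rewrite hornerXsubC subrr.
have r1 : e1.[t1] = 0 by rewrite hornerXsubC subrr.
have r2 : e2.[t2] = 0 by rewrite hornerXsubC subrr.
(* Up to constants the pairs ([al], [be]) are (e1^2 e0, e0^2 e1), (e2^2 e1, e1^2 e2) and (e0^2 e2,
   e2^2 e0); the chosen parameter is a common zero of the two pairs other than i. *)
exists (if i == 0 then t2 else if i == 1 then t else t1).
rewrite lf_cval /= cc0; split.
  by rewrite !hornerM; elim/ord3P: i => /=; rewrite ?r0 ?r1 ?r2 ?(mulr0, mul0r).
move=> j; rewrite /al /be !lf_cval cc1 cc2.
by elim/ord3P: i; elim/ord3P: j => //= _;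
  rewrite !(rmorphM, fe0, fe1, fe2) /= !(fe0, fe1, fe2) !hornerM ?r0 ?r1 ?r2 !(mulr0, mul0r).
Qed.

(* With w = t - t^q, the affine space {X_1 + k X_2^(q^2) = c X_0} containing
   the curve meets Sigma in the plane of the cover with this parameter. *)
Definition special_z : L := (frob (t - t1) * k2)^-1.

Let w1 := t1 - t2.
Let w2 := t2 - t.
Let nw1 : w1 != 0. Proof. by rewrite subr_eq0 eq_sym. Qed.
Let nw2 : w2 != 0. Proof. by rewrite subr_eq0. Qed.
Let zE : special_z = (w1 * k2)^-1.
Proof. by rewrite /special_z rmorphB. Qed.
Let fzE : frob special_z = (w2 * k)^-1.
Proof. by rewrite zE fmorphV rmorphM rmorphB /= t3 frob3. Qed.

Lemma special_z_neq0 : special_z != 0.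
Proof. by rewrite zE invr_eq0 mulf_neq0. Qed.

Lemma special_relation : exists m : L,
  special_z%:P * ccoord G H f 0 1 + (frob special_z)%:P * fr (fr (ccoord G H f 0 2))
   = m%:P * ccoord G H f 0 0.
Proof.
pose A1 := special_z * (k1 / k); pose A2 := frob special_z * (k1 / k2).
exists (A1 + A2).
(* After division by e0 e1 the relation is linear, and [special_z] is chosen so that A1 e1 + A2 e0
   has the root t2. *)
have A12 : A1 * t1 + A2 * t = (A1 + A2) * t2.
  by rewrite /A1 /A2 fzE zE /w1 /w2; field; rewrite k0 k2n -/w1 -/w2 nw1 nw2.
have fe0 : fr e0 = e1 by rewrite fe.
have fe1 : fr e1 = e2 by rewrite fe.
have fe2 : fr e2 = e0 by rewrite fe t3.
have e01 : A1%:P * e1 + A2%:P * e0 = (A1 + A2)%:P * e2.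
  rewrite /e0 /e1 /e2 !mulrBr -!polyCM -A12 !polyCD; ring.
have frC x q : fr (x%:P * q) = (frob x)%:P * fr q.
  by rewrite rmorphM /= map_polyC.
have kE : frob (frob (k2 / k)) = k1 / k2.
  by rewrite !fmorph_div /= /k2 frob3.
have frM (q r : {poly L}) : fr (q * r) = fr q * fr r by rewrite rmorphM.
rewrite cc0 cc1 cc2 !frC kE !frM !(fe0, fe1, fe2).
transitivity ((A1%:P * e1 + A2%:P * e0) * (e0 * e1)); last by rewrite e01; ring.
by rewrite (polyCM special_z) (polyCM (frob special_z)); ring.
Qed.

Lemma special_lead : bbc G H (coefrow f 3) 0 0 = 1.
Proof.
have mon : e0 * e1 * e2 \is monic by rewrite !monicMl ?monicXsubC.
have se : size (e0 * e1 * e2) = 4%N.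
  by rewrite !size_mul ?mulf_neq0 ?polyXsubC_eq0 // !size_XsubC.
by rewrite bbc_coefrow cc0; move/monicP: mon; rewrite /lead_coef se.
Qed.

(** Subtracting a multiple of the leading coefficient vector makes X_0 zero, and the linear relation
    then becomes the equation of the plane. Working with coefficients rather than points also
    controls the extended curve. *)
Lemma special_space A : ctype G H (frob \o frob) special_z A -> forall j : nat,
  coefrow f j \in (A + <[coefrow f 3]>)%VS.
Proof.
move=> hA j; have [b hb] := frame_base hfr (coefrow f j); rewrite -/(bbc G H _) in hb.
rewrite -[coefrow f j](subrK (b *: coefrow f 3)) memv_add //; last first.
  by rewrite memvZ ?memv_line.
apply/hA; have [m hm] := special_relation.
have cE i : bbc G H (coefrow f j - b *: coefrow f 3) 0 i =
    bbc G H (coefrow f j) 0 i - b%:A * bbc G H (coefrow f 3) 0 i.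
  by rewrite -scaleNr bbcD bbcZ scaleNr [LHS]mxE [X in _ + X]mxE mulNr.
have rel l : special_z * bbc G H (coefrow f l) 0 1 +
    frob special_z * frob (frob (bbc G H (coefrow f l) 0 2)) = m * bbc G H (coefrow f l) 0 0.
  have := congr1 (fun q : {poly L} => q`_l) hm.
  by rewrite /= coefD !coefCM !coef_map /= -!bbc_coefrow.
split; first by rewrite cE special_lead mulr1 hb subrr.
apply/eqP; rewrite mulNr -addr_eq0 !cE /= !rmorphB !rmorphM /= !frob_alg.
have r1 := rel j; have r2 := rel 3%N; rewrite special_lead hb in r1 r2.
apply/eqP.
transitivity (special_z * bbc G H (coefrow f j) 0 1 +
    frob special_z * frob (frob (bbc G H (coefrow f j) 0 2)) -
    b%:A * (special_z * bbc G H (coefrow f 3) 0 1 +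
    frob special_z * frob (frob (bbc G H (coefrow f 3) 0 2)))); first by ring.
by rewrite r1 r2; ring.
Qed.

Lemma cval_coefrow (s : option L) : exists x : 'I_4 -> L,
  cval (in_alg L) f s = \sum_j x j *: emb (coefrow f j).
Proof.
exists (fun j : 'I_4 => if s is Some y then y ^+ j else (j == 3%N :> nat)%:R).
apply/rowP => i; rewrite summxE [LHS]mxE.
case: s => [y|].
  rewrite (@horner_coef_wide _ 4) ?size_crow //.
  by apply: eq_bigr => j _; rewrite !mxE coef_map mulrC.
rewrite !big_ord_recl big_ord0 !mxE /= coef_map.
by rewrite !mul0r !add0r mul1r addr0.
Qed.

Lemma special_twisted CC :
    (forall z, z != 0 -> exists2 A, CC A & ctype G H (frob \o frob) z A) ->
    (forall A, CC A -> \dim A = 3%N /\ (A <= Sigma)%VS) ->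
    normal_rational_curve f ->
  special_twisted_cubic L Sigma CC f.
Proof.
move=> hCC hCC' nf; split=> //.
have [A CA hA] := hCC _ special_z_neq0.
have [dA AS] := hCC' A CA.
have x3S : coefrow f 3 \notin Sigma.
  by rewrite (frame_Sigma hfr) -/(bbc G H _) special_lead oner_eq0.
have x3U : coefrow f 3 \in (A + <[coefrow f 3]>)%VS.
  by rewrite -[X in X \in _]add0r memv_add ?mem0v ?memv_line.
exists (A + <[coefrow f 3]>)%VS; split.
- rewrite /flat /= dimv_disjoint_sum ?dA ?dim_vline.
    by rewrite (contraNneq _ x3S) // => ->; rewrite mem0v.
  apply/eqP; rewrite -subv0; apply/subvP => u; rewrite memv_cap => /andP[uA].
  case/vlineP => b ub; rewrite ub memv0 scaler_eq0.
  have [//|nb] := eqVneq b 0; case/negP: x3S.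
  by rewrite -[coefrow f 3](scalerK nb) -ub rpredZ // (subvP AS).
- by apply: contra x3S => /subvP; apply.
- by exists A => //; apply: addvSl.
- move=> _ [s _ <-]; rewrite /cpoint -memvE.
  have [x ->] := cval_coefrow s.
  apply: rpred_sum => j _; rewrite rpredZ //; apply: memv_mapv.
  exact: special_space.
move=> g hg; have [i hi] := transversal_lineP hfr hCC hg.
have [s [s0 sj]] := special_curve_pair i.
exists (cpoint (in_alg L) f (Some s)); first by exists (Some s).
by rewrite /cpoint -memvE; apply: hi.
Qed.

End Roots.
End Cubic.

(** * Existence of the coordinate frame *)

Section Frame.
Variables (F : finFieldType) (L : fieldExtType F).
Hypothesis hL : \dim {:L} = 3%N.
Variables (Sigma : {vspace 'rV[F]_7}) (S : set {vspace 'rV[F]_7}).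
Variables (linf : {vspace 'rV[L]_3}) (G : 'M[L]_(7, 3)) (M : 'M[L]_3).
Hypotheses (hSigma : flat 5 Sigma) (hS : regular_spread Sigma S).
Hypotheses (hlinf : flat 1 linf) (hG : bruck_bose Sigma S linf G).
Hypotheses (uM : M \in unitmx) (hext : exterior linf M).

(** The entries of a = M l are the values of the form of [linf] at the base points of the subplane;
    their independence over [F] is exactly exteriority. *)
Lemma frame_exists : exists H a, bb_frame Sigma linf G M H a.
Proof.
have [l [hl hF hlift]] := bruck_bose_coord hL hSigma hS hlinf hG.
pose a := M *m l; pose H := invmx M *m moore a.
have Hl (y : 'rV[L]_3) : (y *m H) 0 0 = (y *m l) 0 0.
  have -> : (y *m H) 0 0 = (y *m invmx M *m a) 0 0.
    by rewrite /H mulmxA !mxE; apply: eq_bigr => i _; rewrite [moore a _ _]mxE.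
  by rewrite /a mulmxA mulmxKV.
have H0 (y : 'rV[L]_3) : (y *m l == 0) = ((y *m H) 0 0 == 0).
  rewrite Hl; apply/eqP/eqP => [->|yl]; first by rewrite mxE.
  by apply/matrixP => i j; rewrite !ord1 [RHS]mxE.
exists H, a; split=> //.
- move=> v va; apply/eqP/negPn/negP => nv.
  have : subplane M (pgl M (ext L <[v]>%VS)).
    by exists <[v]>%VS => //; apply: flat0_line.
  move/hext; rewrite /ext mapv_line pgl_line -memvE hl H0 Hl -mulmxA -/a va.
  by rewrite eqxx.
- by rewrite /H mulKVmx.
- by move=> y; rewrite hl H0.
- by move=> x; rewrite (mem_Sigma hG) hl H0.
- by move=> x; have [b hb] := hF x; exists b; rewrite Hl.
- exact: (bb_inj hSigma hG).
- by move=> y b; rewrite Hl; apply: hlift.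
Qed.

End Frame.

(** * The type of the conic cover and arbitrary parametrisations of a conic *)

Section Main.
Variables (F : finFieldType) (L : fieldExtType F).
Variables (Sigma : {vspace 'rV[F]_7}) (linf : {vspace 'rV[L]_3}).
Variables (G : 'M[L]_(7, 3)) (M H : 'M[L]_3) (a : 'cV[L]_3).
Hypothesis hfr : bb_frame Sigma linf G M H a.

Lemma cover_type_eq t X Y : t 1 = 1 ->
    splash_cover Sigma linf G M X -> splash_cover Sigma linf G M Y ->
    (forall A, X A -> exists2 z, z != 0 & ctype G H t z A) ->
    (forall A, Y A -> exists2 z, z != 0 & ctype G H t z A) ->
  (X `<=` Y)%classic.
Proof.
move=> t1 cX cY hX hY A /hX[z nz hA].
have [B YB hB] := cover_full hfr cY t1 hY nz.
by rewrite (ctype_eq hA hB).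
Qed.

(** Two covers of the same type coincide, and the first type is taken by the tangent cover. *)
Lemma conic_cover_type CC : conic_cover Sigma linf G M CC ->
  forall A, CC A -> exists2 z, z != 0 & ctype G H (frob (L := L) \o frob (L := L)) z A.
Proof.
move=> [cC [T tT nT]]; have [cT _] := tT.
have hT := tangent_cover_type hfr tT.
have [hC|//] := cover_type hfr cC.
have f1 : frob (1 : L) = 1 by rewrite rmorph1.
by case: nT; apply/seteqP; split; apply: (cover_type_eq f1).
Qed.

Section Conic.
Variables (A : 'M[F]_3) (T : 'M[F]_3) (f : F).
Hypotheses (uT : T \in unitmx) (f0 : f != 0).
Hypothesis qT : forall (R : comNzRingType) (g : {rmorphism F -> R}) (w : 'rV[R]_3),
  qform (map_mx g A) (w *m map_mx g T) = w 0 0 * w 0 1 + g f * w 0 2 ^+ 2.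

(** A functional killing the coefficient vectors of the parametrisation on the coordinate side would
    be a line containing all points of the conic. *)
Lemma curve_span (c : 3.-tuple {poly_3 F}) : curve c = qpoints A -> cspan L c.
Proof.
move=> cA; pose C : 'M[F]_3 := \matrix_(k, j) (tnth c j : {poly F})`_k.
have crowE (K : fieldType) (iota : {rmorphism F -> K}) :
    crow iota c = (\row_(k < 3) 'X^k) *m map_mx polyC (map_mx iota C).
  apply/rowP => j; rewrite !mxE [LHS](_ : _ = \poly_(k < 3) (map_poly iota (tnth c j))`_k).
    rewrite poly_def; apply: eq_bigr => k _.
    by rewrite !mxE coef_map -mul_polyC mulrC.
  apply/polyP => k; rewrite coef_poly; case: ltnP => // ge.
  by rewrite nth_default // size_map_poly (leq_trans (size_npoly _)).
have uC : C \in unitmx.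
  rewrite -unitmx_tr -row_free_unit; apply: inj_row_free => r r0.
  have Cr : C *m r^T = 0 by rewrite -[C]trmxK -trmx_mul r0 trmx0.
  suff : r^T = 0 by move=> /(congr1 trmx); rewrite trmxK trmx0.
  apply: (conic_indep uT qT (iota := idfun)) => v nv qv; rewrite map_mx_id //.
  have : qpoints A <[v]>%VS.
    split=> [|_ /vlineP[k ->]]; first exact: flat0_line.
    rewrite /qform -scalemxAl -scalemxAl linearZ /= -scalemxAr scalerA.
    rewrite (_ : _ *m _ = 0) ?scaler0 ?mxE //.
    by apply/matrixP => i j; rewrite !ord1 [RHS]mxE; exact: qv.
  rewrite -cA => -[t _ /esym vt]; have := memv_line v; rewrite vt => /vlineP[k ->].
  rewrite cvalE crowE map_mx_id // map_ev_mul -scalemxAl -mulmxA Cr mulmx0 scaler0 //.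
move=> q sq; pose y : 'cV[L]_3 := \col_k q`_k.
have uCL : map_mx (in_alg L) C \in unitmx by rewrite map_unitmx.
exists (invmx (map_mx (in_alg L) C) *m y).
rewrite crowE -mulmxA -map_mxM mulKVmx //.
apply/matrixP => i j; rewrite !ord1 !mxE mulr1n.
rewrite [LHS](_ : _ = \poly_(k < 3) q`_k).
  by rewrite poly_def; apply: eq_bigr => k _; rewrite !mxE -mul_polyC mulrC.
apply/polyP => k; rewrite coef_poly; case: ltnP => // ge.
by rewrite nth_default // (leq_trans sq).
Qed.

Lemma special_conj_root : special_conic linf M A -> exists t, conj_root a (conic_param T f) t.
Proof.
move=> /(special_conicP hfr)[[v [nv qv] [v0 v1]] _ _].
have [t [k nk vE]] := conic_pointP uT f0 qT nv qv.
have sp : cspan L (conic_param T f) by move=> q; apply: conic_span.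
have cm : (cval (in_alg L) (conic_param T f) t *m moore a) 0 0 = 0 /\
    (cval (in_alg L) (conic_param T f) t *m moore a) 0 1 = 0.
  have e i : (v *m moore a) 0 i = k * (cval (in_alg L) (conic_param T f) t *m moore a) 0 i.
    by rewrite vE -scalemxAl [LHS]mxE.
  by split; apply: (mulfI nk); rewrite mulr0 -e.
move: cm; rewrite (cval_moore a) !mxE /=; case: t {vE} => [t|] /= [p0 p1].
  by exists t; split; apply/rootP.
(* The vertex cannot sit at infinity, where the value is the leading coefficient of p. *)
have := size_ppoly3 hfr sp => s3; have : ppoly a (conic_param T f) != 0.
  by rewrite -size_poly_gt0 s3.
by rewrite -lead_coef_eq0 /lead_coef s3 /= p0 eqxx.
Qed.

End Conic.
End Main.

Theorem corollary3p8 (F : finFieldType) (L : fieldExtType F)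
    (hL : \dim {:L} = 3%N)
    (Sigma : {vspace 'rV[F]_7}) (hSigma : flat 5 Sigma)
    (S : set {vspace 'rV[F]_7}) (hS : regular_spread Sigma S)
    (linf : {vspace 'rV[L]_3}) (hlinf : flat 1 linf)
    (G : 'M[L]_(7, 3)) (hG : bruck_bose Sigma S linf G)
    (M : 'M[L]_3) (hM : M \in unitmx) (hext : exterior linf M)
    (CC : set {vspace 'rV[F]_7}) (hCC : conic_cover Sigma linf G M CC)
    (A : 'M[F]_3) (hA : irreducible_conic A) :
  (special_conic linf M A <->
     exists2 f : 7.-tuple {poly_4 F},
       bb_conic_param G M A f & special_twisted_cubic L Sigma CC f) /\
  (~ special_conic linf M A ->
     exists2 f : 7.-tuple {poly_7 F},
       bb_conic_param G M A f & normal_rational_curve f).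
Proof.
have [H [a hfr]] := frame_exists hL hSigma hS hlinf hG hM hext.
have [T [f0 [uT nf0 qT]]] := conic_normal_form L hA.
pose c := conic_param T f0.
have sp : cspan L c by move=> q; apply: conic_span.
have c0 t : cval idfun c t != 0 by apply: (cval_conic_neq0 uT nf0).
have ceq : qform (map_mx polyC A) (crow idfun c) = 0 := conic_param_eq qT.
have cA : curve c = qpoints A := curve_conic uT nf0 qT.
have [cC _] := hCC.
split; [split|].
- move=> /(special_conj_root hfr uT nf0 qT)[t ht].
  have [f [fc ind nf]] := special_curve hfr sp c0 ht.
  exists f; first by exists c => //; rewrite /conic -cA.
  apply: (special_twisted hfr sp c0 ht fc) => // [z nz|B CB].
    apply: (cover_full hfr cC) nz; first by rewrite /= !rmorph1.
    exact: (conic_cover_type hfr hCC).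
  by have [hB _ _ _ _] := cC; have [] := hB B CB.
- move=> [f [c' c'eq ind] [nf _]].
  have [pts _ _] := ind.
  have sp' : cspan L c'.
    apply: (curve_span uT qT); apply/seteqP; split => p hp.
      have : conic M A (pgl M (ext L p)) by rewrite -pts; exists p.
      by case=> p' hp' /(pgl_ext_inj hfr)<-.
    have : [set pgl M (ext L p) | p in curve c']%classic (pgl M (ext L p)).
      by rewrite pts; exists p.
    by case=> p' hp' /(pgl_ext_inj hfr)<-.
  (* A normal rational lift of degree 3 < 6 excludes the coprime case. *)
  have [cp|[t ht]] := coprime_or_conj_root hfr sp'.
    by case: (coprime_degree hfr sp' _ cp ind nf).
  exact: (conj_root_special hfr sp' c'eq ht).
move=> ns; have cp : coprimep (ppoly a c) (map_poly (@frob F L) (ppoly a c)).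
  have [//|[t ht]] := coprime_or_conj_root hfr sp.
  by case: ns; apply: (conj_root_special hfr sp ceq ht).
have [f [fc pts ind nf]] := @norm_curve _ _ _ _ _ _ _ _ hfr 6 2 c erefl c0 sp (size_ppoly3 hfr sp) cp.
by exists f => //; exists c => //; rewrite /conic -cA.
Qed.
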